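(* For any integer $m$ with $0\leq m\leq 46$, there exists a smooth real sextic curve $C$ in $\mathbb{P}^2_{\mathbb{R}}$ whose avoidance locus $\mathcal{A}_C$ comprises exactly $m$ convex connected components.
   Context: A smooth real sextic is a curve $C=V_{\mathbb{C}}(f)\subset\mathbb{P}^2$ with $f\in\mathbb{R}[x,y,z]_6$ that is smooth over $\mathbb{C}$; $C_{\mathbb{R}}$ denotes its real locus. The avoidance locus $\mathcal{A}_C\subset(\mathbb{P}^2)^\vee_{\mathbb{R}}$ is the set of all real lines in $\mathbb{P}^2_{\mathbb{R}}$ that do not intersect $C_{\mathbb{R}}$. Its connected components are convex (when regarded as cones in $\mathbb{R}^3$). *)

(* Defs.v *)
From HB Require Import structures.
From mathcomp Require Import all_boot all_order all_algebra.
From mathcomp Require Import mpoly complex.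
From mathcomp Require Import all_classical reals topology normedtype convex.

Set Implicit Arguments.
Unset Strict Implicit.
Unset Printing Implicit Defensive.

Import Order.TTheory GRing.Theory Num.Theory.
Import numFieldNormedType.Exports.

Local Open Scope classical_set_scope.
Local Open Scope quotient_scope.
Local Open Scope complex_scope.
Local Open Scope ring_scope.

Section ProjectivePlane.
Variable R : realType.

Definition nonzero_vec : set 'rV[R]_3 := [set v | v != 0].

(* For nonzero u and v, equality of the row spaces means that each of them is
   a scalar multiple of the other. *)
Definition proportional (u v : nonzero_vec) : bool :=
  (set_val u == set_val v)%MS.

Lemma proportional_equiv : equiv_class_of proportional.
Proof.
split=> [u|u v|v u w]; rewrite /proportional.
- exact/eqmxP.
- by apply/eqmxP/eqmxP => ?; exact/eqmx_sym.
- by move=> /eqmxP uv /eqmxP vw; apply/eqmxP; exact: eqmx_trans uv vw.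
Qed.

Canonical proportional_equiv_rel := EquivRelPack proportional_equiv.

Definition RP2 : topologicalType :=
  quotient_topology {eq_quot proportional_equiv_rel}.

Definition proj_point (v : nonzero_vec) : RP2 :=
  \pi_(quotient_topology {eq_quot proportional_equiv_rel}) v.

(* Homogeneous coordinates of a point, chosen up to a nonzero scalar. *)
Definition hcoord (p : RP2) : 'rV[R]_3 :=
  set_val (repr (p : quotient_topology {eq_quot proportional_equiv_rel})).

(* The dual plane is [RP2] as well: the line with homogeneous coordinates
   (a : b : c) is the set of points (x : y : z) with a x + b y + c z = 0. *)
Definition real_line (l : RP2) : set RP2 :=
  [set p | hcoord p *m (hcoord l)^T = 0].

Definition real_locus (f : {mpoly R[3]}) : set RP2 :=
  [set p | f.@[hcoord p 0] = 0].

Definition avoidance_locus (f : {mpoly R[3]}) : set RP2 :=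
  [set l | real_line l `&` real_locus f = set0].

Definition smooth_over_C (f : {mpoly R[3]}) : Prop :=
  let fC : {mpoly R[i][3]} := map_mpoly (real_complex R) f in
  forall v : 'rV[R[i]]_3, v != 0 -> fC.@[v 0] = 0 ->
    exists i : 'I_3, fC^`M(i).@[v 0] != 0.

(* The zero form counts as homogeneous, but it is not smooth. *)
Definition smooth_real_sextic (f : {mpoly R[3]}) : Prop :=
  f \is 6.-homog /\ smooth_over_C f.

Definition connected_components (T : topologicalType) (A : set T) :
    set (set T) :=
  [set connected_component A x | x in A].

(* Openness matters: a half-space {z > 0} together with a half-plane of its
   boundary and a half-line of the boundary of that half-plane is a convex cone
   whose image is all of [RP2].  Allowing 0 in S makes [RP2] itself, the
   avoidance locus of a curve without real points, convex as the image of the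
   cone R^3. *)
Definition open_convex_cone (S : set 'rV[R]_3) : Prop :=
  [/\ open S, convex_set (S : set (convex_lmodType 'rV[R]_3)) &
      forall (t : R) v, 0 < t -> S v -> S (t *: v)].

Definition convex_as_cone (K : set RP2) : Prop :=
  exists2 S, open_convex_cone S &
    K = [set proj_point v | v in [set v | S (set_val v)]].

(* [real_line] and [real_locus] do not depend on the coordinates chosen. *)

Lemma hcoord_proj_point (v : nonzero_vec) :
  exists2 c : R, c != 0 & hcoord (proj_point v) = c *: set_val v.
Proof.
pose Q := quotient_topology {eq_quot proportional_equiv_rel}.
have : proportional (repr (\pi_Q v)) v.
  have : repr (\pi_Q v) = v %[mod {eq_quot proportional_equiv_rel}].
    exact: (@reprK _ Q).
  by move=> /eqquotP.
move=> /andP[/sub_rVP[c cE] _]; exists c => //.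
apply/eqP => c0; have /eqP := set_valP (repr (\pi_Q v)); apply.
by move: cE; rewrite c0 scale0r.
Qed.

Lemma real_lineP (l v : nonzero_vec) :
  real_line (proj_point l) (proj_point v) <-> set_val v *m (set_val l)^T = 0.
Proof.
rewrite /real_line /=.
have [c c0 ->] := hcoord_proj_point l; have [d d0 ->] := hcoord_proj_point v.
rewrite linearZ /= -scalemxAr -scalemxAl scalerA; split=> [/eqP|->].
  by rewrite scaler_eq0 mulf_eq0 (negPf c0) (negPf d0) => /eqP.
by rewrite scaler0.
Qed.

Lemma meval_homogZ (f : {mpoly R[3]}) d (c : R) (v : 'rV[R]_3) :
  f \is d.-homog -> f.@[(c *: v) 0] = c ^+ d * f.@[v 0].
Proof.
move=> /dhomogP fd; rewrite !mevalE mulr_sumr.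
rewrite big_seq [RHS]big_seq; apply: eq_bigr => m /fd /= <-.
rewrite mdegE mulrCA; congr (_ * _).
rewrite -prodrXr -big_split /=; apply: eq_bigr => i _.
by rewrite mxE exprMn.
Qed.

Lemma real_locusP (f : {mpoly R[3]}) d (v : nonzero_vec) :
  f \is d.-homog -> real_locus f (proj_point v) <-> f.@[set_val v 0] = 0.
Proof.
move=> fd; rewrite /real_locus /=.
have [c c0 ->] := hcoord_proj_point v; rewrite (meval_homogZ _ _ fd).
split=> [/eqP|->]; last by rewrite mulr0.
by rewrite mulf_eq0 expf_eq0 (negPf c0) andbF => /eqP.
Qed.

End ProjectivePlane.

(* Main.v *)
From Stdlib Require Import ZArith.
Require Import Defs.
From HB Require Import structures.
From mathcomp Require Import all_boot all_order all_algebra.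
From mathcomp Require Import mpoly complex polyrcf ssrZ zify ring lra.
From mathcomp Require Import all_classical reals topology normedtype convex.
From mathcomp Require Import interval_inference.

(* Write E = x^6 + y^6 + z^6.  If F is a nonnegative sextic with finitely many real
   zeros p_1, ..., p_k, all of them with nondegenerate Hessian, then for small e > 0
   the real curve F = e E consists of convex ovals around the p_i.  A line avoiding it
   misses the p_i, and two such lines lie in one component if and only if they separate
   the p_i in the same way.  The components are thus the regions of the arrangement of
   the k lines dual to the p_i, and their number is 1 + C(k,2) minus a correction for
   collinear triples: 46 for ten points in general position.
   Explicit sextics with ten zeros, certified by sums of squares, and the removal of
   zeros by adding squares of cubics yield all m except 0, 5 and 8.  For m = 5 and 8,
   F is the product of the equation of a disc by (x^2 - z^2)^2 + (y^2 - z^2)^2; for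
   m = 0 it is (x^3 + y^3 + z^3)^2, whose perturbation meets every line.
   The perturbed curve is smooth when 6 e is not a root of a characteristic polynomial
   of Macaulay's matrix, hence for all but finitely many e. *)

Set Implicit Arguments.
Unset Strict Implicit.
Unset Printing Implicit Defensive.

Import Order.TTheory GRing.Theory Num.Theory.
Import numFieldNormedType.Exports.

Local Open Scope classical_set_scope.
Local Open Scope quotient_scope.
Local Open Scope card_scope.
Local Open Scope ring_scope.

(** * Lines and points *)

(** Why 5 and 8 are exceptional: a nonnegative sextic with four collinear zeros restricts to their
    line as a form of degree 6 with four double zeros, so it vanishes on that line. With finitely
    many zeros only collinear triples can occur, and k zeros with t triples give 1 + C(k,2) - t
    regions. These numbers are 1, 2, 3, 4, 6, 7 for 1 <= k <= 4 and at least 9 for k = 5, since five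
    points then have at most two triples; further lines only add regions. A disc forbids more
    patterns than a point does and so reaches 5 and 8. Why a multiplier: the ten zeros impose
    independent conditions on the ten-dimensional space of cubics, so F itself is not a sum of
    squares, as every cubic in it would vanish at all zeros. After multiplication by a quadratic
    form q one may use quartics, of which a space of dimension 15 - 10 = 5 vanishes at the zeros.
    Why the Fermat sextic: it is positive, and its partials are multiples of the pure powers x^5,
    y^5, z^5, so that subtracting e E shifts Macaulay's matrix by a scalar. Regions are counted by
    integer arithmetic: a sign pattern is either realized by a listed line or contradicts a linear
    dependency among the points. *)

Section Points.
Variable R : realType.
Implicit Types u v w l : 'rV[R]_3.

Definition dot u v : R := \sum_i u 0 i * v 0 i.

Lemma dotC u v : dot u v = dot v u.
Proof. by apply: eq_bigr => i _; rewrite mulrC. Qed.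

Lemma dotDl u v w : dot (u + v) w = dot u w + dot v w.
Proof. by rewrite /dot -big_split; apply: eq_bigr => i _; rewrite mxE mulrDl. Qed.

Lemma dotZl c u v : dot (c *: u) v = c * dot u v.
Proof. by rewrite /dot mulr_sumr; apply: eq_bigr => i _; rewrite mxE mulrA. Qed.

Lemma dotDr u v w : dot u (v + w) = dot u v + dot u w.
Proof. by rewrite dotC dotDl dotC [dot w u]dotC. Qed.

Lemma dotZr c u v : dot u (c *: v) = c * dot u v.
Proof. by rewrite dotC dotZl dotC. Qed.

Lemma dotNl u v : dot (- u) v = - dot u v.
Proof. by rewrite -scaleN1r dotZl mulN1r. Qed.

Lemma dotNr u v : dot u (- v) = - dot u v.
Proof. by rewrite dotC dotNl dotC. Qed.

Lemma dot0l u : dot 0 u = 0.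
Proof. by rewrite -(scale0r 0) dotZl mul0r. Qed.

Lemma dot0r u : dot u 0 = 0.
Proof. by rewrite dotC dot0l. Qed.

Lemma dot_mul u v : (u *m v^T = 0) <-> dot u v = 0.
Proof.
have E : (u *m v^T) 0 0 = dot u v by rewrite mxE; apply: eq_bigr => i _; rewrite mxE.
split=> [h|h]; first by rewrite -E h mxE.
by apply/matrixP => i j; rewrite !ord1 E h mxE.
Qed.

Lemma dot_continuous l : continuous (dot l).
Proof.
apply: (@continuous_big R 'I_3 +%R 0 xpredT) => [|i _].
  exact: add_continuous.
move=> w; apply: (@cvgM R _ (nbhs w) _ (fun=> l 0 i) (fun v => v 0 i) (l 0 i)).
  exact: cvg_cst.
exact: coord_continuous.
Qed.

Let one_in : (const_mx 1 : 'rV[R]_3) \in @nonzero_vec R.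
Proof.
rewrite inE /nonzero_vec /=; apply/eqP => /rowP/(_ 0); rewrite !mxE => /eqP.
by rewrite oner_eq0.
Qed.

(** The zero vector is sent to the default (1, 1, 1). This makes [pt] total, so that continuity and
    images can be treated in R^3. *)
Definition nz v : (@nonzero_vec R : Type) := insubd (SigSub one_in : @nonzero_vec R) v.

Lemma nzK v : v != 0 -> set_val (nz v) = v.
Proof. by move=> v0; rewrite /nz set_valE /= insubdK // inE. Qed.

Definition pt v : RP2 R := proj_point (nz v).

Lemma ptP (p : RP2 R) : exists2 v, v != 0 & p = pt v.
Proof.
pose Q := quotient_topology {eq_quot proportional_equiv_rel R}.
exists (set_val (repr (p : Q))); first exact: set_valP (repr (p : Q)).
rewrite /pt /proj_point.
have -> : nz (set_val (repr (p : Q))) = repr (p : Q).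
  by apply: val_inj; rewrite -set_valE nzK //; exact: set_valP (repr (p : Q)).
by rewrite reprK.
Qed.

Lemma pt_eq u v : u != 0 -> v != 0 ->
  pt u = pt v <-> exists2 c : R, c != 0 & u = c *: v.
Proof.
move=> u0 v0; rewrite /pt.
have [c c0 hc] := hcoord_proj_point (nz u).
have [d d0 hd] := hcoord_proj_point (nz v).
rewrite (nzK u0) in hc; rewrite (nzK v0) in hd.
split=> [e|[a a0 e]].
  move: hc; rewrite e hd => /(congr1 (fun x => c^-1 *: x)).
  rewrite !scalerA mulVf // scale1r => <-.
  by exists (c^-1 * d) => //; rewrite mulf_neq0 ?invr_eq0.
have : nz u = nz v %[mod {eq_quot proportional_equiv_rel R}].
  apply/eqquotP; rewrite /= /proportional !nzK // e.
  by apply/eqmxP; exact: eqmx_scale.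
by [].
Qed.

(** An open set of the quotient pulls back to the trace of an open set [W] of R^3 on the nonzero
    vectors, and these form an open set themselves. *)
Lemma pt_continuous v : v != 0 -> {for v, continuous pt}.
Proof.
move=> v0 U; rewrite nbhsE => -[O [oO Ov] OU].
have /= [W oW hW] : open (@proj_point R @^-1` O).
  by move/continuousP: (@pi_continuous _ (quotient_topology {eq_quot proportional_equiv_rel R})); apply.
have Wv : W v.
  have : (set_val @^-1` W) (nz v) by rewrite hW.
  by rewrite /= nzK.
have W' : nbhs v (W `&` [set w | w != 0]).
  apply: open_nbhs_nbhs; split=> //; apply: openI => //.
  have -> : [set w : 'rV[R]_3 | w != 0] = ~` [set 0].
    by apply/seteqP; split=> w /= /eqP.
  exact/closed_openC/accessible_closed_set1/hausdorff_accessible/norm_hausdorff.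
apply: filterS W' => w [Ww w0]; apply: OU => /=.
have : (set_val @^-1` W) (nz w) by rewrite /= nzK.
by rewrite hW.
Qed.

(** Invariance under scaling makes the preimage of the image equal to the trace of [S], and openness
    in the quotient is openness of that preimage. *)
Lemma open_pt (S : set 'rV[R]_3) : open S ->
    (forall (c : R) v, c != 0 -> S v -> S (c *: v)) ->
  open [set pt v | v in S `&` [set v | v != 0]].
Proof.
move=> oS hS.
suff : open ((@proj_point R) @^-1` [set pt v | v in S `&` [set v | v != 0]]) by [].
exists S => //; apply/seteqP; split=> w /=.
  move=> Sw; have w0 : set_val w != 0 by exact: (set_valP w).
  exists (set_val w) => //; rewrite /pt; congr proj_point.
  by apply: val_inj; rewrite -!set_valE nzK.
move=> [v [Sv v0] e]; have w0 : set_val w != 0 by exact: (set_valP w).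
have : pt v = pt (set_val w).
  rewrite e /pt; congr proj_point.
  by apply: val_inj; rewrite -!set_valE nzK.
move=> /(pt_eq v0 w0) [c c0 ev].
have -> : set_val w = c^-1 *: v by rewrite ev scalerA mulVf // scale1r.
by apply: hS => //; rewrite invr_eq0.
Qed.

Lemma pt_scale (c : R) v : c != 0 -> v != 0 -> pt (c *: v) = pt v.
Proof. by move=> c0 v0; apply/pt_eq => //; [rewrite scaler_eq0 negb_or c0|exists c]. Qed.

Section Avoid.
Variable f : {mpoly R[3]}.
Hypothesis f6 : f \is 6.-homog.

Definition avoids l := forall v, v != 0 -> f.@[v 0] = 0 -> dot l v != 0.

Lemma avoidP l : l != 0 -> avoidance_locus f (pt l) <-> avoids l.
Proof.
move=> l0; rewrite /avoidance_locus /=; split.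
  move=> h v v0 fv; apply/eqP => lv.
  have : (real_line (pt l) `&` real_locus f) (pt v).
    split; first by apply/real_lineP; rewrite !nzK //; apply/dot_mul; rewrite dotC.
    by apply/(real_locusP _ f6); rewrite nzK.
  by rewrite h.
move=> h; apply/seteqP; split=> // p [].
have [v v0 ->] := ptP p.
move=> /real_lineP; rewrite !nzK // => /dot_mul; rewrite dotC => lv.
by move=> /(real_locusP _ f6); rewrite nzK // => /(h _ v0); rewrite lv eqxx.
Qed.

Lemma avoidsZ (c : R) l : c != 0 -> avoids l -> avoids (c *: l).
Proof. by move=> c0 h v v0 fv; rewrite dotZl mulf_neq0 ?h. Qed.

End Avoid.
End Points.

(** * Components *)

Section Continuity.
Variables (R : realType) (T : topologicalType).

Lemma continuous_coord (a : T -> 'rV[R]_3) i :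
  continuous a -> continuous (fun t => a t 0 i).
Proof.
move=> ca t.
exact: (@continuous_comp T 'rV[R]_3 R a (fun v => v 0 i) t (ca t) (@coord_continuous R 1 3 0 i (a t))).
Qed.

Lemma continuous_mulR (a b : T -> R) :
  continuous a -> continuous b -> continuous (fun t => a t * b t).
Proof. by move=> ca cb t; apply: (@cvgM R _ (nbhs t) _ a b); [exact: ca|exact: cb]. Qed.

Lemma continuous_addR (a b : T -> R) :
  continuous a -> continuous b -> continuous (fun t => a t + b t).
Proof. by move=> ca cb t; apply: (@cvgD _ _ _ (nbhs t) _ a b); [exact: ca|exact: cb]. Qed.

Lemma continuous_oppR (a : T -> R) : continuous a -> continuous (fun t => - a t).
Proof. by move=> ca t; apply: (@cvgN _ _ _ (nbhs t) _ a); exact: ca. Qed.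

Lemma continuous_cstR (c : R) : continuous (fun _ : T => c).
Proof. by move=> t; exact: cvg_cst. Qed.

Lemma continuous_addV (V : normedModType R) (a b : T -> V) :
  continuous a -> continuous b -> continuous (fun t => a t + b t).
Proof. by move=> ca cb t; apply: (@cvgD _ _ _ (nbhs t) _ a b); [exact: ca|exact: cb]. Qed.

Lemma continuous_oppV (V : normedModType R) (a : T -> V) :
  continuous a -> continuous (fun t => - a t).
Proof. by move=> ca t; apply: (@cvgN _ _ _ (nbhs t) _ a); exact: ca. Qed.

Lemma continuous_scaleV (V : normedModType R) (a : T -> R) (b : T -> V) :
  continuous a -> continuous b -> continuous (fun t => a t *: b t).
Proof. by move=> ca cb t; apply: (@cvgZ _ _ _ (nbhs t) _ a b); [exact: ca|exact: cb]. Qed.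

Lemma continuous_norm (V : normedModType R) (a : T -> V) :
  continuous a -> continuous (fun t => `|a t|).
Proof.
move=> ca t.
exact: (@continuous_comp T V R a (fun x => `|x|) t (ca t) (@norm_continuous _ V (a t))).
Qed.

Lemma continuous_sumR (I : Type) (r : seq I) (P : pred I) (F : I -> T -> R) :
  (forall i, continuous (F i)) -> continuous (fun t => \sum_(i <- r | P i) F i t).
Proof.
move=> h; apply: (@continuous_big R I +%R 0 P) => [|i _]; last exact: h.
exact: add_continuous.
Qed.

Lemma continuous_prodR (I : Type) (r : seq I) (P : pred I) (F : I -> T -> R) :
  (forall i, continuous (F i)) -> continuous (fun t => \prod_(i <- r | P i) F i t).
Proof.
move=> h; apply: (@continuous_big R I *%R 1 P) => [|i _]; last exact: h.
exact: mul_continuous.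
Qed.

Lemma continuous_expR (a : T -> R) n :
  continuous a -> continuous (fun t => a t ^+ n).
Proof.
move=> ca; elim: n => [t|n IH]; first exact: cvg_cst.
have -> : (fun t => a t ^+ n.+1) = (fun t => a t * a t ^+ n).
  by apply/funext => t; rewrite exprS.
exact: continuous_mulR.
Qed.

Lemma continuous_dot (a b : T -> 'rV[R]_3) :
  continuous a -> continuous b -> continuous (fun t => dot (a t) (b t)).
Proof.
move=> ca cb; apply: continuous_sumR => i.
by apply: continuous_mulR; exact: continuous_coord.
Qed.

Lemma continuous_meval (f : {mpoly R[3]}) (a : T -> 'rV[R]_3) :
  continuous a -> continuous (fun t => f.@[a t 0]).
Proof.
move=> ca.
have -> : (fun t => f.@[a t 0]) =
    (fun t => \sum_(m <- msupp f) f@_m * \prod_i (a t 0 i) ^+ m i).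
  by apply/funext => t; rewrite mevalE.
apply: continuous_sumR => m; apply: continuous_mulR; first by move=> t; exact: cvg_cst.
by apply: continuous_prodR => i; apply: continuous_expR; exact: continuous_coord.
Qed.

Lemma near_pos (F : T -> R) t : continuous F -> 0 < F t ->
  \forall t' \near t, 0 < F t'.
Proof. by move=> cF; apply: cvgr_gt; exact: cF. Qed.

Lemma near_neg (F : T -> R) t : continuous F -> F t < 0 ->
  \forall t' \near t, F t' < 0.
Proof. by move=> cF; apply: cvgr_lt; exact: cF. Qed.

End Continuity.

(** * The component of an avoiding line is the image of a convex cone *)

Section Component.
Variables (R : realType) (f : {mpoly R[3]}).
Hypothesis f6 : f \is 6.-homog.
Implicit Types u v w l : 'rV[R]_3.

Lemma mevalN6 v : f.@[(- v) 0] = f.@[v 0].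
Proof. by rewrite -scaleN1r (meval_homogZ _ _ f6) -signr_odd expr0 mul1r. Qed.

(** The lift of the component of [l] to R^3. Choosing for each real point the representative on
    which [l] is positive turns the condition of not crossing the curve into a family of strict
    linear inequalities, hence into a convex one. *)
Definition side l : set 'rV[R]_3 :=
  [set w | forall v, f.@[v 0] = 0 -> 0 < dot l v -> 0 < dot w v].

Lemma side_avoids l w : avoids f l -> side l w -> avoids f w.
Proof.
move=> la lw v v0 fv; have := la _ v0 fv.
rewrite neq_lt => /orP[h|h]; last by rewrite gt_eqF // lw.
have := lw (- v); rewrite mevalN6 !dotNr !oppr_gt0 => /(_ fv h) h'.
by rewrite lt_eqF.
Qed.

Lemma compact_sphere (A : set 'rV[R]_3) : closed A -> compact (A `&` [set v | `|v| = 1]).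
Proof.
move=> cA; apply: bounded_closed_compact.
  by exists 1; split=> // x x1 v [_ /= ->]; exact: ltW.
apply: closedI => //.
have -> : [set v : 'rV[R]_3 | `|v| = 1] = (@Num.norm _ _) @^-1` [set 1] by [].
apply: preimage_closed => [v _|]; first exact: norm_continuous.
exact/accessible_closed_set1/hausdorff_accessible/norm_hausdorff.
Qed.

Lemma closed_ge0 (F : 'rV[R]_3 -> R) : continuous F -> closed [set v | 0 <= F v].
Proof.
move=> cF; have -> : [set v | 0 <= F v] = F @^-1` [set x | 0 <= x] by [].
by apply: preimage_closed => [v _|]; [exact: cF|exact: closed_ge].
Qed.

Lemma closed_eq0 (F : 'rV[R]_3 -> R) : continuous F -> closed [set v | F v = 0].
Proof.
move=> cF; have -> : [set v | F v = 0] = F @^-1` [set 0] by [].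
apply: preimage_closed => [v _|]; first exact: cF.
exact/accessible_closed_set1/hausdorff_accessible/norm_hausdorff.
Qed.

Lemma normalize_sphere v : v != 0 -> `| `|v|^-1 *: v | = 1.
Proof. by move=> v0; rewrite normrZ normfV normr_id mulVf // normr_eq0. Qed.

(** The infinitely many inequalities reduce to a compact family, the normalized zeros on the
    positive side of [l], and strict positivity on a compact set is an open condition. *)
Lemma side_open l : avoids f l -> open (side l).
Proof.
move=> la; rewrite openE => w lw; rewrite /interior.
(* The weak inequality makes [K] closed; it is strict on [K] because [l] avoids the curve. *)
pose K : set 'rV[R]_3 := ([set v : 'rV[R]_3 | f.@[v 0] = 0] `&` [set v | 0 <= dot l v]) `&` [set v | `|v| = 1].
have cK : compact K.
  apply: compact_sphere; apply: closedI.
    by apply: closed_eq0; apply: continuous_meval => v; exact: cvg_id.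
  by apply: closed_ge0; exact: dot_continuous.
have KP v : K v -> [/\ v != 0, f.@[v 0] = 0 & 0 < dot l v].
  move=> [[fv lv] v1]; have v0 : v != 0.
    by apply/eqP => e; move: v1; rewrite /= e normr0 => /eqP; rewrite eq_sym oner_eq0.
  by split=> //; rewrite lt_neqAle eq_sym la.
have /compact_near_coveringP/(_ _ (nbhs w) (fun w' v => 0 < dot w' v) _) h := cK.
have : \forall w' \near w, K `<=` (fun v => 0 < dot w' v).
  apply: h => v Kv.
  have : \forall p \near (v, w), 0 < dot p.2 p.1.
    apply: (@near_pos R ('rV[R]_3 * 'rV[R]_3)%type (fun p => dot p.2 p.1) (v, w)).
      by apply: continuous_dot => p; [exact: cvg_snd|exact: cvg_fst].
    by have [_ fv lv] := KP _ Kv; exact: lw.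
  by [].
apply: filterS => w' hw' v fv lv.
have v0 : v != 0 by apply/eqP => e; move: lv; rewrite e dot0r ltxx.
have n0 : 0 < `|v| by rewrite normr_gt0.
have : 0 < dot w' (`|v|^-1 *: v).
  apply: hw'; split; last exact: normalize_sphere.
  split; first by rewrite /= (meval_homogZ _ _ f6) fv mulr0.
  by rewrite /= dotZr mulr_ge0 ?invr_ge0 ?ltW.
by rewrite dotZr pmulr_rgt0 // invr_gt0.
Qed.

Lemma side_scale l (c : R) w : 0 < c -> side l w -> side l (c *: w).
Proof. by move=> c0 lw v fv lv; rewrite dotZl mulr_gt0 // lw. Qed.

Lemma side_mix l (s t : R) u w : 0 <= s -> 0 <= t -> 0 < s + t ->
  side l u -> side l w -> side l (s *: u + t *: w).
Proof.
move=> s0 t0 st hu hw v fv lv; rewrite dotDl !dotZl.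
have du := hu v fv lv; have dw := hw v fv lv.
have [s_gt0|s_le0] := ltP 0 s.
  by rewrite ltr_pwDl ?mulr_gt0 // mulr_ge0 // ltW.
have s00 : s = 0 by apply/eqP; rewrite eq_le s0 s_le0.
by move: st; rewrite s00 add0r mul0r add0r => ?; rewrite mulr_gt0.
Qed.

Lemma side_convex l : convex_set (side l : set (convex_lmodType 'rV[R]_3)).
Proof.
move=> x y t; rewrite !inE => hx hy.
change (side l (t%:num *: x + (1 - t%:num) *: y)).
have t0 : 0 <= t%:num by exact: ge0.
have t1 : 0 <= 1 - t%:num by rewrite subr_ge0; exact: le1.
by apply: side_mix => //; rewrite addrC subrK.
Qed.

Hypothesis fZ : exists2 v : 'rV[R]_3, v != 0 & f.@[v 0] = 0.

Lemma avoids_neq0 l : avoids f l -> l != 0.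
Proof.
move=> la; apply/eqP => l0; have [v v0 fv] := fZ.
by have := la _ v0 fv; rewrite l0 dot0l eqxx.
Qed.

(** The cone is connected, so its image lies in the component. Conversely the image meets the
    component in a nonempty subset that is both open and closed in it. *)
Lemma side_component l : avoids f l ->
  connected_component (avoidance_locus f) (pt l) = [set pt w | w in side l].
Proof.
move=> la; have l0 := avoids_neq0 la.
have sl0 w : side l w -> w != 0 by move=> /(side_avoids la)/avoids_neq0.
apply/seteqP; split; last first.
  apply: connected_component_max.
  - by exists l.
  - by move=> _ [w lw <-]; apply/(avoidP f6 (sl0 _ lw)); exact: side_avoids lw.
  - apply: connected_continuous_connected.
      have -> : side l = \bigcup_(w in side l) ((fun t : R => l + t *: (w - l)) @` `[0, 1]).
        apply/seteqP; split=> [w lw|w].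
          exists w => //; exists 1; first by rewrite /= in_itv /= ler01 lexx.
          by rewrite scale1r addrC subrK.
        move=> [v lv [t]]; rewrite /= in_itv /= => /andP[t0 t1] <-.
        have -> : l + t *: (v - l) = (1 - t) *: l + t *: v.
          by rewrite scalerBr scalerBl scale1r [t *: v - _]addrC addrA.
        by apply: side_mix; rewrite ?subr_ge0 ?subrK.
      apply: bigcup_connected.
        exists l => w _; exists 0; first by rewrite /= in_itv /= ler01 lexx.
        by rewrite scale0r addr0.
      move=> w _; apply: connected_continuous_connected; first exact: segment_connected.
      apply: continuous_subspaceT => t; apply: cvgD; first exact: cvg_cst.
      by apply: cvgZr_tmp; exact: cvg_id.
    apply: continuous_in_subspaceT => w; rewrite inE => lw.
    exact/pt_continuous/sl0.
set K := connected_component _ _.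
pose B := K `&` [set pt w | w in side l].
suff -> : K = B by move=> p [].
(* The cone and its opposite together are stable under nonzero scalars, as [open_pt] requires. *)
pose U : set 'rV[R]_3 := side l `|` [set w | side l (- w)].
have oside : open U.
  apply: openU; first exact: side_open.
  have -> : [set w | side l (- w)] = (@GRing.opp 'rV[R]_3) @^-1` side l by [].
  apply: open_comp; last exact: side_open.
  by move=> w _; exact: opp_continuous.
have UZ (c : R) v : c != 0 -> U v -> U (c *: v).
  rewrite neq_lt => /orP[c0|c0] [hv|hv].
  - by right; rewrite /= -scaleNr; apply: side_scale; rewrite ?oppr_gt0.
  - by left; rewrite -[v]opprK scalerN -scaleNr; apply: side_scale; rewrite ?oppr_gt0.
  - by left; apply: side_scale.
  - by right; rewrite /= -scalerN; apply: side_scale.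
(* The complement of [U] among avoiding lines: [w] separates two zeros that [l] leaves on one side.
   This condition is open as well. *)
pose V : set 'rV[R]_3 := [set w | exists v1 v2, [/\ f.@[v1 0] = 0, f.@[v2 0] = 0,
   0 < dot l v1 /\ 0 < dot l v2, 0 < dot w v1 & dot w v2 < 0]].
have oV : open V.
  rewrite openE => w [v1 [v2 [f1 f2 l12 w1 w2]]].
  have cd v : continuous (fun w : 'rV[R]_3 => dot w v).
    have -> : (fun w : 'rV[R]_3 => dot w v) = dot v by apply/funext => x; exact: dotC.
    exact: dot_continuous.
  have h1 := near_pos (@cd v1) w1.
  have h2 := near_neg (@cd v2) w2.
  by apply: filterS2 h1 h2 => w' ? ?; exists v1, v2.
have VZ (c : R) v : c != 0 -> V v -> V (c *: v).
  move=> c0 [v1 [v2 [f1 f2 [l1 l2] w1 w2]]].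
  move: c0; rewrite neq_lt => /orP[c0|c0].
    exists v2, v1; split=> //; first by rewrite dotZl nmulr_rgt0.
    by rewrite dotZl nmulr_rlt0.
  by exists v1, v2; split=> //; rewrite dotZl ?pmulr_rgt0 ?pmulr_rlt0.
have KA : K `<=` avoidance_locus f by exact: connected_component_sub.
have ptN w : w != 0 -> pt (- w) = pt w by move=> w0; rewrite -scaleN1r pt_scale // oppr_eq0 oner_neq0.
have BU : B = K `&` [set pt v | v in U `&` [set v | v != 0]].
  apply/seteqP; split=> p [Kp [w]].
    by move=> lw e; split=> //; exists w => //; split; [left|exact: sl0].
  move=> [[lw|lw] /= w0] e; split=> //; first by exists w.
  by exists (- w); rewrite ?ptN.
have BV : B = K `&` ~` [set pt v | v in V `&` [set v | v != 0]].
  apply/seteqP; split=> p [Kp].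
    move=> [w lw e]; split=> // -[w' [[v1 [v2 [f1 f2 [l1 l2] w1 w2]]] /= w'0]].
    rewrite -e => /(pt_eq w'0 (sl0 _ lw)) [c c0 ew].
    move: w1 w2; rewrite ew !dotZl.
    have h1 := lw _ f1 l1; have h2 := lw _ f2 l2.
    by rewrite (pmulr_lgt0 _ h1) (pmulr_llt0 _ h2) => /ltW; rewrite leNgt => /negbTE ->.
  move=> nV; split=> //.
  have [w w0 e] := ptP p.
  have wa : avoids f w by apply/(avoidP f6 w0); rewrite -e; exact: KA.
  rewrite e; apply: contrapT => nU; apply: nV; rewrite e; exists w => //; split=> //.
  (* Failing both memberships gives a zero where [w] is nonpositive and one where it is nonnegative;
     avoidance makes both signs strict. *)
  have nU1 : ~ side l w by move=> h; apply: nU; exists w.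
  have nU2 : ~ side l (- w) by move=> h; apply: nU; exists (- w); rewrite ?ptN.
  move/existsNP: nU1 => [v1 /not_implyP[f1 /not_implyP[l1 /negP]]]; rewrite -leNgt => w1.
  move/existsNP: nU2 => [v2 /not_implyP[f2 /not_implyP[l2 /negP]]].
  rewrite -leNgt dotNl oppr_le0 => w2.
  have nz' v : 0 < dot l v -> v != 0.
    by move=> h; apply/eqP => v0; move: h; rewrite v0 dot0r ltxx.
  exists v2, v1; split=> //.
    by rewrite lt_neqAle w2 eq_sym wa // nz'.
  by rewrite lt_neqAle w1 wa // nz'.
apply/esym; apply: (component_connected (A := avoidance_locus f) (x := pt l)).
- exists (pt l); split; last by exists l.
  by apply: connected_component_refl; apply/(avoidP f6 l0).
- exists [set pt v | v in U `&` [set v | v != 0]] => //; exact: open_pt.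
- exists (~` [set pt v | v in V `&` [set v | v != 0]]) => //.
  by apply: open_closedC; exact: open_pt.
Qed.

Lemma component_convex K :
  connected_components (avoidance_locus f) K -> convex_as_cone K.
Proof.
move=> [p Ap <-]; have [l l0 e] := ptP p.
have la : avoids f l by apply/(avoidP f6 l0); rewrite -e.
rewrite e (side_component la); exists (side l).
  by split; [exact: side_open|exact: side_convex|move=> t v; exact: side_scale].
have sl0 w : side l w -> w != 0 by move=> /(side_avoids la)/avoids_neq0.
apply/seteqP; split=> _ [w lw <-].
  by exists (nz w); rewrite //= nzK // sl0.
exists (set_val w) => //; rewrite /pt; congr proj_point.
by apply: val_inj; rewrite -!set_valE nzK // sl0.
Qed.

End Component.

(** * Components correspond to sign patterns at finitely many centers *)

Section Counting.
Variables (R : realType) (f : {mpoly R[3]}).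
Hypothesis f6 : f \is 6.-homog.
Hypothesis fZ : exists2 v : 'rV[R]_3, v != 0 & f.@[v 0] = 0.
Variables (p0 : 'rV[R]_3) (P : seq 'rV[R]_3).
Hypothesis p0P : p0 \in P.
Hypothesis center_avoided : forall p l : 'rV[R]_3, p \in P -> avoids f l -> dot l p != 0.
(** The only geometric input to the count: every zero, with a suitable sign, stays together with
    some center on the same side of all avoiding lines. For convex ovals the center is the point
    inside. *)
Hypothesis linked : forall v : 'rV[R]_3, v != 0 -> f.@[v 0] = 0 ->
  exists w p, [/\ w = v \/ w = - v, p \in P &
    forall l, avoids f l -> 0 < dot l w * dot l p].

Definition pattern l : seq bool := [seq 0 < dot l p | p <- P].

Let component l := connected_component (avoidance_locus f) (pt l).

(** If the signs at [p] differed, some positive combination of [l] and [w] would vanish at [p]; but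
    this combination lies in the convex cone [side f l], so it avoids the curve and cannot pass
    through a center. *)
Lemma side_center l w p : p \in P -> avoids f l -> side f l w ->
  (0 < dot l p) = (0 < dot w p).
Proof.
move=> pP la lw; have wa := side_avoids f6 la lw.
have lp := center_avoided pP la; have wp := center_avoided pP wa.
have mixed (s t : R) : 0 < s -> 0 < t -> s * dot l p + t * dot w p != 0.
  move=> s0 t0; rewrite -!dotZl -dotDl; apply: center_avoided => //.
  apply: (side_avoids f6 la); apply: side_mix => //; rewrite ?addr_gt0 ?ltW //.
move: lp wp; rewrite !neq_lt => /orP[lp|lp] /orP[wp|wp]; rewrite ?lp ?wp //.
- by rewrite !ltNge (ltW lp) (ltW wp).
- have := mixed (dot w p) (- dot l p) wp; rewrite oppr_gt0 => /(_ lp).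
  by rewrite mulNr mulrC subrr eqxx.
- have := mixed (- dot w p) (dot l p); rewrite oppr_gt0 => /(_ wp lp).
  by rewrite mulNr mulrC addrC subrr eqxx.
Qed.

(** Equal patterns give equal signs at all zeros through [linked]. Conversely a line of the
    component is a multiple of an element of the cone, and positivity at [p0] makes the multiplier
    positive. *)
Lemma pattern_component l l' : avoids f l -> avoids f l' ->
  0 < dot l p0 -> 0 < dot l' p0 ->
  pattern l = pattern l' <-> component l = component l'.
Proof.
move=> la la' lp0 lp0'.
have l0 := avoids_neq0 fZ la; have l0' := avoids_neq0 fZ la'.
split=> [e|e].
  have sgn p : p \in P -> (0 < dot l p) = (0 < dot l' p).
    by move=> pP; move/eq_in_map: e; apply.
  apply/same_connected_component; rewrite -/(component l) /component side_component //.
  exists l' => // v fv lv.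
  have v0 : v != 0 by apply/eqP => v0; move: lv; rewrite v0 dot0r ltxx.
  have [w [p [wv pP hw]]] := linked v0 fv.
  have := hw _ la; have := hw _ la'; have := sgn _ pP.
  have := center_avoided pP la; have := center_avoided pP la'.
  case: wv => ->; rewrite ?dotNr !neq_lt => /orP[a|a] /orP[b|b].
  - by rewrite !nmulr_lgt0 // => _ _; rewrite ltNge (ltW lv).
  - by rewrite b ltNge (ltW a).
  - by rewrite a ltNge (ltW b).
  - by rewrite !pmulr_lgt0.
  - by rewrite !nmulr_lgt0 // !oppr_lt0.
  - by rewrite b ltNge (ltW a).
  - by rewrite a ltNge (ltW b).
  - by rewrite !pmulr_lgt0 // !oppr_gt0 => _ _; rewrite ltNge (ltW lv).
have : component l (pt l').
  by rewrite e; apply: connected_component_refl; apply/(avoidP f6 l0').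
rewrite /component side_component // => -[w lw ew].
have wa := side_avoids f6 la lw.
have w0 := avoids_neq0 fZ wa.
have /esym/(pt_eq l0' w0) [c c0 el'] := ew.
have c_gt0 : 0 < c.
  have := lp0'; rewrite el' dotZl pmulr_lgt0 //.
  by rewrite -(side_center p0P la lw).
apply/eq_in_map => p pP.
by rewrite (side_center pP la lw) el' dotZl pmulr_rgt0.
Qed.

Lemma card_components (L : seq 'rV[R]_3) :
  (forall l, l \in L -> avoids f l /\ 0 < dot l p0) ->
  uniq (map pattern L) ->
  (forall l, avoids f l -> 0 < dot l p0 -> pattern l \in map pattern L) ->
  connected_components (avoidance_locus f) #= `I_(size L).
Proof.
move=> hL uL cL.
have -> : connected_components (avoidance_locus f) =
    (fun i => component (nth 0 L i)) @` `I_(size L).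
  apply/seteqP; split=> K.
    move=> [p Ap <-]; have [l l0 ep] := ptP p.
    have la : avoids f l by apply/(avoidP f6 l0); rewrite -ep.
    wlog lp : l l0 ep la / 0 < dot l p0.
      move=> H; have := center_avoided p0P la; rewrite neq_lt => /orP[h|h]; last exact: (H l).
      apply: (H (- l)); rewrite ?oppr_eq0 ?dotNl ?oppr_gt0 //.
        by rewrite ep -scaleN1r pt_scale // oppr_eq0 oner_neq0.
      by rewrite -scaleN1r; apply: avoidsZ => //; rewrite oppr_eq0 oner_neq0.
    case: (elimT (nthP (Nil bool)) (cL _ la lp)) => i; rewrite size_map => iL ei.
    have [la' lp'] := hL _ (mem_nth 0 iL).
    exists i => //; rewrite ep; apply/pattern_component => //.
    by rewrite -ei (nth_map 0).
  move=> [i iL <-]; have [la lp] := hL _ (mem_nth 0 iL).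
  exists (pt (nth 0 L i)) => //.
  by apply/(avoidP f6 (avoids_neq0 fZ la)).
apply: inj_card_eq => i j; rewrite !inE => iL jL e.
have [la lp] := hL _ (mem_nth 0 iL); have [la' lp'] := hL _ (mem_nth 0 jL).
apply/eqP; rewrite -(nth_uniq (Nil bool) _ _ uL) ?size_map //.
by rewrite !(nth_map 0) //; apply/eqP/pattern_component.
Qed.

End Counting.

(** * Restriction to segments *)

Section LinePolynomials.
Variable R : realType.
Implicit Types (p u v w l : 'rV[R]_3) (f g : {mpoly R[3]}).

(** Restriction to a parametrized line, which brings in the intermediate and mean value theorems for
    univariate polynomials. *)
Definition line_poly p u f : {poly R} :=
  mmap polyC (fun i => (p 0 i)%:P + (u 0 i) *: 'X) f.

Lemma line_polyE p u f t : (line_poly p u f).[t] = f.@[(p + t *: u) 0].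
Proof.
rewrite /line_poly /mmap mevalE horner_sum; apply: eq_bigr => m _.
rewrite hornerM hornerC; congr (_ * _).
rewrite /mmap1 horner_prod; apply: eq_bigr => i _.
by rewrite horner_exp hornerD hornerC hornerZ hornerX !mxE [t * _]mulrC.
Qed.

(** The chain rule. The identity is stable under sums and products, so constants and variables
    suffice. *)
Lemma deriv_line_poly p u f :
  (line_poly p u f)^`() = \sum_i u 0 i *: line_poly p u f^`M(i).
Proof.
pose D g := (line_poly p u g)^`() = \sum_i u 0 i *: line_poly p u g^`M(i).
have DD g h : D g -> D h -> D (g + h).
  rewrite /D /line_poly rmorphD derivD => -> ->; rewrite -big_split.
  by apply: eq_bigr => i _; rewrite mderivD rmorphD scalerDr.
have DM g h : D g -> D h -> D (g * h).
  rewrite /D /line_poly rmorphM derivM => -> ->.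
  rewrite mulr_suml mulr_sumr -big_split; apply: eq_bigr => i _.
  by rewrite mderivM rmorphD !rmorphM scalerDr -!scalerAl -!scalerAr.
have DC c : D c%:MP.
  rewrite /D /line_poly mmapC derivC big1 // => i _.
  by rewrite mderivC rmorph0 scaler0.
have DX i : D 'X_i.
  rewrite /D /line_poly mmapX mmap1U derivD derivC derivZ derivX add0r.
  rewrite (bigD1 i) //= big1 => [|j ji].
    have -> : ('X_i : {mpoly R[3]})^`M(i) = 1.
      rewrite mderivX mnm1E eqxx scale1r -mpolyX0; congr 'X_[_].
      by apply/mnmP => j; rewrite mnmBE mnm0E subnn.
    by rewrite addr0 rmorph1.
  by rewrite mderivX mnm1E eq_sym (negPf ji) scale0r rmorph0 scaler0.
suff : D f by [].
elim/mpolyind: f => [|c m g _ _ Dg]; first by rewrite -mpolyC0; exact: DC.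
apply: (DD) => //; rewrite -mul_mpolyC; apply: (DM); first exact: DC.
rewrite mpolyXE_id; apply: (big_ind D) => [||i _]; [by rewrite -mpolyC1; exact: DC|exact: DM|].
by elim: (m i) => [|k IH]; rewrite ?expr0 ?exprS; [rewrite -mpolyC1; exact: DC|exact: DM].
Qed.

Definition hess f v u : R := \sum_i \sum_j f^`M(i)^`M(j).@[v 0] * (u 0 i * u 0 j).

Lemma deriv2_line_poly p u f t :
  (line_poly p u f)^`()^`().[t] = hess f (p + t *: u) u.
Proof.
rewrite deriv_line_poly raddf_sum horner_sum; apply: eq_bigr => i _ /=.
rewrite derivZ deriv_line_poly hornerZ horner_sum mulr_sumr; apply: eq_bigr => j _.
by rewrite hornerZ line_polyE mulrA mulrC.
Qed.

(** A positive value at [t] would force a positive slope before [t] and a negative one after it,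
    hence a negative second derivative in between. *)
Lemma poly_convex_le0 (g : {poly R}) : g.[0] <= 0 -> g.[1] <= 0 ->
  (forall t, 0 <= t <= 1 -> 0 < g^`()^`().[t]) ->
  forall t, 0 <= t <= 1 -> g.[t] <= 0.
Proof.
move=> g0 g1 g2 t /andP[t0 t1]; rewrite leNgt; apply/negP => gt.
have t0' : 0 < t by rewrite lt_neqAle t0 andbT; apply: contraTneq gt => <-; rewrite -leNgt.
have t1' : t < 1 by rewrite lt_neqAle t1 andbT; apply: contraTneq gt => ->; rewrite -leNgt.
have [a] := poly_mvt g t0'; rewrite in_itv /= => /andP[a0 at_] ea.
have [b] := poly_mvt g t1'; rewrite in_itv /= => /andP[tb b1] eb.
have ga : 0 < g^`().[a].
  by move: ea => /eqP; rewrite subr0 => /eqP ea; rewrite -(pmulr_lgt0 _ t0') -ea subr_gt0; exact: le_lt_trans gt.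
have gb : g^`().[b] < 0.
  have h : 0 < 1 - t by rewrite subr_gt0.
  by rewrite -(pmulr_llt0 _ h) -eb subr_lt0; exact: le_lt_trans gt.
have ab := lt_trans at_ tb.
have [c] := poly_mvt g^`() ab; rewrite in_itv /= => /andP[ac cb] ec.
have : 0 < g^`()^`().[c] by apply: g2; rewrite (ltW (lt_trans a0 ac)) (ltW (lt_trans cb b1)).
have h : 0 < b - a by rewrite subr_gt0.
rewrite -(pmulr_lgt0 _ h) -ec subr_gt0 => h'.
by have := lt_trans (lt_trans h' gb) ga; rewrite ltxx.
Qed.

Lemma segment_root f v w : 0 < f.@[v 0] -> f.@[w 0] <= 0 ->
  exists t, [/\ 0 <= t, t <= 1 & f.@[((1 - t) *: v + t *: w) 0] = 0].
Proof.
move=> fv fw; pose g := line_poly v (w - v) f.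
have e t : (1 - t) *: v + t *: w = v + t *: (w - v).
  by rewrite scalerBr scalerBl scale1r [t *: w - _]addrC addrA.
have [] := @polyrcf.poly_ivt _ g 0 1 ler01.
  rewrite !line_polyE scale0r addr0 scale1r addrC subrK.
  by rewrite mulr_ge0_le0 // ltW.
move=> t; rewrite in_itv /= => /andP[t0 t1] /rootP; rewrite line_polyE => h.
by exists t; split=> //; rewrite e.
Qed.

Lemma common_zero l l' : exists2 v : 'rV[R]_3, v != 0 & dot l v = 0 /\ dot l' v = 0.
Proof.
pose M : 'M[R]_(3, 1 + 1) := row_mx l^T l'^T.
have : kermx M != 0.
  by rewrite -mxrank_eq0 mxrank_ker subn_eq0 -ltnNge (leq_ltn_trans (rank_leq_col _)).
move=> /rowV0Pn [v vM v0]; exists v => //.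
have : v *m M = 0 by apply/sub_kermxP.
rewrite mul_mx_row -[RHS]row_mx0 => /eq_row_mx[] /dot_mul h /dot_mul h'.
by rewrite dotC h dotC h'.
Qed.

Section Positive.
Variable f : {mpoly R[3]}.
Hypothesis f6 : f \is 6.-homog.

(** Two lines meet, at [w] say, so positivity spreads from one line to every avoiding line: a value
    <= 0 on [l] would produce a zero on the segment from [w]. Avoidance thus becomes positivity,
    which survives small perturbations. *)
Lemma positive_on_avoiding l0 l : (forall v, v != 0 -> dot l0 v = 0 -> 0 < f.@[v 0]) ->
  avoids f l -> forall v, v != 0 -> dot l v = 0 -> 0 < f.@[v 0].
Proof.
move=> h0 la v v0 lv; rewrite ltNge; apply/negP => fv.
have [w w0 [lw l0w]] := common_zero l l0.
have fw := h0 _ w0 l0w.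
have [t [t0 t1 ft]] := segment_root fw fv.
set z := (1 - t) *: w + t *: v in ft.
have lz : dot l z = 0 by rewrite dotDr !dotZr lw lv !mulr0 addr0.
have [z0|z0] := eqVneq z 0; last by have := la _ z0 ft; rewrite lz eqxx.
(* The segment can pass through the origin only if [v] is a negative multiple of [w], and then the
   even degree gives [v] the sign of [w]. *)
have tn0 : t != 0.
  by apply/eqP => e; move/eqP: z0; rewrite /z e subr0 scale1r scale0r addr0 (negPf w0).
have t1n : 1 - t != 0.
  by apply/eqP => e; move/eqP: z0; rewrite /z e scale0r add0r scaler_eq0 (negPf tn0) (negPf v0).
have vE : v = (- ((1 - t) / t)) *: w.
  move/eqP: z0; rewrite addr_eq0 => /eqP e.
  by rewrite scaleNr [(1 - t) / t]mulrC -scalerA e scalerN opprK scalerA mulVf // scale1r.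
move: fv; rewrite vE (meval_homogZ _ _ f6) leNgt => /negP; apply.
by rewrite mulr_gt0 // exprn_even_gt0 //= oppr_eq0 mulf_neq0 ?invr_eq0.
Qed.

End Positive.
End LinePolynomials.

(** * Perturbation by the Fermat sextic *)

Section Perturbation.
Variable R : realType.
Implicit Types (p u v w l x : 'rV[R]_3) (e r t : R) (F : {mpoly R[3]}).

Lemma compact_pos (I : topologicalType) (i0 : I) (K : set 'rV[R]_3)
    (Phi : 'rV[R]_3 * I -> R) : compact K -> continuous Phi ->
  (forall v, K v -> 0 < Phi (v, i0)) ->
  \forall i \near i0, forall v, K v -> 0 < Phi (v, i).
Proof.
move=> cK cPhi h.
have /compact_near_coveringP/(_ _ (nbhs i0) (fun i v => 0 < Phi (v, i)) _) H := cK.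
have : \forall i \near i0, K `<=` (fun v => 0 < Phi (v, i)).
  apply: H => v Kv.
  have : \forall z \near (v, i0), 0 < Phi (z.1, z.2).
    by have := near_pos cPhi (h _ Kv); apply: filterS => -[].
  by [].
by apply: filterS => i + v; apply.
Qed.

Lemma near0_radius (Q : R -> Prop) : (\forall e \near 0, Q e) ->
  exists2 r, 0 < r & forall e, 0 < e < r -> Q e.
Proof.
move=> /nbhs_ballP [r /= r0 h]; exists r => // e /andP[e0 er]; apply: h.
by rewrite /ball /= sub0r normrN gtr0_norm.
Qed.

Definition fermat : {mpoly R[3]} := \sum_(i < 3) 'X_i ^+ 6.

Lemma fermatE v : fermat.@[v 0] = \sum_(i < 3) v 0 i ^+ 6.
Proof. by rewrite /fermat rmorph_sum; apply: eq_bigr => i _; rewrite rmorphXn /= mevalXU. Qed.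

Lemma fermat_gt0 v : v != 0 -> 0 < fermat.@[v 0].
Proof.
move=> v0; rewrite fermatE lt_neqAle sumr_ge0 ?andbT => [|i _]; last exact: exprn_even_ge0.
rewrite eq_sym psumr_eq0 => [|i _]; last exact: exprn_even_ge0.
apply: contra v0 => /allP h; apply/eqP/rowP => i; rewrite mxE; apply/eqP.
by have := h i; rewrite mem_index_enum expf_eq0 => /(_ isT).
Qed.

Lemma fermat_homog : fermat \is 6.-homog.
Proof.
apply: rpred_sum => i _; have -> : 6%N = (1 * 6)%N by [].
by apply: dhomogMn; rewrite dhomogX /= mdeg1.
Qed.

Definition pert F e : {mpoly R[3]} := F - e *: fermat.

Lemma pertE F e v : (pert F e).@[v 0] = F.@[v 0] - e * fermat.@[v 0].
Proof. by rewrite mevalB mevalZ. Qed.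

Lemma pert_homog F e : F \is 6.-homog -> pert F e \is 6.-homog.
Proof. by move=> F6; rewrite rpredB // rpredZ // fermat_homog. Qed.

Lemma hess_pert F e v u : hess (pert F e) v u = hess F v u - e * hess fermat v u.
Proof.
rewrite /hess mulr_sumr -sumrB; apply: eq_bigr => i _.
rewrite mulr_sumr -sumrB; apply: eq_bigr => j _.
by rewrite /pert !mderivB !mderivZ mevalB mevalZ; ring.
Qed.

Lemma hessZ F v c u : hess F v (c *: u) = c ^+ 2 * hess F v u.
Proof.
rewrite /hess mulr_sumr; apply: eq_bigr => i _.
rewrite mulr_sumr; apply: eq_bigr => j _; rewrite !mxE; ring.
Qed.

Lemma continuous_hess (T : topologicalType) F (a b : T -> 'rV[R]_3) :
  continuous a -> continuous b -> continuous (fun z => hess F (a z) (b z)).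
Proof.
move=> ca cb; apply: continuous_sumR => i; apply: continuous_sumR => j.
apply: continuous_mulR; first exact: continuous_meval.
by apply: continuous_mulR; exact: continuous_coord.
Qed.

Lemma dot_gt0 p : p != 0 -> 0 < dot p p.
Proof.
move=> p0; rewrite lt_neqAle sumr_ge0 ?andbT => [|i _]; last by rewrite -expr2 sqr_ge0.
rewrite eq_sym /dot psumr_eq0 => [|i _]; last by rewrite -expr2 sqr_ge0.
apply: contra p0 => /allP h; apply/eqP/rowP => i; rewrite mxE; apply/eqP.
by have := h i; rewrite mem_index_enum mulf_eq0 orbb => /(_ isT).
Qed.

(** A line on which [f] is positive misses the segment, on which [f] <= 0, so the linear form [l]
    keeps its sign along it. *)
Lemma star_linked (f : {mpoly R[3]}) p v l :
  (forall t, 0 <= t <= 1 -> p + t *: (v - p) != 0 /\ f.@[(p + t *: (v - p)) 0] <= 0) ->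
  (forall x, x != 0 -> dot l x = 0 -> 0 < f.@[x 0]) ->
  0 < dot l v * dot l p.
Proof.
move=> st lpos; rewrite ltNge; apply/negP => sgn.
pose g : {poly R} := (dot l p)%:P + dot l (v - p) *: 'X.
have gE t : g.[t] = dot l (p + t *: (v - p)).
  by rewrite hornerD hornerC hornerZ hornerX [RHS]dotDr dotZr mulrC.
have [] := @polyrcf.poly_ivt _ g 0 1 ler01.
  by rewrite !gE scale0r addr0 scale1r addrC subrK mulrC.
move=> t; rewrite in_itv /= => t01 /rootP; rewrite gE => lt0.
have [x0 fx] := st _ t01.
by have := lpos _ x0 lt0; rewrite ltNge fx.
Qed.

(** The bound on [e] comes before [v] and [l]: one perturbation must serve all zeros in [N] and all
    lines at once. *)
Definition locally_linked F p (N : set 'rV[R]_3) :=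
  exists2 r, 0 < r & forall e, 0 < e < r -> forall v, N v -> (pert F e).@[v 0] = 0 ->
    exists2 w, w = v \/ w = - v &
      forall l, (forall x, x != 0 -> dot l x = 0 -> 0 < (pert F e).@[x 0]) ->
        0 < dot l w * dot l p.

Lemma linked_scale p v c : c != 0 ->
  exists2 w, w = v \/ w = - v & forall l, 0 < dot l (c *: v) * dot l p -> 0 < dot l w * dot l p.
Proof.
rewrite neq_lt => /orP[c0|c0].
  exists (- v); first by right.
  by move=> l; rewrite dotNr dotZr -mulrA nmulr_rgt0 // mulNr oppr_gt0.
by exists v; [left|move=> l; rewrite dotZr -mulrA pmulr_rgt0].
Qed.

(** The multiple of [v] in the affine plane through [p] orthogonal to [p] is at distance less than
    [r] from [p]. Denominators are cleared, which makes the set visibly open and homogeneous. *)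
Definition cone_nbhd p r : set 'rV[R]_3 :=
  [set v | `|dot p p *: v - dot v p *: p| < r * `|dot v p| ].

Lemma cone_nbhd_open p r : open (cone_nbhd p r).
Proof.
rewrite openE => v; rewrite /cone_nbhd /= -subr_gt0 => h.
pose Phi v := r * `|dot v p| - `|dot p p *: v - dot v p *: p|.
have cd : continuous (fun v => dot v p).
  have -> : (fun v => dot v p) = dot p by apply/funext => x; exact: dotC.
  exact: dot_continuous.
have cPhi : continuous Phi.
  apply: continuous_addR.
    apply: continuous_mulR; first exact: continuous_cstR.
    exact: (@continuous_norm R _ R^o).
  apply: continuous_oppR; apply: continuous_norm; apply: continuous_addV.
    by apply: continuous_scaleV; [exact: continuous_cstR|move=> x; exact: cvg_id].
  apply: continuous_oppV; apply: continuous_scaleV; first exact: cd.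
  exact: cst_continuous.
by have := near_pos cPhi h; apply: filterS => x; rewrite /Phi subr_gt0.
Qed.

Lemma cone_nbhd_scale p r (c : R) v : c != 0 -> cone_nbhd p r v -> cone_nbhd p r (c *: v).
Proof.
move=> c0; rewrite /cone_nbhd /=.
have -> : dot p p *: (c *: v) - dot (c *: v) p *: p = c *: (dot p p *: v - dot v p *: p).
  by rewrite dotZl scalerBr !scalerA [c * dot p p]mulrC.
by rewrite dotZl normrZ normrM mulrCA ltr_pM2l // normr_gt0.
Qed.

Lemma cone_nbhd_mem p r : p != 0 -> 0 < r -> cone_nbhd p r p.
Proof.
by move=> p0 r0; rewrite /cone_nbhd /= subrr normr0 mulr_gt0 // normr_gt0 gt_eqF // dot_gt0.
Qed.

(** Near [p] the perturbed form is strictly convex along directions orthogonal to [p]. It is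
    negative at [p] and zero at the rescaled [v], hence nonpositive in between, and [star_linked]
    applies. *)
Lemma point_linked F p : F \is 6.-homog -> p != 0 -> F.@[p 0] = 0 ->
  (forall u, u != 0 -> dot u p = 0 -> 0 < hess F p u) ->
  exists2 r, 0 < r & locally_linked F p (cone_nbhd p r).
Proof.
move=> F6 p0 Fp Hp.
pose K : set 'rV[R]_3 := [set u | dot p u = 0] `&` [set u | `|u| = 1].
have cK : compact K by apply: compact_sphere; apply: closed_eq0; exact: dot_continuous.
have KP u : K u -> u != 0 /\ dot u p = 0.
  move=> [pu u1]; rewrite dotC; split=> //.
  by apply/eqP => e; move: u1; rewrite /= e normr0 => /eqP; rewrite eq_sym oner_eq0.
(* The Hessian of the perturbed form with direction, base point and [e] all variable: compactness in
   the direction yields bounds for the other two. *)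
pose Phi (x : 'rV[R]_3 * ('rV[R]_3 * R)) := hess F x.2.1 x.1 - x.2.2 * hess fermat x.2.1 x.1.
have cPhi : continuous Phi.
  have c1 : continuous (fun x : 'rV[R]_3 * ('rV[R]_3 * R) => x.1) by move=> x; exact: cvg_fst.
  have c2 : continuous (fun x : 'rV[R]_3 * ('rV[R]_3 * R) => x.2.1).
    by move=> x; apply: cvg_comp; [exact: cvg_snd|exact: cvg_fst].
  have c3 : continuous (fun x : 'rV[R]_3 * ('rV[R]_3 * R) => x.2.2).
    by move=> x; apply: cvg_comp; [exact: cvg_snd|exact: cvg_snd].
  apply: continuous_addR; first exact: continuous_hess.
  by apply: continuous_oppR; apply: continuous_mulR => //; exact: continuous_hess.
have : \forall i \near (p, 0 : R), forall u, K u -> 0 < Phi (u, i).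
  by apply: compact_pos => // u Ku; have [u0 up] := KP _ Ku; rewrite /Phi /= mul0r subr0 Hp.
move=> [[A B] /= [/nbhs_ballP[r1 /= r10 h1] /nbhs_ballP[r2 /= r20 h2]] hAB].
exists r1 => //; exists r2 => // e /andP[e0 er] v Nv fv.
have dvp : dot v p != 0.
  by apply: contraTneq Nv => h; rewrite /cone_nbhd /= h normr0 mulr0 -leNgt.
(* This factor moves [v] into the plane through [p] orthogonal to [p], so the segment from [p] has a
   direction covered by the Hessian bound. *)
set c := dot p p / dot v p.
have c0 : c != 0 by rewrite mulf_neq0 ?invr_eq0 // gt_eqF // dot_gt0.
have [w wv hw] := linked_scale p v c0.
exists w => // l lpos; apply: hw; apply: star_linked lpos => t t01.
set u := c *: v - p.
have up : dot u p = 0 by rewrite dotDl dotNl dotZl divfK // subrr.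
split.
  apply: contraTneq (dot_gt0 p0) => e'.
  have : dot (p + t *: u) p = 0 by rewrite e' dot0l.
  by rewrite dotDl dotZl up mulr0 addr0 => ->; rewrite ltxx.
have f6 : pert F e \is 6.-homog by exact: pert_homog.
have fp : (pert F e).@[p 0] < 0.
  by rewrite pertE Fp sub0r oppr_lt0 mulr_gt0 // fermat_gt0.
have fcv : (pert F e).@[(c *: v) 0] = 0 by rewrite (meval_homogZ _ _ f6) fv mulr0.
have u0 : u != 0.
  by apply: contraTneq fp => /eqP; rewrite subr_eq0 => /eqP <-; rewrite fcv ltxx.
have ur : `|u| < r1.
  have -> : u = (dot v p)^-1 *: (dot p p *: v - dot v p *: p).
    by rewrite scalerBr !scalerA mulVf // scale1r mulrC.
  by rewrite normrZ normfV mulrC ltr_pdivrMr ?normr_gt0.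
rewrite -line_polyE; apply: poly_convex_le0 t01.
- by rewrite line_polyE scale0r addr0 ltW.
- by rewrite line_polyE scale1r addrC subrK fcv.
move=> s /andP[s0 s1]; rewrite deriv2_line_poly hess_pert.
pose h := `|u|^-1 *: u.
have uE : u = `|u| *: h by rewrite scalerA mulfV ?normr_eq0 // scale1r.
set q := p + s *: u; rewrite [u]uE (hessZ F q `|u| h) (hessZ fermat q `|u| h).
rewrite mulrCA -mulrBr mulr_gt0 ?exprn_gt0 ?normr_gt0 //.
have Ku : K h.
  by split; rewrite /= ?normalize_sphere // dotZr dotC up mulr0.
apply: (hAB (q, e) _ _ Ku); split=> /=.
  apply: h1; rewrite -ball_normE /ball_ /= /q opprD addrA subrr sub0r normrN normrZ ger0_norm //.
  by apply: le_lt_trans ur; rewrite ler_piMl.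
by apply: h2; rewrite /ball /= sub0r normrN gtr0_norm.
Qed.

End Perturbation.

(** * Smoothness for a generic parameter *)

Section GenericSmoothness.
Variable R : realType.
Implicit Type F : {mpoly R[3]}.

Lemma map_mpoly_mderiv (S : nzRingType) (h : {rmorphism R -> S}) F i :
  (map_mpoly h F)^`M(i) = map_mpoly h F^`M(i).
Proof.
by apply/mpolyP => m; rewrite mcoeff_mderiv !mcoeff_map_mpoly /= mcoeff_mderiv rmorphMn.
Qed.

Lemma mderiv_homog F d i : F \is d.+1.-homog -> F^`M(i) \is d.-homog.
Proof.
move=> /dhomogP Fd; apply/dhomogP => m; rewrite mcoeff_msupp mcoeff_mderiv => nz0.
have : (m + U_(i))%MM \in msupp F.
  by rewrite mcoeff_msupp; apply: contraNneq nz0 => ->; rewrite mul0rn.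
by move=> /Fd /=; rewrite mdegD mdeg1 addn1 => -[].
Qed.

Lemma mderiv_fermat i : (fermat R)^`M(i) = 6%:R *: 'X_i ^+ 5.
Proof.
rewrite /fermat raddf_sum (bigD1 i) //= big1 ?addr0 => [|j ji].
  rewrite !mpolyXn mderivX mulmnE mnm1E eqxx mul1n; congr (_ *: 'X_[_]).
  by apply/mnmP => k; rewrite mnmBE !mulmnE mnm1E; case: eqP.
by rewrite mpolyXn mderivX mulmnE mnm1E (negPf ji) mul0n scale0r.
Qed.

(** Macaulay's degree for three quintics, the partials of a sextic: 13 = 3 * (5 - 1) + 1. *)
Definition monomials13 : seq 'X_{1..3} :=
  [seq val m | m <- enum {: 'X_{1..3 < 14}} & mdeg (val m) == 13%N].

Lemma mem_monomials13 m : (m \in monomials13) = (mdeg m == 13%N).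
Proof.
apply/mapP/idP => [[x]|/eqP m13]; first by rewrite mem_filter => /andP[h _] ->.
have m14 : (mdeg m < 14)%N by rewrite m13.
by exists (BMultinom m14) => //; rewrite mem_filter mem_enum /= m13 eqxx.
Qed.

Lemma uniq_monomials13 : uniq monomials13.
Proof. rewrite map_inj_uniq => [|x y /val_inj //].
apply: filter_uniq; exact: enum_uniq. Qed.

(** Exponents at most 4 add up to at most 12, so in degree 13 some variable occurs to the fifth
    power; the default 0 is never reached there. *)
Definition big_index (m : 'X_{1..3}) : 'I_3 := odflt 0 [pick c | (5 <= m c)%N].

Lemma big_indexP m : mdeg m = 13%N -> (5 <= m (big_index m))%N.
Proof.
rewrite /big_index; case: pickP => //= h; rewrite mdegE => e.
have : (\sum_(i < 3) m i <= \sum_(i < 3) 4)%N.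
  by apply: leq_sum => i _; have := h i; rewrite leqNgt => /negbFE.
by rewrite e sum_nat_const card_ord.
Qed.

Lemma prod_mnmD (S : comNzRingType) (v : 'I_3 -> S) (m : 'X_{1..3}) c n :
  \prod_k v k ^+ (m + U_(c) *+ n)%MM k = v c ^+ n * \prod_k v k ^+ m k.
Proof.
under eq_bigr => k _ do rewrite mnmDE exprD mulrC.
rewrite big_split; congr (_ * _).
rewrite (bigD1 c) //= big1 => [|k kc]; first by rewrite mulmnE mnm1E eqxx mul1n mulr1.
by rewrite mulmnE mnm1E eq_sym (negPf kc) mul0n.
Qed.

Lemma meval_monomials13 (S : nzRingType) (v : 'I_3 -> S) (g : {mpoly S[3]}) :
  g \is 13.-homog ->
  g.@[v] = \sum_(m <- monomials13) g@_m * \prod_i v i ^+ m i.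
Proof.
move=> /dhomogP g13; rewrite mevalE.
rewrite [RHS](bigID (fun m => m \in msupp g)) /= [X in _ = _ + X]big1 ?addr0; last first.
  by move=> m; rewrite mcoeff_msupp negbK => /eqP ->; rewrite mul0r.
rewrite -[RHS]big_filter; apply: perm_big; apply: uniq_perm.
- exact: msupp_uniq.
- by rewrite filter_uniq // uniq_monomials13.
by move=> m; rewrite mem_filter mem_monomials13; case: (boolP (m \in _)) => // /g13 ->.
Qed.

(* Macaulay's resultant matrix in degree 13: if all partials of F - e * fermat
   vanish at v, then the vector of monomials of v of degree 13 is an eigenvector
   of a matrix depending on F only, with eigenvalue 6 e. *)
Lemma generic_smooth F : F \is 6.-homog -> exists2 chi : {poly R}, chi != 0 &
  forall e, ~~ root chi (6%:R * e) -> smooth_over_C (pert F e).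
Proof.
move=> F6; pose N := size monomials13.
pose mon (i : 'I_N) := nth 0%MM monomials13 i.
have mon13 i : mdeg (mon i) = 13%N.
  by apply/eqP; rewrite -mem_monomials13 mem_nth.
pose q m := (m - U_(big_index m) *+ 5)%MM.
have qE m : mdeg m = 13%N -> (q m + U_(big_index m) *+ 5)%MM = m.
  move=> m13; apply/mnmP => k; rewrite mnmDE mnmBE mulmnE mnm1E subnK //.
  by case: eqP => [<-|_]; rewrite ?mul1n ?big_indexP.
(* Replacing the factor x_c^5 of the monomial [m] by the partial of F with respect to x_c. At a
   singular point of F - e E this partial equals 6 e x_c^5, so [g m] takes the value 6 e times the
   monomial. *)
pose g m : {mpoly R[3]} := 'X_[q m] * F^`M(big_index m).
have g13 m : mdeg m = 13%N -> g m \is 13.-homog.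
  move=> m13; have -> : 13%N = (8 + 5)%N by [].
  apply: dhomogM; last exact: mderiv_homog.
  rewrite dhomogX /=; have := congr1 mdeg (qE m m13).
  by rewrite mdegD mdegMn mdeg1 m13 mul1n => /eqP; rewrite (eqn_add2r 5 _ 8).
pose A : 'M[R]_N := \matrix_(j, i) (g (mon i))@_(mon j).
exists (char_poly A); first by rewrite monic_neq0 // char_poly_monic.
move=> e nroot fC v v0 fv; rewrite {}/fC in fv *; apply: contrapT => sing; case/negP: nroot.
pose rc : {rmorphism R -> R[i]} := real_complex R.
have dv c : (map_mpoly rc F^`M(c)).@[v 0] = rc (6%:R * e) * v 0 c ^+ 5.
  have : (map_mpoly rc (pert F e)^`M(c)).@[v 0] = 0.
    rewrite -(map_mpoly_mderiv rc).
    by apply/eqP; apply: contraT => h; exfalso; apply: sing; exists c.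
  have -> : (pert F e)^`M(c) = F^`M(c) - (6%:R * e)%:MP * 'X_c ^+ 5.
    rewrite /pert mderivB mderivZ mderiv_fermat scalerA mul_mpolyC.
    by rewrite mulrC.
  rewrite (rmorphB (map_mpoly rc)) (rmorphM (map_mpoly rc)) (rmorphXn (map_mpoly rc)) /=.
  rewrite map_mpolyC map_mpolyX mevalB mevalM mevalC rmorphXn /= mevalXU.
  by move=> /eqP; rewrite subr_eq0 => /eqP.
have gE m : mdeg m = 13%N ->
    rc (6%:R * e) * \prod_k v 0 k ^+ m k = (map_mpoly rc (g m)).@[v 0].
  move=> m13; rewrite /g (rmorphM (map_mpoly rc)) mevalM [X in _ = _ * X]dv.
  rewrite -[in LHS](qE _ m13) prod_mnmD.
  have -> : \prod_k v 0 k ^+ q m k = (map_mpoly rc 'X_[q m]).@[v 0].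
    by rewrite map_mpolyX mevalX.
  by rewrite [LHS]mulrA [LHS]mulrC.
pose w : 'rV[R[i]]_N := \row_j \prod_k v 0 k ^+ mon j k.
have wA : w *m map_mx rc A = rc (6%:R * e) *: w.
  apply/rowP => i; rewrite !mxE.
  rewrite (gE _ (mon13 i)).
  rewrite meval_monomials13; last first.
    apply/dhomogP => m; rewrite mcoeff_msupp mcoeff_map_mpoly /= fmorph_eq0 -mcoeff_msupp.
    exact: (dhomogP _ _ _ (g13 _ (mon13 i))).
  rewrite (big_nth 0%MM) big_mkord; apply: eq_bigr => j _.
  by rewrite !mxE mulrC mcoeff_map_mpoly.
(* The thirteenth power of a nonzero coordinate of [v] is an entry of [w]. *)
have w0 : w != 0.
  have [k vk] : exists k, v 0 k != 0 by apply/rV0Pn.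
  have mk : (U_(k) *+ 13)%MM \in monomials13 by rewrite mem_monomials13 mdegMn mdeg1.
  have jN : (index (U_(k) *+ 13)%MM monomials13 < N)%N by rewrite index_mem.
  apply/rV0Pn; exists (Ordinal jN); rewrite mxE /mon nth_index //.
  apply/prodf_neq0 => i _; rewrite mulmnE mnm1E.
  case: (k =P i) => [<-|_]; first exact: expf_neq0.
  by rewrite mul0n expr0 oner_neq0.
have : eigenvalue (map_mx rc A) (rc (6%:R * e)).
  by apply/eigenvalueP; exists w.
by rewrite eigenvalue_root_char -map_char_poly fmorph_root.
Qed.

(** The values r/2, r/3, ..., as many as the size of [chi], cannot all give roots, since a nonzero
    polynomial has fewer roots than its size. *)
Lemma small_nonroot (chi : {poly R}) r : chi != 0 -> 0 < r ->
  exists2 e, 0 < e < r & ~~ root chi (6%:R * e).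
Proof.
move=> chi0 r0; pose e_ i : R := r / i.+2%:R.
have e01 i : 0 < e_ i < r.
  by rewrite divr_gt0 ?ltr0n //= ltr_pdivrMr ?ltr0n // ltr_pMr // ltr1n.
apply: contrapT => h.
have all_root : all (root chi) [seq 6%:R * e_ i | i <- iota 0 (size chi)].
  apply/allP => _ /mapP[i _ ->]; apply: contraT => nr.
  by exfalso; apply: h; exists (e_ i).
have u : uniq [seq 6%:R * e_ i | i <- iota 0 (size chi)].
  rewrite map_inj_uniq ?iota_uniq // => i j.
  have six : (6%:R : R) != 0 by rewrite pnatr_eq0.
  move=> /(mulfI six); rewrite /e_ => /(mulfI (lt0r_neq0 r0))/invr_inj/eqP.
  by rewrite eqr_nat => /eqP[].
by have := max_poly_roots chi0 all_root u; rewrite size_map size_iota ltnn.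
Qed.

End GenericSmoothness.

(** * Counting components by sign patterns *)

Section Realization.
Variable R : realType.
Implicit Types (p v w l x : 'rV[R]_3) (e r : R).

Definition positive_on (F : {mpoly R[3]}) l :=
  forall x, x != 0 -> dot l x = 0 -> 0 < F.@[x 0].

Lemma radius_forall (I : eqType) (P : seq I) (Q : I -> R -> Prop) :
  (forall i, i \in P -> exists2 r, 0 < r & forall e, 0 < e < r -> Q i e) ->
  exists2 r, 0 < r & forall e, 0 < e < r -> forall i, i \in P -> Q i e.
Proof.
elim: P => [|i P IH] h; first by exists 1.
have [r r0 hr] := h i (mem_head _ _).
have [|s s0 hs] := IH; first by move=> j jP; apply: h; rewrite in_cons jP orbT.
exists (Num.min r s); first by rewrite lt_min r0 s0.
move=> e /andP[e0]; rewrite lt_min => /andP[er es] j.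
by rewrite in_cons => /orP[/eqP ->|/hs]; [apply: hr; rewrite e0|apply; rewrite e0].
Qed.

Lemma pert_pos_compact F (K : set 'rV[R]_3) : compact K ->
  (forall v, K v -> 0 < F.@[v 0]) ->
  exists2 r, 0 < r & forall e, 0 < e < r -> forall v, K v -> 0 < (pert F e).@[v 0].
Proof.
move=> cK h; apply: near0_radius.
pose Phi (z : 'rV[R]_3 * R) := F.@[z.1 0] - z.2 * (fermat R).@[z.1 0].
have cPhi : continuous Phi.
  have c1 : continuous (fun z : 'rV[R]_3 * R => z.1) by move=> z; exact: cvg_fst.
  apply: continuous_addR; first exact: continuous_meval.
  apply: continuous_oppR; apply: continuous_mulR; last exact: continuous_meval.
  by move=> z; exact: cvg_snd.
have : \forall e \near (0 : R), forall v, K v -> 0 < Phi (v, e).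
  by apply: compact_pos => // v Kv; rewrite /Phi mul0r subr0 h.
by apply: filterS => e he v Kv; rewrite pertE; exact: he.
Qed.

Lemma positive_on_pert F l : F \is 6.-homog -> positive_on F l ->
  exists2 r, 0 < r & forall e, 0 < e < r -> positive_on (pert F e) l.
Proof.
move=> F6 h.
have cK : compact ([set x | dot l x = 0] `&` [set x | `|x| = 1]).
  by apply: compact_sphere; apply: closed_eq0; exact: dot_continuous.
have [x [/= lx x1]|r r0 hr] := pert_pos_compact (F := F) cK.
  by apply: h => //; apply/eqP => x0; move: x1; rewrite x0 normr0 => /eqP; rewrite eq_sym oner_eq0.
exists r => // e er x x0 lx.
have n0 : 0 < `|x| by rewrite normr_gt0.
have := hr e er (`|x|^-1 *: x) (conj _ (normalize_sphere x0)).
rewrite /= dotZr lx mulr0 => /(_ erefl).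
rewrite (meval_homogZ _ _ (pert_homog e F6)) pmulr_rgt0 //.
by rewrite exprn_gt0 // invr_gt0.
Qed.

Lemma avoids_of_positive F l : positive_on F l -> avoids F l.
Proof. by move=> h v v0 fv; apply/eqP => lv; have := h _ v0 lv; rewrite fv ltxx. Qed.

(** The common frame for isolated zeros and for a disc: centers only need F <= 0, and the
    neighbourhoods are arbitrary open cones covering the set where F <= 0. Three bounds on [e] keep
    the zeros linked, the listed lines positive and the perturbed curve inside the neighbourhoods; a
    nonroot of [chi] below them gives smoothness. *)
Lemma sextic_of_centers (F : {mpoly R[3]}) (p0 : 'rV[R]_3) (P L : seq 'rV[R]_3)
    (N : 'rV[R]_3 -> set 'rV[R]_3) :
  F \is 6.-homog -> p0 \in P ->
  (forall p, p \in P -> [/\ p != 0, F.@[p 0] <= 0, open (N p),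
     (forall (c : R) v, 0 < c -> N p v -> N p (c *: v)) & locally_linked F p (N p)]) ->
  (forall v, v != 0 -> F.@[v 0] <= 0 -> exists2 p, p \in P & N p v) ->
  (0 < size L)%N ->
  (forall l, l \in L -> 0 < dot l p0 /\ positive_on F l) ->
  uniq (map (pattern P) L) ->
  (forall l, 0 < dot l p0 -> positive_on F l -> pattern P l \in map (pattern P) L) ->
  exists f : {mpoly R[3]},
    [/\ smooth_real_sextic f,
        connected_components (avoidance_locus f) #= `I_(size L) &
        forall K, connected_components (avoidance_locus f) K -> convex_as_cone K].
Proof.
move=> F6 p0P hP cov L0 hL uL cL.
have [r1 r10 h1] : exists2 r, 0 < r & forall e, 0 < e < r -> forall p, p \in P ->
    forall v, N p v -> (pert F e).@[v 0] = 0 ->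
    exists2 w, w = v \/ w = - v &
      forall l, positive_on (pert F e) l -> 0 < dot l w * dot l p.
  by apply: radius_forall => p pP; have [_ _ _ _] := hP _ pP.
have [r2 r20 h2] : exists2 r, 0 < r & forall e, 0 < e < r -> forall l, l \in L ->
    positive_on (pert F e) l.
  by apply: radius_forall => l lL; apply: positive_on_pert => //; have [] := hL _ lL.
have [r3 r30 h3] : exists2 r, 0 < r & forall e, 0 < e < r -> forall v, v != 0 ->
    (pert F e).@[v 0] <= 0 -> exists2 p, p \in P & N p v.
  (* Outside the neighbourhoods F is positive, and on the sphere this set is compact, so small
     perturbations stay positive there. *)
  pose C : set 'rV[R]_3 := \bigcap_(p in [set p | p \in P]) ~` N p.
  have cC : closed C.
    by apply: closed_bigI => p pP; apply: open_closedC; have [] := hP _ pP.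
  have [v [Cv v1]|r r0 hr] := pert_pos_compact (F := F) (compact_sphere cC).
    have v0 : v != 0.
      by apply/eqP => v0; move: v1; rewrite /= v0 normr0 => /eqP; rewrite eq_sym oner_eq0.
    by rewrite ltNge; apply/negP => /(cov _ v0)[p pP]; exact: Cv.
  exists r => // e er v v0 fv; apply: contrapT => h.
  have n0 : 0 < `|v| by rewrite normr_gt0.
  have : 0 < (pert F e).@[(`|v|^-1 *: v) 0].
    apply: hr => //; split; last exact: normalize_sphere.
    move=> p pP Np; apply: h; exists p => //.
    have [_ _ _ /(_ _ _ n0 Np)] := hP _ pP.
    by rewrite scalerA mulfV ?gt_eqF // scale1r.
  rewrite (meval_homogZ _ _ (pert_homog e F6)) pmulr_rgt0 ?exprn_gt0 ?invr_gt0 //.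
  by rewrite ltNge fv.
have [chi chi0 smooth] := generic_smooth F6.
pose r := Num.min r1 (Num.min r2 r3).
have r0 : 0 < r by rewrite !lt_min r10 r20 r30.
have [e /andP[e0]] := small_nonroot chi0 r0; rewrite !lt_min => /and3P[er1 er2 er3] nr.
have {}h1 := h1 e (introT andP (conj e0 er1)).
have {}h2 := h2 e (introT andP (conj e0 er2)).
have {}h3 := h3 e (introT andP (conj e0 er3)).
set f := pert F e in h1 h2 h3.
have f6 : f \is 6.-homog by exact: pert_homog.
have fP p : p \in P -> f.@[p 0] < 0.
  move=> pP; have [p_n0 Fp _ _ _] := hP _ pP.
  by rewrite pertE subr_lt0; apply: le_lt_trans Fp _; rewrite mulr_gt0 // fermat_gt0.
have [l0 l0L] : exists l0, l0 \in L by case: (L) L0 => // l0 ? _; exists l0; exact: mem_head.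
have [l0p _] := hL _ l0L.
(* A zero between a point of the line [l0], where [f] > 0, and the center [p0], where [f] < 0. The
   segment misses the origin because [l0] is not zero at [p0]. *)
have fZ : exists2 v : 'rV[R]_3, v != 0 & f.@[v 0] = 0.
  have [x x0 [lx _]] := common_zero l0 l0.
  have [t [t0 t1 ft]] := segment_root (h2 _ l0L _ x0 lx) (ltW (fP _ p0P)).
  exists ((1 - t) *: x + t *: p0) => //; apply/eqP => z0.
  have : dot l0 ((1 - t) *: x + t *: p0) = 0 by rewrite z0 dot0r.
  rewrite dotDr !dotZr lx mulr0 add0r => /eqP; rewrite mulf_eq0 [dot _ _ == 0]gt_eqF // orbF => /eqP t00.
  by move/eqP: z0; rewrite t00 subr0 scale1r scale0r addr0 (negPf x0).
have pos l : avoids f l -> positive_on f l.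
  by move=> la; apply: (positive_on_avoiding f6 (h2 _ l0L) la).
exists f; split; [by split; [|exact: smooth]| |].
  apply: (@card_components _ f f6 fZ p0 P p0P).
  - move=> p l pP la; have [p_n0 _ _ _ _] := hP _ pP.
    apply/eqP => lp; have := pos _ la _ p_n0 lp; rewrite ltNge => /negP; apply.
    exact/ltW/fP.
  - move=> v v0 fv; have [|p pP Np] := h3 v v0; first by rewrite fv.
    have [w wv hw] := h1 p pP v Np fv.
    by exists w, p; split=> // l /pos; exact: hw.
  - move=> l lL; split; last by have [] := hL _ lL.
    exact/avoids_of_positive/h2.
  - exact: uL.
  (* Since [f] < F away from 0, a line positive for [f] is positive for F, so its pattern is
     listed. *)
  move=> l la lp; apply: cL => // x x0 lx.
  have := pos _ la _ x0 lx; rewrite pertE subr_gt0; apply: lt_trans.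
  by rewrite mulr_gt0 // fermat_gt0.
exact: component_convex.
Qed.

End Realization.

(** * Integer certificates *)

Definition zvec := (Z * Z * Z)%type.
Definition zterm := (Z * (nat * nat * nat))%type.
Definition zpoly := seq zterm.

Definition zcoord (p : zvec) (i : nat) : Z :=
  let: (x, y, z) := p in match i with 0%N => x | 1%N => y | _ => z end.

Definition zdot (p q : zvec) : Z :=
  Z.add (Z.add (Z.mul (zcoord p 0) (zcoord q 0)) (Z.mul (zcoord p 1) (zcoord q 1)))
    (Z.mul (zcoord p 2) (zcoord q 2)).

Definition expo (m : nat * nat * nat) (i : nat) : nat :=
  let: (a, b, c) := m in match i with 0%N => a | 1%N => b | _ => c end.

Definition mlt (m n : nat * nat * nat) : bool :=
  (expo m 0 < expo n 0)%N || (expo m 0 == expo n 0) &&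
  ((expo m 1 < expo n 1)%N || (expo m 1 == expo n 1) && (expo m 2 < expo n 2)%N).

Definition mmul (m n : nat * nat * nat) : nat * nat * nat :=
  (expo m 0 + expo n 0, expo m 1 + expo n 1, expo m 2 + expo n 2)%N.

(* Merging of sorted lists of terms; its correctness does not need sortedness. *)
Fixpoint padd (p : zpoly) : zpoly -> zpoly :=
  fix aux (q : zpoly) : zpoly :=
    match p, q with
    | [::], _ => q
    | _, [::] => p
    | s :: p', t :: q' =>
      if s.2 == t.2 then (Z.add s.1 t.1, s.2) :: padd p' q'
      else if mlt s.2 t.2 then s :: padd p' q else t :: aux q'
    end.

Definition pterm (s : zterm) (q : zpoly) : zpoly :=
  [seq (Z.mul s.1 t.1, mmul s.2 t.2) | t <- q].

Definition pmul (p q : zpoly) : zpoly := foldr (fun s => padd (pterm s q)) [::] p.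

Definition pscale (a : Z) (q : zpoly) : zpoly := pterm (a, (0, 0, 0)%N) q.

Definition psum (ps : seq zpoly) : zpoly := foldr padd [::] ps.

Definition pzero (p : zpoly) : bool := all (fun t : zterm => Z.eqb t.1 Z0) p.

Definition peq (p q : zpoly) : bool := pzero (padd p (pscale (Zneg xH) q)).

Fixpoint zpow (x : Z) (n : nat) : Z := if n is n'.+1 then Z.mul x (zpow x n') else Zpos xH.

Definition zeval (p : zpoly) (v : zvec) : Z :=
  foldr (fun (t : zterm) s => Z.add (Z.mul t.1 (Z.mul (Z.mul (zpow (zcoord v 0) (expo t.2 0))
    (zpow (zcoord v 1) (expo t.2 1))) (zpow (zcoord v 2) (expo t.2 2)))) s) Z0 p.

Definition mdec (c : nat) (m : nat * nat * nat) : nat * nat * nat :=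
  let: (i, j, k) := m in
  match c with 0%N => (i.-1, j, k) | 1%N => (i, j.-1, k) | _ => (i, j, k.-1) end.

Definition pderiv (c : nat) (p : zpoly) : zpoly :=
  [seq (Z.mul t.1 (Z.of_nat (expo t.2 c)), mdec c t.2) | t <- p].

(** Fraction-free symmetric elimination: the pivot is positive, the first column agrees with the
    first row, and the Schur complement multiplied by the pivot passes the same test. *)
Fixpoint posdef (n : nat) (M : seq (seq Z)) : bool :=
  match n, M with
  | 0%N, [::] => true
  | n'.+1, (a :: r) :: M' =>
    [&& Z.ltb Z0 a, all2 (fun g s => if s is h :: s' then Z.eqb g h && (size s' == n') else false) r M',
        size r == n' & posdef n' [seq [seq Z.sub (Z.mul a xy.1) (Z.mul (head Z0 s) xy.2) | xy <- zip (behead s) r] | s <- M']]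
  | _, _ => false
  end.

(** * Soundness of the integer computations over the reals *)

Section ZReal.
Variable R : realType.
Implicit Types (v u : 'rV[R]_3).

Definition zR (z : Z) : R := (int_of_Z z)%:~R.

Lemma zR0 : zR Z0 = 0. Proof. by []. Qed.
Lemma zR1 : zR (Zpos xH) = 1. Proof. by []. Qed.

Lemma zRD a b : zR (Z.add a b) = zR a + zR b.
Proof. by rewrite /zR -intrD; congr _%:~R; lia. Qed.

Lemma zRM a b : zR (Z.mul a b) = zR a * zR b.
Proof. by rewrite /zR -intrM; congr _%:~R; lia. Qed.

Lemma zRN a : zR (Z.opp a) = - zR a.
Proof. by rewrite /zR -intrN; congr _%:~R; lia. Qed.

Lemma zRB a b : zR (Z.sub a b) = zR a - zR b.
Proof. by rewrite -zRN -zRD; congr zR; lia. Qed.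

Lemma zR_nat n : zR (Z.of_nat n) = n%:R.
Proof. by rewrite /zR (_ : int_of_Z _ = n%:Z) //; lia. Qed.

Lemma zR_gt0 a : (0 < zR a) = Z.ltb Z0 a.
Proof. rewrite /zR ltr0z; lia. Qed.

Lemma zR_ge0 a : (0 <= zR a) = Z.leb Z0 a.
Proof. rewrite /zR ler0z; lia. Qed.

Lemma zR_eq0 a : (zR a == 0) = Z.eqb a Z0.
Proof. rewrite /zR intr_eq0; lia. Qed.

Lemma zR_pow x n : zR (zpow x n) = zR x ^+ n.
Proof. by elim: n => [|n IH] //=; rewrite zRM IH exprS. Qed.

Lemma ord3P (i : 'I_3) : [\/ i = 0, i = 1 | i = 2%:R].
Proof.
by case: i => [[|[|[|//]]] hi]; [constructor 1|constructor 2|constructor 3]; exact: val_inj.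
Qed.

Lemma sum3 (V : nmodType) (F : 'I_3 -> V) : \sum_i F i = F 0 + F 1 + F 2%:R.
Proof.
rewrite !big_ord_recl big_ord0 addr0 addrA; congr (_ + _ + _); congr F; exact: val_inj.
Qed.

Lemma prod3 (F : 'I_3 -> R) : \prod_i F i = F 0 * F 1 * F 2%:R.
Proof.
rewrite !big_ord_recl big_ord0 mulr1 mulrA; congr (_ * _ * _); congr F; exact: val_inj.
Qed.

Definition vecZ (p : zvec) : 'rV[R]_3 := \row_i zR (zcoord p i).

Lemma dot_vecZ p q : dot (vecZ p) (vecZ q) = zR (zdot p q).
Proof. by rewrite /dot sum3 !mxE /zdot !zRD !zRM. Qed.

Definition mnmZ (m : nat * nat * nat) : 'X_{1..3} := [multinom expo m i | i < 3].

Definition toM (p : zpoly) : {mpoly R[3]} := \sum_(t <- p) zR t.1 *: 'X_[mnmZ t.2].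

Lemma toM_cons t p : toM (t :: p) = zR t.1 *: 'X_[mnmZ t.2] + toM p.
Proof. by rewrite /toM big_cons. Qed.

Lemma toM_nil : toM [::] = 0. Proof. by rewrite /toM big_nil. Qed.

Lemma toM_padd p q : toM (padd p q) = toM p + toM q.
Proof.
elim: p q => [|s p IHp]; elim=> [|t q IHq] //=; rewrite ?toM_nil ?add0r ?addr0 //.
case: eqP => [e|_].
  by rewrite !toM_cons /= IHp zRD scalerDl e addrACA.
case: ifP => _; rewrite toM_cons.
  by rewrite IHp !toM_cons addrA.
by move: IHq => /= ->; rewrite !toM_cons addrCA.
Qed.

Lemma mnmZ_mul m n : mnmZ (mmul m n) = (mnmZ m + mnmZ n)%MM.
Proof.
by apply/mnmP => i; rewrite mnmDE !mnmE; case: i => [[|[|[|]]]].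
Qed.

Lemma toM_pterm s q : toM (pterm s q) = zR s.1 *: 'X_[mnmZ s.2] * toM q.
Proof.
rewrite /toM big_map mulr_sumr; apply: eq_bigr => t _ /=.
by rewrite zRM mnmZ_mul mpolyXD -scalerAl -scalerAr scalerA.
Qed.

Lemma toM_pmul p q : toM (pmul p q) = toM p * toM q.
Proof.
elim: p => [|s p IH] /=; first by rewrite !toM_nil mul0r.
by rewrite toM_padd toM_pterm IH toM_cons mulrDl.
Qed.

Lemma toM_pscale a q : toM (pscale a q) = zR a *: toM q.
Proof.
rewrite toM_pterm /= (_ : mnmZ _ = 0%MM) ?mpolyX0 -?scalerAl ?mul1r //.
by apply/mnmP => i; rewrite mnm0E mnmE; case: i => [[|[|[|]]]].
Qed.

Lemma toM_psum ps : toM (psum ps) = \sum_(p <- ps) toM p.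
Proof.
by elim: ps => [|p ps IH] /=; rewrite ?big_nil ?toM_nil // toM_padd IH big_cons.
Qed.

Lemma toM_pzero p : pzero p -> toM p = 0.
Proof.
move=> /allP h; rewrite /toM big_seq big1 // => t /h /=.
by rewrite -zR_eq0 => /eqP ->; rewrite scale0r.
Qed.

Lemma toM_peq p q : peq p q -> toM p = toM q.
Proof.
move=> /toM_pzero; rewrite toM_padd toM_pscale (zRN (Zpos xH)) zR1 scaleN1r => /eqP.
by rewrite subr_eq0 => /eqP.
Qed.

Lemma meval_toM p (v : zvec) : (toM p).@[vecZ v 0] = zR (zeval p v).
Proof.
elim: p => [|t p IH]; first by rewrite toM_nil meval0.
rewrite toM_cons mevalD mevalZ mevalX IH /= zRD zRM; congr (_ * _ + _).
by rewrite prod3 !mnmE !mxE !zRM !zR_pow.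
Qed.

Lemma toM_pderiv (c : 'I_3) p : toM (pderiv c p) = (toM p)^`M(c).
Proof.
rewrite /toM big_map raddf_sum; apply: eq_bigr => -[a [[i j] k]] _ /=.
rewrite mderivZ mderivX zRM zR_nat scalerA.
have -> : mnmZ (i, j, k) c = expo (i, j, k) c by rewrite mnmE.
congr (_ *: 'X_[_]); apply/mnmP => x; rewrite mnmBE mnm1E !mnmE.
by case: c => [[|[|[|//]]] ?]; case: x => [[|[|[|//]]] ?]; rewrite -val_eqE /= ?subn0 ?subn1.
Qed.

Lemma toM_homog d p : all (fun t : zterm => expo t.2 0 + expo t.2 1 + expo t.2 2 == d)%N p ->
  toM p \is d.-homog.
Proof.
move=> /allP h; rewrite /toM big_seq; apply: rpred_sum => t /h /= /eqP e.
apply: rpredZ; rewrite dhomogX /= mdegE sum3 !mnmE; apply/eqP.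
by [].
Qed.

Definition lin (r : seq Z) (x : seq R) : R := \sum_(t <- zip r x) zR t.1 * t.2.

Definition qform (M : seq (seq Z)) (x : seq R) : R :=
  \sum_(t <- zip M x) t.2 * lin t.1 x.

Lemma lin_nil x : lin [::] x = 0.
Proof. by case: x => [|x0 x]; rewrite /lin big_nil. Qed.

Lemma lin_nilr r : lin r [::] = 0.
Proof. by case: r => [|a r]; rewrite /lin big_nil. Qed.

Lemma lin_cons a r x0 x : lin (a :: r) (x0 :: x) = zR a * x0 + lin r x.
Proof. by rewrite /lin big_cons. Qed.

Lemma lin_zero r x : (forall i, nth 0 x i = 0) -> lin r x = 0.
Proof.
elim: r x => [|a r IH] [|x0 x] h; rewrite ?lin_nil ?lin_nilr //.
rewrite lin_cons IH => [|i]; last exact: (h i.+1).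
by rewrite (h 0%N : x0 = 0) mulr0 add0r.
Qed.

Lemma lin_sub a g s r x : size s = size r ->
  lin [seq Z.sub (Z.mul a xy.1) (Z.mul g xy.2) | xy <- zip s r] x =
  zR a * lin s x - zR g * lin r x.
Proof.
elim: s r x => [|b s IH] [|c r] // x; first by rewrite !lin_nil !mulr0 subrr.
case: x => [|x0 x] [h]; first by rewrite !lin_nilr !mulr0 subrr.
rewrite /=; by rewrite !lin_cons IH // zRB !zRM; ring.
Qed.

(** Completing the square: a times the form is (a x0 + r.y)^2 plus the form of the scaled Schur
    complement in y. *)
Lemma posdefP n M x : posdef n M -> size x = n -> 0 <= qform M x /\
  (qform M x = 0 -> forall i, nth 0 x i = 0).
Proof.
elim: n M x => [|n IH] M x.
  case: M => // _ /size0nil ->; split; first by rewrite /qform big_nil.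
  by move=> _ i; rewrite nth_nil.
case: M => // -[//|a r] M; case: x => // x0 y /= /and4P[a0 sym /eqP szr pd] [szy].
pose M2 := [seq [seq Z.sub (Z.mul a xy.1) (Z.mul (head Z0 s) xy.2) | xy <- zip (behead s) r] | s <- M].
have [h1 h2] := IH M2 y pd szy.
(* The sum over rows is separated from the full vectors [r] and [y], so that induction on the rows
   is possible. *)
have rows r1 y1 : all2 (fun g s => if s is h :: s' then Z.eqb g h && (size s' == n) else false) r1 M ->
    zR a * (\sum_(t <- zip M y1) t.2 * lin t.1 (x0 :: y)) =
    zR a * x0 * lin r1 y1 + lin r1 y1 * lin r y +
    \sum_(t <- zip M2 y1) t.2 * lin t.1 y.
  rewrite /M2; clear M2 sym pd h1 h2.
  elim: M r1 y1 => [|s M IHM] [|g r1] // y1.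
    by rewrite lin_nil; case: y1 => [|? ?]; rewrite /= !big_nil mulr0 mul0r !addr0 mulr0.
  case: y1 => [|y0 y1]; first by rewrite lin_nilr /= !big_nil mulr0 mul0r !addr0 mulr0.
  case: s => //= h s /andP[/andP[/Z.eqb_eq -> /eqP szs] sym].
  rewrite !big_cons /= lin_sub ?szs // !lin_cons mulrDr (IHM _ _ sym); ring.
have e : zR a * qform ((a :: r) :: M) (x0 :: y) = (zR a * x0 + lin r y) ^+ 2 + qform M2 y.
  rewrite /qform big_cons /= lin_cons mulrDr (rows _ _ sym); ring.
have a_gt0 : 0 < zR a by rewrite zR_gt0.
split; first by rewrite -(pmulr_rge0 _ a_gt0) e addr_ge0 // sqr_ge0.
move=> q0; move: e; rewrite q0 mulr0 => /esym/eqP.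
rewrite paddr_eq0 ?sqr_ge0 // => /andP[/eqP s0 /eqP q2].
have y0 := h2 q2.
have l0 : lin r y = 0 by exact: lin_zero.
move/eqP: s0; rewrite l0 addr0 sqrf_eq0 mulf_eq0 gt_eqF //= => /eqP x00.
by case=> [|i] //=.
Qed.

End ZReal.

(** * Nonnegative sextics with nondegenerate zeros *)

Section NonnegativeForms.
Variable R : realType.
Implicit Types (p u v w l x : 'rV[R]_3) (e r : R).

(** For F >= 0 with exactly these zeros, positivity on a line means missing the points of [P], so
    the count becomes a question about a finite point set. *)
Lemma sextic_of_zeros (F : {mpoly R[3]}) (p0 : 'rV[R]_3) (P L : seq 'rV[R]_3) :
  F \is 6.-homog -> p0 \in P ->
  (forall v, 0 <= F.@[v 0]) ->
  (forall p, p \in P -> [/\ p != 0, F.@[p 0] = 0 &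
     forall u, u != 0 -> dot u p = 0 -> 0 < hess F p u]) ->
  (forall v, v != 0 -> F.@[v 0] = 0 -> exists2 p, p \in P & exists c, v = c *: p) ->
  (0 < size L)%N ->
  (forall l, l \in L -> 0 < dot l p0 /\ forall p, p \in P -> dot l p != 0) ->
  uniq (map (pattern P) L) ->
  (forall l, 0 < dot l p0 -> (forall p, p \in P -> dot l p != 0) ->
     pattern P l \in map (pattern P) L) ->
  exists f : {mpoly R[3]},
    [/\ smooth_real_sextic f,
        connected_components (avoidance_locus f) #= `I_(size L) &
        forall K, connected_components (avoidance_locus f) K -> convex_as_cone K].
Proof.
move=> F6 p0P Fge0 hP zeros L0 hL uL cL.
have /choice [rad hrad] : forall p, exists r, p \in P ->
    0 < r /\ locally_linked F p (cone_nbhd p r).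
  move=> p; have [pP|] := boolP (p \in P); last by exists 0.
  have [p_n0 Fp Hp] := hP _ pP.
  by have [r r0 hr] := point_linked F6 p_n0 Fp Hp; exists r.
apply: (@sextic_of_centers R F p0 P L (fun p => cone_nbhd p (rad p))) => //.
- move=> p pP; have [p_n0 Fp _] := hP _ pP; have [r0 hr] := hrad _ pP.
  split=> //; [by rewrite Fp|exact: cone_nbhd_open|].
  by move=> c v c0; apply: cone_nbhd_scale; rewrite gt_eqF.
- move=> v v0 Fv; have [|p pP [c vc]] := zeros v v0.
    by apply/eqP; rewrite eq_le Fv Fge0.
  exists p => //; have [r0 _] := hrad _ pP; have [p_n0 _ _] := hP _ pP.
  have c0 : c != 0 by apply: contraNneq v0 => c0; rewrite vc c0 scale0r.
  by rewrite vc; apply: cone_nbhd_scale => //; exact: cone_nbhd_mem.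
- move=> l lL; have [lp hl] := hL _ lL; split=> // x x0 lx.
  rewrite lt_neqAle Fge0 andbT eq_sym; apply/eqP => Fx.
  have [p pP [c xc]] := zeros x x0 Fx.
  have c0 : c != 0 by apply: contraNneq x0 => c0; rewrite xc c0 scale0r.
  by move: lx; rewrite xc dotZr => /eqP; rewrite mulf_eq0 (negPf c0) (negPf (hl _ pP)).
move=> l lp lpos; apply: cL => // p pP; have [p_n0 Fp _] := hP _ pP.
by apply/eqP => /(lpos _ p_n0); rewrite Fp ltxx.
Qed.

(** At a zero of C the second derivative of C^2 along a line is 2 C'^2. *)
Lemma hess_sqr (C : {mpoly R[3]}) p u : C.@[p 0] = 0 -> 0 <= hess (C ^+ 2) p u.
Proof.
move=> Cp; have := deriv2_line_poly p u (C ^+ 2) 0; rewrite scale0r addr0 => <-.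
rewrite /line_poly rmorphXn /= -/(line_poly p u C) expr2 !(derivM, derivD) !(hornerD, hornerM).
rewrite [(line_poly p u C).[0]]line_polyE scale0r addr0 Cp mulr0 mul0r add0r addr0.
by rewrite addr_ge0 // -expr2 sqr_ge0.
Qed.

Lemma hessD (F G : {mpoly R[3]}) p u : hess (F + G) p u = hess F p u + hess G p u.
Proof.
rewrite /hess -big_split; apply: eq_bigr => i _; rewrite -big_split; apply: eq_bigr => j _.
by rewrite !mderivD mevalD mulrDl.
Qed.

Lemma hess0 p u : hess 0 p u = 0.
Proof. by rewrite /hess big1 // => i _; rewrite big1 // => j _; rewrite !mderiv0 meval0 mul0r. Qed.

End NonnegativeForms.

(** * Certificates for sextics with ten zeros *)

Definition mons (d : nat) : seq (nat * nat * nat) :=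
  flatten [seq [seq (i, j, d - i - j)%N | j <- iota 0 (d - i).+1] | i <- iota 0 d.+1].

(** Coefficients are listed in increasing [mlt] order of the monomials, so that [padd] collects
    equal terms. *)
Definition zform (d : nat) (c : seq Z) : zpoly := zip c (mons d).

Definition linform (a : zvec) : zpoly :=
  [:: (zcoord a 2, (0, 0, 1)%N); (zcoord a 1, (0, 1, 0)%N); (zcoord a 0, (1, 0, 0)%N)].

Definition zunit (k : nat) : zvec :=
  match k with 0%N => (Zpos xH, Z0, Z0) | 1%N => (Z0, Zpos xH, Z0) | _ => (Z0, Z0, Zpos xH) end.

(** The linear forms v -> (v x p)_k; for nonzero p they vanish together exactly on the multiples of
    p. *)
Definition zcross (p : zvec) (k : nat) : zvec :=
  let: (x, y, z) := p in
  match k with 0%N => (Z0, z, Z.opp y) | 1%N => (Z.opp z, Z0, x) | _ => (y, Z.opp x, Z0) end.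

Definition gram (M : seq (seq Z)) (s : seq zpoly) : zpoly :=
  psum [seq pmul rt.2 (psum [seq pscale ct.1 ct.2 | ct <- zip rt.1 s]) | rt <- zip M s].

Definition pcoef (p : zpoly) (m : nat * nat * nat) : Z :=
  head Z0 [seq t.1 | t <- p & t.2 == m].

(** The Hessian plus p p^T. By Euler's relation p is in the kernel of the Hessian at a singular
    zero; the added term turns positivity on the orthogonal complement of p into positive
    definiteness. *)
Definition zhess (F : zpoly) (p : zvec) : seq (seq Z) :=
  [seq [seq Z.add (zeval (pderiv j (pderiv i F)) p) (Z.mul (zcoord p i) (zcoord p j))
    | j <- iota 0 3] | i <- iota 0 3].

(* A nonnegative ternary sextic F with a list of zeros: the certificate says that
   D q F = s^T G s, with q and G positive definite and s a family of quartics that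
   spans those vanishing at the zeros; the cubics C_i satisfy C_i(p_j) = W [i = j]. *)
Record config := Config {
  zeros : seq zvec;
  sextic : seq Z;
  multiplier : seq (seq Z);
  denominator : Z;
  quartics : seq (seq Z);
  pivots : seq nat;
  leading : Z;
  gramian : seq (seq Z);
  cubics : seq (seq Z);
  weight : Z;
  lines : seq zvec }.

Definition F_ (c : config) : zpoly := zform 6 (sextic c).
Definition q_ (c : config) : zpoly := gram (multiplier c) [seq linform (zunit k) | k <- iota 0 3].
Definition s_ (c : config) : seq zpoly := [seq zform 4 s | s <- quartics c].
Definition C_ (c : config) : seq zpoly := [seq zform 3 s | s <- cubics c].

(** The quartics are in reduced echelon form: at its pivot each has coefficient [leading c] and the
    others have 0. Hence the coefficients of p at the pivots are those of its expansion. *)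
Definition in_span (c : config) (p : zpoly) : bool :=
  peq (pscale (leading c) p)
    (psum [seq pscale (pcoef p (nth (0, 0, 0)%N (mons 4) js.1)) js.2 | js <- zip (pivots c) (s_ c)]).

(** The last two checks locate the zeros: the products of C_i with the linear forms of p_i lie in
    the span of the quartics, and the interpolation formula W x_k^3 = sum_i (p_i)_k^3 C_i shows that
    the C_i have no common zero. *)
Definition good_config (c : config) : bool :=
  [&& posdef 3 (multiplier c), posdef 5 (gramian c), size (quartics c) == 5%N,
      Z.ltb Z0 (denominator c), ~~ Z.eqb (leading c) Z0, ~~ Z.eqb (weight c) Z0
    & [&& size (cubics c) == size (zeros c),
      peq (pscale (denominator c) (pmul (q_ c) (F_ c))) (gram (gramian c) (s_ c)),
      all (fun p => [&& Z.ltb Z0 (zdot p p), Z.eqb (zeval (F_ c) p) Z0 &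
         posdef 3 (zhess (F_ c) p)]) (zeros c),
      all (fun i => all (fun j => Z.eqb (zeval (nth [::] (C_ c) i) (nth (zunit 0) (zeros c) j))
         (if i == j then weight c else Z0)) (iota 0 (size (zeros c)))) (iota 0 (size (zeros c))),
      all (fun pC => all (fun k => in_span c (pmul (linform (zcross pC.1 k)) pC.2)) (iota 0 3))
         (zip (zeros c) (C_ c))
    & all (fun k => peq (psum [seq pscale (zpow (zcoord pC.1 k) 3) pC.2 | pC <- zip (zeros c) (C_ c)])
         (pscale (weight c) (let x := linform (zunit k) in pmul x (pmul x x)))) (iota 0 3)]].

(** * What a valid certificate proves *)

Section GoodConfig.
Variable R : realType.
Implicit Types (v u : 'rV[R]_3).

Lemma mons_homog d m : m \in mons d -> (expo m 0 + expo m 1 + expo m 2 == d)%N.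
Proof.
move=> /allpairsPdep [i [j]]; rewrite !mem_iota => -[/andP[_ id] /andP[_ jd] ->] /=.
by apply/eqP; lia.
Qed.

Lemma zip_snd (S T : eqType) (s : seq S) (t : seq T) x y : (x, y) \in zip s t -> y \in t.
Proof.
elim: s t => [|a s IH] [|b t] //=; rewrite !in_cons xpair_eqE => /orP[/andP[_ ->] //|/IH ->].
by rewrite orbT.
Qed.

Lemma zform_homog d c : toM R (zform d c) \is d.-homog.
Proof.
apply: toM_homog; apply/allP => -[a m] /zip_snd /=.
exact: mons_homog.
Qed.

Lemma meval_linform a v : (toM R (linform a)).@[v 0] = dot (vecZ R a) v.
Proof.
rewrite /linform !toM_cons toM_nil addr0 !mevalD !mevalZ !mevalX !prod3 !mnmE /=.
rewrite /dot sum3 !mxE; ring.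
Qed.

Lemma meval_gram M s v :
  (toM R (gram M s)).@[v 0] = qform M [seq (toM R t).@[v 0] | t <- s].
Proof.
rewrite /gram toM_psum big_map raddf_sum /= /qform.
have -> : zip M [seq (toM R t).@[v 0] | t <- s] =
    [seq (rt.1, (toM R rt.2).@[v 0]) | rt <- zip M s].
  by elim: M s => [|r M IH] [|t s] //=; rewrite IH.
rewrite big_map; apply: eq_bigr => -[r t] _ /=.
rewrite toM_pmul mevalM; congr (_ * _).
rewrite toM_psum big_map raddf_sum /= /lin.
elim: r s => [|a r IH] [|t' s]; rewrite /= ?big_nil // !big_cons IH.
by rewrite toM_pscale mevalZ.
Qed.

Section Certified.
Variable c : config.
Hypothesis good : good_config c.

Let Fm := toM R (F_ c).

Lemma multiplier_gt0 v : v != 0 -> 0 < (toM R (q_ c)).@[v 0].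
Proof.
move=> v0; move: good => /and5P[pq _ _ _ _].
rewrite /q_ meval_gram; set x := map _ _.
have xE : x = [:: v 0 0; v 0 1; v 0 2%:R].
  rewrite /x /= !meval_linform /dot !sum3 !mxE /= zR0 zR1.
  by rewrite !(mul0r, mul1r, addr0, add0r).
have [h1 h2] := posdefP pq (erefl : size x = 3%N).
rewrite lt_neqAle h1 andbT eq_sym; apply: contra v0 => /eqP /h2; rewrite xE => h.
apply/eqP/rowP => i; rewrite mxE.
case: i => [[|[|[|//]]] hi].
- by rewrite -(h 0%N) /=; congr (v 0 _); exact: val_inj.
- by rewrite -(h 1%N) /=; congr (v 0 _); exact: val_inj.
- by rewrite -(h 2%N) /=; congr (v 0 _); exact: val_inj.
Qed.

Lemma certificate v : zR R (denominator c) * ((toM R (q_ c)).@[v 0] * Fm.@[v 0]) =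
  qform (gramian c) [seq (toM R t).@[v 0] | t <- s_ c].
Proof.
move: good => /and5P[_ _ _ _ /and3P[_ _ /and5P[_ /(toM_peq R) e _ _ _]]].
have := congr1 (meval (v 0)) e.
by rewrite toM_pscale mevalZ toM_pmul mevalM meval_gram.
Qed.

Lemma certified_ge0 v : 0 <= Fm.@[v 0].
Proof.
have [->|v0] := eqVneq v 0.
  rewrite -(scale0r (0 : 'rV[R]_3)) /Fm /F_.
  by rewrite (meval_homogZ _ _ (zform_homog 6 (sextic c))) expr0n mul0r.
have q0 := multiplier_gt0 v0; have e := certificate v.
move: good => /and5P[_ pG /eqP sz d0 _].
have D0 : 0 < zR R (denominator c) by rewrite zR_gt0.
have sz5 : size [seq (toM R t).@[v 0] | t <- s_ c] = 5%N by rewrite !size_map.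
have [h _] := posdefP pG sz5.
by rewrite -(pmulr_rge0 _ q0) -(pmulr_rge0 _ D0) e h.
Qed.

(** At a zero of F the positive definite Gram form vanishes, hence so do all five quartics. Some C_i
    is nonzero at [v], and since its products with the linear forms of p_i lie in the span of the
    quartics, [v] is proportional to p_i. *)
Lemma certified_zero v : v != 0 -> Fm.@[v 0] = 0 ->
  exists2 p, p \in zeros c & exists a, v = a *: vecZ R p.
Proof.
move=> v0 Fv; have e := certificate v; rewrite Fv !mulr0 in e.
move: good => /and5P[_ pG /eqP sz _ /and3P[L0 W0 /and5P[/eqP szC _ hp _ /andP[sp cub]]]].
have sz5 : size [seq (toM R t).@[v 0] | t <- s_ c] = 5%N by rewrite !size_map.
have [_ /(_ (esym e)) s0] := posdefP pG sz5.
have spn p : in_span c p -> (toM R p).@[v 0] = 0.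
  move=> /(toM_peq R)/(congr1 (meval (v 0))); rewrite toM_pscale mevalZ toM_psum [X in _ = X]raddf_sum /= => h.
  have /eqP : zR R (leading c) * (toM R p).@[v 0] = 0.
    rewrite h big_map big_seq big1 // => -[j s] /zip_snd sS.
    rewrite toM_pscale mevalZ; move: sS => /(nthP [::]) [i iS <-].
    have := s0 i; rewrite (nth_map [::]) // => -> //; by rewrite mulr0.
  by rewrite mulf_eq0 zR_eq0 (negPf L0) => /eqP.
(* If all C_i vanished at [v], the interpolation formula would give x_k^3 = 0 at [v] for every k. *)
have [[p C] pC Cv] : exists2 pC, pC \in zip (zeros c) (C_ c) & (toM R pC.2).@[v 0] != 0.
  apply: contrapT => h.
  have C0 pC : pC \in zip (zeros c) (C_ c) -> (toM R pC.2).@[v 0] = 0.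
    by move=> hpC; apply/eqP; apply: contraT => h'; exfalso; apply: h; exists pC.
  have coord (k : nat) : (k < 3)%N -> dot (vecZ R (zunit k)) v = 0.
    move=> k3; have /allP/(_ k) := cub; rewrite mem_iota => /(_ k3).
    move=> /(toM_peq R)/(congr1 (meval (v 0))); set q3 := pscale (weight c) _.
    rewrite toM_psum [X in X = _]raddf_sum /= big_map.
    rewrite [X in X = _]big_seq big1 => [|pC /C0 h']; last by rewrite toM_pscale mevalZ h' mulr0.
    rewrite /q3 toM_pscale mevalZ !toM_pmul !mevalM meval_linform => /esym/eqP.
    by rewrite mulf_eq0 zR_eq0 (negPf W0) !mulf_eq0 !orbb => /eqP.
  move: v0 => /eqP; apply; apply/rowP => i; rewrite mxE.
  have := coord i (ltn_ord i); rewrite /dot sum3 !mxE.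
  case: i => [[|[|[|//]]] hi] /=; rewrite zR0 zR1 !(mul0r, mul1r, addr0, add0r) => <-;
    congr (v 0 _); exact: val_inj.
have cr k : (k < 3)%N -> dot (vecZ R (zcross p k)) v = 0.
  move=> k3; have /allP/(_ _ pC)/allP/(_ k) := sp; rewrite mem_iota => /(_ k3)/spn.
  by rewrite toM_pmul mevalM meval_linform => /eqP; rewrite mulf_eq0 (negPf Cv) orbF => /eqP.
have pz : p \in zeros c.
  by move: pC; elim: (zeros c) (C_ c) => [|? ? IH] [|? ?] //=;
  rewrite !in_cons xpair_eqE => /orP[/andP[-> _] //|/IH ->]; rewrite orbT.
have /allP/(_ _ pz)/and3P[pp _ _] := hp.
exists p => //.
(* The coefficient of the orthogonal projection on [p]; the three identities below are the
   coordinates of (p.p) v - (p.v) p, expanded by cross products. *)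
exists (dot (vecZ R p) v / dot (vecZ R p) (vecZ R p)).
have pp0 : 0 < dot (vecZ R p) (vecZ R p) by rewrite dot_vecZ zR_gt0.
apply: (scalerI (lt0r_neq0 pp0)); rewrite scalerA mulrC divfK ?gt_eqF //.
have := cr 0%N isT; have := cr 1%N isT; have := cr 2%N isT.
rewrite /dot !sum3; case: (p) => -[x y] z; rewrite !mxE /= !zRN zR0 => e2 e1 e0.
apply/rowP => i; rewrite !mxE.
have [-> | [-> | ->]] : i = 0 \/ i = 1 \/ i = 2%:R.
- by case: i => [[|[|[|//]]] hi]; [left|right; left|right; right]; exact: val_inj.
all: apply/eqP; rewrite -subr_eq0; apply/eqP; move: e0 e1 e2 => /=.
all: move: (zR R x) (zR R y) (zR R z) (v 0 0) (v 0 1) (v 0 2%:R) => {}x {}y {}z a b d e0 e1 e2.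
- by transitivity (y * (y * a + - x * b + 0 * d) - z * (- z * a + 0 * b + x * d)); [ring|rewrite e1 e2; ring].
- by transitivity (z * (0 * a + z * b + - y * d) - x * (y * a + - x * b + 0 * d)); [ring|rewrite e0 e2; ring].
- by transitivity (x * (- z * a + 0 * b + x * d) - y * (0 * a + z * b + - y * d)); [ring|rewrite e0 e1; ring].
Qed.

End Certified.
End GoodConfig.

(** * Sign patterns of lines on a finite set of points *)

Definition zneg (p : zvec) : zvec := let: (x, y, z) := p in (Z.opp x, Z.opp y, Z.opp z).

Definition zcr (p q : zvec) : zvec :=
  let: (x, y, z) := p in (zdot (zcross q 0) p, zdot (zcross q 1) p, zdot (zcross q 2) p).

Definition zdet (p q r : zvec) : Z := zdot (zcr p q) r.

Definition spattern (pts : seq zvec) (l : zvec) : seq bool := [seq Z.ltb Z0 (zdot l p) | p <- pts].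

Definition combination (pts : seq zvec) (lam : seq (nat * Z)) (k : nat) : Z :=
  foldr (fun t s => Z.add (Z.mul t.2 (zcoord (nth (zunit 0) pts t.1) k)) s) Z0 lam.

Definition dependency (pts : seq zvec) (lam : seq (nat * Z)) : bool :=
  all (fun t => t.1 < size pts)%N lam && all (fun k => Z.eqb (combination pts lam k) Z0) (iota 0 3).

(* Candidates given by Cramer's rule: four vectors, or three coplanar ones. *)
Definition dependencies (pts : seq zvec) : seq (seq (nat * Z)) :=
  let n := size pts in let p i := nth (zunit 0) pts i in
  let three := flatten [seq flatten [seq flatten [seq
     [seq [:: (i, zdet (p j) (p k) (zunit e)); (j, Z.opp (zdet (p i) (p k) (zunit e)));
              (k, zdet (p i) (p j) (zunit e))] | e <- iota 0 3]
     | k <- iota j.+1 (n - j.+1)] | j <- iota i.+1 (n - i.+1)] | i <- iota 0 n] in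
  let four := flatten [seq flatten [seq flatten [seq
     [seq [:: (i, zdet (p j) (p k) (p l)); (j, Z.opp (zdet (p i) (p k) (p l)));
              (k, zdet (p i) (p j) (p l)); (l, Z.opp (zdet (p i) (p j) (p k)))]
     | l <- iota k.+1 (n - k.+1)]
     | k <- iota j.+1 (n - j.+1)] | j <- iota i.+1 (n - i.+1)] | i <- iota 0 n] in
  [seq lam <- three ++ four | dependency pts lam].

(** Orthogonality of signs, as for oriented matroids: evaluating a line on a dependency gives a sum
    equal to 0, whose nonzero terms therefore cannot all have one sign. *)
Definition violates (s : seq bool) (lam : seq (nat * Z)) : bool :=
  let w := [seq if nth false s t.1 then t.2 else Z.opp t.2 | t <- lam] in
  ~~ all (fun z => Z.eqb z Z0) w && (all (Z.leb Z0) w || all (fun z => Z.leb z Z0) w).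

Fixpoint sign_vectors (n : nat) : seq (seq bool) :=
  if n is n'.+1 then [seq true :: s | s <- sign_vectors n'] ++ [seq false :: s | s <- sign_vectors n']
  else [:: [::]].

(** Every sign vector is tried. The first sign is fixed by the choice between a line and its
    opposite; [ok] records signs known in advance, and only the first [n] signs count for the
    pattern. *)
Definition complete (pts : seq zvec) (n : nat) (ok : pred (seq bool)) (pats : seq (seq bool)) : bool :=
  let deps := dependencies pts in
  all (fun s => [|| ~~ head false s, ~~ ok s, take n s \in pats | has (violates s) deps])
    (sign_vectors (size pts)).

Fixpoint distinct (pts : seq zvec) (seen : seq (seq bool)) (ls : seq zvec) : seq zvec :=
  if ls is l :: ls' then
    let s := spattern pts l in
    if s \in seen then distinct pts seen ls' else l :: distinct pts (s :: seen) ls'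
  else [::].

(** One list of lines serves all selections from a configuration, because every region of a
    subarrangement contains a region of the whole arrangement; repeated patterns are dropped. *)
Definition witnesses (pts : seq zvec) (ls : seq zvec) : seq zvec :=
  distinct pts [::] [seq if Z.ltb Z0 (zdot l (head (zunit 0) pts)) then l else zneg l | l <- ls].

Definition good_witnesses (pts : seq zvec) (L : seq zvec) : bool :=
  uniq (map (spattern pts) L) &&
  all (fun l => Z.ltb Z0 (zdot l (head (zunit 0) pts)) && all (fun p => ~~ Z.eqb (zdot l p) Z0) pts) L.

Section Patterns.
Variable R : realType.
Implicit Types (v u l : 'rV[R]_3).

Lemma mem_sign_vectors s : s \in sign_vectors (size s).
Proof.
elim: s => [|[] s IH] //=; rewrite mem_cat; apply/orP; [left|right]; exact: map_f.
Qed.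

Lemma pattern_vecZ pts (l : zvec) : pattern (map (vecZ R) pts) (vecZ R l) = spattern pts l.
Proof. by rewrite /pattern -map_comp; apply: eq_map => p /=; rewrite dot_vecZ zR_gt0. Qed.

Lemma combinationE pts lam l : dependency pts lam ->
  \sum_(t <- lam) zR R t.2 * dot l (vecZ R (nth (zunit 0) pts t.1)) = 0.
Proof.
move=> /andP[_ /and4P[/Z.eqb_eq c0 /Z.eqb_eq c1 /Z.eqb_eq c2 _]].
have cE k : zR R (combination pts lam k) =
    \sum_(t <- lam) zR R t.2 * zR R (zcoord (nth (zunit 0) pts t.1) k).
  rewrite /combination; elim: (lam) => [|t s IH] /=; first by rewrite big_nil zR0.
  by rewrite zRD zRM IH big_cons.
transitivity (l 0 0 * zR R (combination pts lam 0) + l 0 1 * zR R (combination pts lam 1)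
  + l 0 2%:R * zR R (combination pts lam 2)); last by rewrite c0 c1 c2 zR0 !mulr0 !addr0.
rewrite !cE !mulr_sumr -!big_split; apply: eq_bigr => t _.
by rewrite /dot sum3 !mxE /=; ring.
Qed.

Lemma violatesP pts lam l : dependency pts lam ->
  (forall p, p \in pts -> dot l (vecZ R p) != 0) ->
  ~~ violates (pattern (map (vecZ R) pts) l) lam.
Proof.
move=> dep lpts; apply/negP => /andP[nz sgn].
have := combinationE l dep; move: dep => /andP[/allP szs _].
set s := pattern _ l in nz sgn.
pose w (t : nat * Z) := if nth false s t.1 then t.2 else Z.opp t.2.
pose a (t : nat * Z) := `|dot l (vecZ R (nth (zunit 0) pts t.1))|.
(* Each term of the relation is an absolute value, which is positive, times the signed coefficient
   [w t]. *)
have wE t : t \in lam -> zR R t.2 * dot l (vecZ R (nth (zunit 0) pts t.1)) = zR R (w t) * a t.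
  move=> tlam; rewrite /w /a /s /pattern -map_comp (nth_map (zunit 0)) ?szs //=.
  case: ltrP => h; first by rewrite gtr0_norm.
  by rewrite ler0_norm // zRN mulrNN.
have a_gt0 t : t \in lam -> 0 < a t.
  by move=> tlam; rewrite /a normr_gt0 lpts // mem_nth // szs.
rewrite big_seq (eq_bigr _ wE) -big_seq.
move: nz; rewrite all_map => /allPn [t0 t0lam /= nz0].
have wt0 : zR R (w t0) != 0 by rewrite zR_eq0.
case/orP: sgn; rewrite all_map => /allP sgn sum0.
  have : all (fun t => zR R (w t) * a t == 0) lam.
    move: sum0 => /eqP; rewrite big_seq psumr_eq0 => [/allP h|t tl]; last first.
      by apply: mulr_ge0; [rewrite zR_ge0; exact: sgn|exact/ltW/a_gt0].
    by apply/allP => t tl; have := h t tl; rewrite tl.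
  by move=> /allP/(_ _ t0lam); rewrite mulf_eq0 (negPf wt0) gt_eqF // a_gt0.
have : all (fun t => - (zR R (w t) * a t) == 0) lam.
  move: sum0 => /eqP; rewrite -oppr_eq0 -sumrN big_seq psumr_eq0 => [/allP h|t tl]; last first.
    rewrite -mulNr; apply: mulr_ge0; last exact/ltW/a_gt0.
    rewrite -zRN zR_ge0.
    by have := sgn t tl; rewrite /= -/(w t); lia.
  by apply/allP => t tl; have := h t tl; rewrite tl.
by move=> /allP/(_ _ t0lam); rewrite oppr_eq0 mulf_eq0 (negPf wt0) gt_eqF // a_gt0.
Qed.

Lemma completeP pts n ok pats l : complete pts n ok pats -> (0 < size pts)%N ->
  0 < dot l (vecZ R (head (zunit 0) pts)) ->
  (forall p, p \in pts -> dot l (vecZ R p) != 0) ->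
  ok (pattern (map (vecZ R) pts) l) ->
  take n (pattern (map (vecZ R) pts) l) \in pats.
Proof.
move=> /allP h pts0 lp lpts okl.
set s := pattern _ l in okl *.
have /h : s \in sign_vectors (size pts).
  by have := mem_sign_vectors s; rewrite size_map size_map.
have -> : head false s = true by rewrite /s; case: (pts) pts0 lp => //= p ps _ ->.
rewrite okl /= => /orP[//|/hasP [lam]].
rewrite mem_filter => /andP[dep _] viol.
by have := violatesP dep lpts; rewrite -/s viol.
Qed.

(** The rank one term of [zhess] contributes (u.p)^2, which is 0 here. *)
Lemma posdef_hess (F : zpoly) (p : zvec) u : posdef 3 (zhess F p) -> u != 0 ->
  dot u (vecZ R p) = 0 -> 0 < hess (toM R F) (vecZ R p) u.
Proof.
move=> pH u0 up.
pose x := [:: u 0 0; u 0 1; u 0 2%:R].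
have [h1 h2] := posdefP pH (erefl : size x = 3%N).
have e : qform (zhess F p) x = hess (toM R F) (vecZ R p) u + dot u (vecZ R p) ^+ 2.
  have E (i j : 'I_3) (a b : nat) : i = a :> nat -> j = b :> nat ->
      (toM R F)^`M(i)^`M(j).@[vecZ R p 0] = zR R (zeval (pderiv b (pderiv a F)) p).
    by move=> <- <-; rewrite -!toM_pderiv meval_toM.
  have V (i : 'I_3) (a : nat) : i = a :> nat -> vecZ R p 0 i = zR R (zcoord p a).
    by move=> <-; rewrite mxE.
  rewrite /hess /dot !sum3 (E 0 0 0%N 0%N) // (E 0 1 0%N 1%N) // (E 0 2%:R 0%N 2%N) //.
  rewrite (E 1 0 1%N 0%N) // (E 1 1 1%N 1%N) // (E 1 2%:R 1%N 2%N) //.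
  rewrite (E 2%:R 0 2%N 0%N) // (E 2%:R 1 2%N 1%N) // (E 2%:R 2%:R 2%N 2%N) //.
  rewrite (V 0 0%N) // (V 1 1%N) // (V 2%:R 2%N) //.
  rewrite /qform /lin /zhess /= !big_cons !big_nil /= !zRD !zRM; ring.
move: e; rewrite up expr0n addr0 => <-.
rewrite lt_neqAle h1 andbT eq_sym; apply: contra u0 => /eqP /h2 h.
apply/eqP/rowP => i; rewrite mxE.
have [-> | -> | ->] := ord3P i.
- exact: (h 0%N).
- exact: (h 1%N).
- exact: (h 2%N).
Qed.

End Patterns.

(** * Keeping only some of the zeros *)

Section Selection.
Variable R : realType.
Variables (c : config) (S : seq nat).
Hypothesis good : good_config c.
Hypothesis S_lt : all (fun i => i < size (zeros c))%N S.

Let Fm := toM R (F_ c).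
Let others := [seq j <- iota 0 (size (zeros c)) | j \notin S].
(** The cubic of index j is nonzero at the zero of index j and vanishes at all others, so its square
    removes exactly that zero. *)
Let FS := Fm + \sum_(j <- others) toM R (nth [::] (C_ c) j) ^+ 2.
Let selected := [seq nth (zunit 0) (zeros c) i | i <- S].

Lemma certified_hess p u : p \in zeros c -> u != 0 -> dot u (vecZ R p) = 0 ->
  0 < hess Fm (vecZ R p) u.
Proof.
move=> pz.
move: good => /and5P[_ _ _ _ /and3P[_ _ /and5P[_ _ /allP/(_ _ pz)/and3P[_ _ pH] _ _]]].
exact: posdef_hess.
Qed.

Lemma cubic_value i j : (i < size (zeros c))%N -> (j < size (zeros c))%N ->
  (toM R (nth [::] (C_ c) i)).@[vecZ R (nth (zunit 0) (zeros c) j) 0] =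
    if i == j then zR R (weight c) else 0.
Proof.
move=> hi hj.
move: good => /and5P[_ _ _ _ /and3P[_ _ /and5P[_ _ _ /allP h _]]].
have /h /allP h1 : i \in iota 0 (size (zeros c)) by rewrite mem_iota.
have /h1 /Z.eqb_eq h' : j \in iota 0 (size (zeros c)) by rewrite mem_iota.
by rewrite meval_toM h'; case: eqP => // _; exact: zR0.
Qed.

Lemma selection_ge0 (v : 'rV[R]_3) : 0 <= FS.@[v 0].
Proof.
rewrite /FS mevalD addr_ge0 //; first exact: certified_ge0.
rewrite raddf_sum /= sumr_ge0 // => j _; rewrite rmorphXn /= sqr_ge0 //.
Qed.

Lemma selection_homog : FS \is 6.-homog.
Proof.
rewrite rpredD //; first exact: zform_homog.
apply: rpred_sum => j _; apply: (@dhomogMn _ _ _ 3 _ 2).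
have [jC|jC] := ltnP j (size (C_ c)); last by rewrite nth_default // toM_nil rpred0.
by rewrite /C_ (nth_map [::]) ?zform_homog //; move: jC; rewrite size_map.
Qed.

Lemma selection_sextic (ls : seq zvec) (m : nat) : (0 < size S)%N -> (0 < m)%N ->
  size (witnesses selected ls) = m ->
  good_witnesses selected (witnesses selected ls) ->
  complete selected (size selected) predT (map (spattern selected) (witnesses selected ls)) ->
  exists f : {mpoly R[3]},
    [/\ smooth_real_sextic f,
        connected_components (avoidance_locus f) #= `I_m &
        forall K, connected_components (avoidance_locus f) K -> convex_as_cone K].
Proof.
move=> S0 m0; set L := witnesses _ _ => sz /andP[uL /allP goodL] compl.
move: m0; rewrite -{}sz => m0.
have sel0 : (0 < size selected)%N by rewrite size_map.
have sel_zero p : p \in selected -> p \in zeros c.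
  by move=> /mapP [i iS ->]; rewrite mem_nth //; move/allP: S_lt; apply.
have headE : map (vecZ R) selected = vecZ R (head (zunit 0) selected) :: behead (map (vecZ R) selected).
  by case: (selected) sel0.
rewrite -(size_map (vecZ R) L).
apply: (@sextic_of_zeros R FS (vecZ R (head (zunit 0) selected)) (map (vecZ R) selected)).
- exact: selection_homog.
- by rewrite headE mem_head.
- exact: selection_ge0.
- move=> _ /mapP [p psel ->]; have pz := sel_zero _ psel.
  move: (good) => /and5P[_ _ _ _ /and3P[_ _ /and5P[_ _ /allP/(_ _ pz)/and3P[pp /Z.eqb_eq Fp _] _ _]]].
  have othersC j : j \in others -> (toM R (nth [::] (C_ c) j)).@[vecZ R p 0] = 0.
    rewrite mem_filter mem_iota => /andP[jS jn]; move: psel => /mapP [i iS ->].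
    rewrite cubic_value //; last by move/allP: S_lt; apply.
    by case: eqP => // ji; move: jS; rewrite ji iS.
  split.
  + apply/eqP => p0; move: pp; rewrite -(zR_gt0 R) -dot_vecZ p0 dot0l ltxx //.
  + rewrite /FS mevalD meval_toM Fp zR0 add0r raddf_sum big_seq big1 //= => j /othersC e.
    by rewrite rmorphXn /= e expr0n.
  (* At a kept zero each added square has a nonnegative Hessian, so nondegeneracy persists. *)
  + move=> u u0 up; rewrite /FS hessD ltr_wpDr ?certified_hess //.
    rewrite big_seq; elim/big_ind: _ => [|a b ha hb|j /othersC]; last exact: hess_sqr.
      by rewrite hess0.
    by rewrite hessD addr_ge0.
- move=> v v0; rewrite /FS mevalD => /eqP; rewrite paddr_eq0; last 2 first.
  + exact: certified_ge0.
  + by rewrite raddf_sum /= sumr_ge0 // => j _; rewrite rmorphXn /= sqr_ge0.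
  move=> /andP[/eqP Fv /eqP Cv]; have [p pz [a va]] := certified_zero good v0 Fv.
  exists (vecZ R p); last by exists a.
  apply: map_f; apply/mapP; exists (index p (zeros c)); last by rewrite nth_index.
  (* An unselected zero would make its own cubic vanish there, although the value is the nonzero
     weight times the cube of the nonzero factor [a]. *)
  apply: contraT => pS; exfalso.
  have po : index p (zeros c) \in others by rewrite mem_filter pS mem_iota /= add0n index_mem.
  move: Cv => /eqP; rewrite raddf_sum psumr_eq0 => [/allP/(_ _ po)|j _]; last by rewrite /= rmorphXn /= sqr_ge0.
  have C3 : toM R (nth [::] (C_ c) (index p (zeros c))) \is 3.-homog.
    have [jC|jC] := ltnP (index p (zeros c)) (size (C_ c)); last by rewrite nth_default // toM_nil rpred0.
    by rewrite /C_ (nth_map [::]) ?zform_homog //; move: jC; rewrite size_map.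
  rewrite /= rmorphXn /= sqrf_eq0 va (meval_homogZ _ _ C3) -[in vecZ R p](nth_index (zunit 0) pz).
  rewrite cubic_value ?index_mem // eqxx mulf_eq0 expf_eq0 /= zR_eq0.
  move: (good) => /and5P[_ _ _ _ /and3P[_ W0 _]]; rewrite (negPf W0) orbF => /eqP a0.
  by move: v0; rewrite va a0 scale0r eqxx.
- by rewrite size_map.
- move=> _ /mapP [l lL ->]; have /andP[lp /allP hl] := goodL _ lL.
  split; first by rewrite dot_vecZ zR_gt0.
  by move=> _ /mapP [p psel ->]; rewrite dot_vecZ zR_eq0 hl.
- by rewrite -map_comp (eq_map (pattern_vecZ R selected)).
move=> l lp lsel; rewrite -map_comp (eq_map (pattern_vecZ R selected)).
have := completeP compl sel0 lp _ isT; rewrite take_oversize ?size_map //; apply.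
by move=> p psel; apply: lsel; exact: map_f.
Qed.

End Selection.

(** * Nine configurations of zeros *)

Local Open Scope Z_scope.

(** The ten zeros of the configuration numbered i contain i collinear triples, so they give 46 - i
    regions. *)
Definition config0 : config := Config
    [:: (0, 0, 1); (1, 0, 0); (0, 1, 0); (1, 1, 1); (2, 1, -1); (2, 3, 1); (1, 2, 3); (1, -2, -1); (1, -1, 2);
    (3, 1, 2)]
    [:: 0; 0; 169; -274; 169; 0; 0; 0; -169; -677; 823; -169; 0; 169; 823; -123; -677; 169; -274; -677; 823;
    -274; 169; -169; 169; 0; 0; 0]
  [:: [:: 2; 0; 0]; [:: 0; 2; -1]; [:: 0; -1; 2]] 670761
    [:: [:: 0; 560; 285; -389; 0; -1083; -1293; 1293; -192; 819; 0; 0; 0; 0; 0]; [:: 0; 49; 939; -796; 0;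
    -456; -372; -447; 264; 0; 819; 0; 0; 0; 0]; [:: 0; 581; -165; -680; 0; -192; -717; 717; -363; 0; 0; 819;
    0; 0; 0]; [:: 0; -84; 2421; -1185; 0; -2043; -342; 342; 72; 0; 0; 0; 819; 0; 0]; [:: 0; 630; 81; -279; 0;
    -648; -1593; 1593; -603; 0; 0; 0; 0; 819; 0]]
  [:: 9%N; 10%N; 11%N; 12%N; 13%N] 819
    [:: [:: 868; -152; -201; -274; -74]; [:: -152; 2000; -857; -603; 462]; [:: -201; -857; 628; 361; -274];
    [:: -274; -603; 361; 338; -169]; [:: -74; 462; -274; -169; 338]]
    [:: [:: 104; -104; -64; 0; -104; 168; -88; -64; 152; 0]; [:: 0; -88; 152; 0; -64; 168; -64; -104; -104;
    104]; [:: 0; -64; -104; 104; 152; 168; -104; -88; -64; 0]; [:: 0; -152; 88; 0; 88; 296; -152; -152; 88;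
    0]; [:: 0; 1; -5; 0; 9; -4; -2; -9; 10; 0]; [:: 0; 5; -1; 0; -7; -12; 10; 7; -2; 0]; [:: 0; 10; -2; 0; -1;
    -12; 7; 5; -7; 0]; [:: 0; 2; -10; 0; 5; 4; 9; -1; -9; 0]; [:: 0; -9; 9; 0; 10; -4; 1; -2; -5; 0]; [:: 0;
    7; -7; 0; -2; -12; 5; 10; -1; 0]] 104
    [:: (-6, 1, 1); (-6, 1, 4); (-6, 4, 1); (-4, -1, -1); (-4, -1, 1); (-4, -1, 6); (-4, 1, 4); (-4, 4, -1);
    (-4, 6, -1); (-3, 1, 1); (-2, -2, 1); (-2, -1, 1); (-2, -1, 2); (-2, 1, -2); (-2, 1, 2); (-2, 2, -1); (-2,
    2, 1); (-1, -4, -1); (-1, -4, 4); (-1, -4, 6); (-1, -2, 2); (-1, -1, -4); (-1, -1, -1); (-1, -1, 3); (-1,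
    -1, 6); (-1, 1, -4); (-1, 1, -2); (-1, 1, 2); (-1, 2, -2); (-1, 2, 1); (-1, 3, -1); (-1, 4, 1); (-1, 6,
    -4); (-1, 6, -1); (1, -8, -5); (1, -5, 12); (1, 12, -8); (5, -12, -1); (5, -1, 8); (5, 8, -12); (8, -12,
    5); (8, -1, -12); (8, 5, -1); (12, -8, 1); (12, -5, -8); (12, 1, -5)].

Definition config1 : config := Config
    [:: (1, 1, -1); (1, 1, 1); (1, -5, -4); (5, -1, 20); (0, 0, 1); (1, -1, -8); (1, 0, 0); (4, 1, -2); (1, 4,
    -2); (0, 1, 0)]
    [:: 0; 0; 357; -452; 676; 0; 0; 0; 374; 1092; -1588; 3832; 0; 101; -188; 160; -4472; 5456; -452; -1588;
    -3192; -10336; 676; 3832; 5712; 0; 0; 0]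
  [:: [:: 4; 0; 1]; [:: 0; 2; 0]; [:: 1; 0; 2]] 1192464
    [:: [:: 0; -4788; -3928; 7904; 0; -2444; -19760; -672; 21504; 2184; 0; 0; 0; 0; 0]; [:: 0; 1386; 979;
    -2834; 0; 650; 7085; -1386; -8064; 0; 2184; 0; 0; 0; 0]; [:: 0; -588; -190; 260; 0; -260; -2834; 588; 840;
    0; 0; 2184; 0; 0; 0]; [:: 0; 6216; 10141; -16406; 0; 2756; 35555; 5250; -45696; 0; 0; 0; 2184; 0; 0]; [::
    0; -3150; -4279; 6890; 0; -1430; -17225; -2310; 19320; 0; 0; 0; 0; 2184; 0]]
  [:: 9%N; 10%N; 11%N; 12%N; 13%N] 2184
    [:: [:: 196; 155; 768; -57; -380]; [:: 155; 988; 84; 544; 1380]; [:: 768; 84; 9080; -1548; -5168]; [::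
    -57; 544; -1548; 676; 1916]; [:: -380; 1380; -5168; 1916; 5712]]
    [:: [:: 0; -136080; 30240; 0; -75600; -272160; 30240; 151200; 272160; 0]; [:: 0; 11760; 16800; 0; 5040;
    70560; 50400; 3360; 23520; 0]; [:: 0; -1215; -3510; 0; -945; 0; -7560; 3510; 9720; 0]; [:: 0; 49; -182; 0;
    63; 0; -504; 182; 392; 0]; [:: 181440; -1088640; 4717440; 0; 0; -181440; 12882240; -4717440; -11793600;
    0]; [:: 0; -1134; 6804; 0; 1134; 0; 18144; -6804; -18144; 0]; [:: 0; -226800; 272160; 0; -136080; -453600;
    725760; 181440; -544320; 181440]; [:: 0; 5296; -4736; 0; 3024; 10080; -12096; -5344; 3776; 0]; [:: 0;
    8400; 3360; 0; 5040; 10080; 20160; -13440; -33600; 0]; [:: 0; -571536; -689472; 181440; -371952; -453600;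
    -2286144; 1143072; 3048192; 0]] 181440
    [:: (-6, 3, -1); (-6, 3, 2); (-5, -4, 1); (-5, -1, -5); (-5, -1, 1); (-5, 1, -3); (-5, 5, -1); (-4, 1, 1);
    (-4, 2, 1); (-4, 4, 1); (-4, 6, -1); (-4, 6, 1); (-3, 1, -1); (-3, 1, 1); (-2, -2, 1); (-2, -1, -4); (-2,
    -1, 1); (-2, 1, -2); (-2, 1, 2); (-2, 4, -1); (-1, -5, -5); (-1, -2, -4); (-1, -1, -3); (-1, -1, -1); (-1,
    -1, 3); (-1, 1, -2); (-1, 1, -1); (-1, 1, 1); (-1, 2, -2); (-1, 3, -1); (-1, 3, 1); (1, -7, -1); (1, 10,
    -12); (1, 10, -1); (1, 26, 1); (2, -11, -1); (2, -7, 1); (3, 3, 7); (8, -1, 1); (8, 17, -1); (9, -1, 2);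
    (10, 1, 1); (11, 2, 1); (14, 1, 2); (21, -1, 8)].

Definition config2 : config := Config
    [:: (5, 2, -2); (3, 6, 2); (0, 1, 0); (1, 1, 2); (7, -6, 2); (2, 3, 4); (0, 0, 1); (1, 0, 0); (5, 6, 4);
    (1, 1, 1)]
    [:: 0; 0; 3091; -6148; 5861; 0; 0; 0; -4870; 4762; -8728; -5780; 0; 1948; 1924; 13408; 9744; 1428; -1552;
    -11144; -9624; -1952; 2800; 3632; 1200; 0; 0; 0]
  [:: [:: 2; -1; 0]; [:: -1; 2; -1]; [:: 0; -1; 2]] 3872
    [:: [:: 0; 572; -860; 328; 0; -424; 168; 184; -144; 176; 0; 0; 0; 0; 0]; [:: 0; -858; 1734; -708; 0; 648;
    -940; -380; 328; 0; 176; 0; 0; 0; 0]; [:: 0; 1188; -2400; 1252; 0; -864; 1224; 8; -584; 0; 0; 176; 0; 0;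
    0]; [:: 0; -638; 1802; -1080; 0; 412; -844; -388; 560; 0; 0; 0; 176; 0; 0]; [:: 0; -495; 367; 532; 0; 540;
    -578; -214; -328; 0; 0; 0; 0; 176; 0]]
  [:: 9%N; 10%N; 11%N; 12%N; 13%N] 176
    [:: [:: 1025; 472; -237; -194; -56]; [:: 472; 4357; 1534; -1687; -1088]; [:: -237; 1534; 723; -569; -394];
    [:: -194; -1687; -569; 700; 454]; [:: -56; -1088; -394; 454; 300]]
    [:: [:: 0; 99; 369; 0; 18; -1116; -162; 396; 396; 0]; [:: 0; -2295; 1755; 0; 1710; 1260; -630; -1260;
    -540; 0]; [:: 0; 196560; -99360; 17280; -140400; -246240; 17280; 177120; 77760; 0]; [:: 0; 11520; -53280;
    0; -1440; 72000; 25920; -31680; -23040; 0]; [:: 0; 90; -10; 0; -60; -200; 20; 120; 40; 0]; [:: 0; 720;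
    1920; 0; -720; -3360; -960; 1440; 960; 0]; [:: 17280; -34560; 120960; 0; -11520; -195840; -57600; 92160;
    69120; 0]; [:: 0; -62640; -41040; 0; 34560; 254880; 12960; -129600; -86400; 17280]; [:: 0; 2448; -2992; 0;
    -1824; 928; 1376; 192; -128; 0]; [:: 0; -241920; 362880; 0; 172800; -241920; -172800; 69120; 69120; 0]]
    17280
    [:: (-6, 3, 1); (-5, 2, 2); (-5, 5, -1); (-4, -3, 4); (-4, 1, 1); (-4, 1, 2); (-3, -1, 5); (-3, -1, 6);
    (-3, 4, -2); (-3, 6, -1); (-2, -3, 3); (-2, -2, 3); (-2, -1, 1); (-2, -1, 2); (-2, 1, -2); (-1, -2, -2);
    (-1, -2, 1); (-1, -2, 4); (-1, -1, -4); (-1, -1, -1); (-1, -1, 3); (-1, -1, 5); (-1, 1, -2); (-1, 1, -1);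
    (-1, 1, 1); (-1, 2, -2); (-1, 3, -3); (-1, 4, -2); (-1, 4, -1); (-1, 4, 1); (1, -7, 5); (1, -1, -7); (1,
    4, 7); (4, -7, 2); (4, 1, -10); (7, -1, -7); (8, -7, 1); (8, -3, -2); (9, -2, -8); (9, -1, -10); (10, -5,
    -1); (11, -8, -2); (15, -12, -1); (19, -33, 15)].

Definition config3 : config := Config
    [:: (1, -1, -1); (1, 1, 5); (7, 1, -7); (0, 0, 1); (5, -1, 1); (1, 0, 0); (4, -8, -1); (2, 1, -8); (0, 1,
    0); (1, 1, 1)]
    [:: 0; 0; 169; -367; 639; 0; 0; 0; -248; 244; -42; 46; 0; 92; -187; -176; -655; 44; 154; 102; -368; 112;
    75; 197; 169; 0; 0; 0]
  [:: [:: 2; 0; 0]; [:: 0; 2; 0]; [:: 0; 0; 2]] 149058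
    [:: [:: 0; -607; 106; 228; 0; 462; 531; -1193; 200; 273; 0; 0; 0; 0; 0]; [:: 0; 149; 211; -633; 0; -126;
    -393; 739; -220; 0; 273; 0; 0; 0; 0]; [:: 0; -82; -314; 123; 0; 84; 405; -731; 242; 0; 0; 273; 0; 0; 0];
    [:: 0; 223; -2755; 2532; 0; -42; 1845; -2956; 880; 0; 0; 0; 273; 0; 0]; [:: 0; 328; 2075; -2403; 0; -336;
    -2166; 3197; -968; 0; 0; 0; 0; 273; 0]]
  [:: 9%N; 10%N; 11%N; 12%N; 13%N] 273
    [:: [:: 528; 116; -59; 308; 379]; [:: 116; 2434; -260; -175; -733]; [:: -59; -260; 972; -3; 224]; [:: 308;
    -175; -3; 300; 394]; [:: 379; -733; 224; 394; 676]]
    [:: [:: 0; -9450; -14175; 0; 7560; 22680; -7560; 2835; -1890; 0]; [:: 0; 2730; 1680; 0; -1260; 2520;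
    -1260; -1680; -2730; 0]; [:: 0; -30; 345; 0; 0; 0; 0; -165; -150; 0]; [:: 45360; -453600; -782460; 0;
    374220; -623700; 249480; 476280; 714420; 0]; [:: 0; -860; 1700; 0; 600; -480; -120; 340; -1180; 0]; [:: 0;
    136080; -317520; 0; -90720; 45360; 0; 0; 181440; 45360]; [:: 0; 112; -28; 0; -84; -84; 168; -56; -28; 0];
    [:: 0; -216; -1296; 0; 432; -648; 216; 648; 864; 0]; [:: 0; 61560; -38880; 45360; -45360; -22680; 68040;
    -35640; -32400; 0]; [:: 0; -17010; 11340; 0; 11340; 0; 11340; 11340; 17010; 0]] 45360
    [:: (-6, -3, -2); (-5, 1, -1); (-4, -2, -1); (-4, -2, 1); (-4, -1, -5); (-4, -1, -1); (-3, -3, -1); (-3,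
    -3, 1); (-3, -1, -3); (-3, -1, -1); (-3, 1, 1); (-2, -4, 1); (-2, -1, 1); (-2, -1, 4); (-2, 1, -1); (-2,
    4, -1); (-1, -5, 1); (-1, -4, 2); (-1, -3, 1); (-1, -3, 3); (-1, -2, -2); (-1, -2, 4); (-1, -1, -1); (-1,
    -1, 1); (-1, -1, 3); (-1, -1, 5); (-1, 1, -3); (-1, 1, -1); (-1, 1, 1); (-1, 3, -1); (1, -57, -7); (1,
    -15, -1); (1, -11, -1); (1, -7, 1); (1, -1, -7); (1, -1, 13); (1, 7, 1); (1, 8, 2); (1, 9, 3); (3, -9, 1);
    (7, -1, -1); (11, -13, 1); (15, -21, 1)].

Definition config4 : config := Config
    [:: (2, 1, 2); (1, 0, 2); (0, 1, 0); (1, 0, 0); (3, 1, 4); (1, -1, 0); (4, 1, 3); (2, -1, 3); (1, 1, 1);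
    (0, 0, 1)]
    [:: 0; 0; 16369; -17630; 10801; 0; 0; 0; -176; -64236; 64202; -22842; 0; 88; 84; 88134; -72414; 12393;
    -352; 1508; -51516; 24786; 352; -1944; 12393; 0; 0; 0]
  [:: [:: 2; 0; -1]; [:: 0; 6; -1]; [:: -1; -1; 2]] 32400
    [:: [:: 0; 2196; -5004; -1296; 0; -90; -3114; 7128; 0; 180; 0; 0; 0; 0; 0]; [:: 0; 324; -396; -144; 0; 0;
    -576; 612; 0; 0; 180; 0; 0; 0; 0]; [:: 0; 104; -76; -244; 0; 0; -136; -8; 180; 0; 0; 180; 0; 0; 0]; [:: 0;
    4176; -8964; -2556; 0; -45; -5859; 13068; 0; 0; 0; 0; 180; 0; 0]; [:: 0; 792; -1188; -252; 0; 0; -1188;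
    1836; -180; 0; 0; 0; 0; 180; 0]]
  [:: 9%N; 10%N; 11%N; 12%N; 13%N] 180
    [:: [:: 1232; -1942; 5274; -704; 432]; [:: -1942; 162322; -45306; 3020; -56601]; [:: 5274; -45306; 99144;
    -7308; 24786]; [:: -704; 3020; -7308; 704; -1944]; [:: 432; -56601; 24786; -1944; 24786]]
    [:: [:: 0; -363; 165; 0; 12; 696; -243; -24; -243; 0]; [:: 0; 69; -267; 0; 66; -276; 243; -78; 243; 0];
    [:: 0; -339; 105; 108; -12; 708; -243; 24; -351; 0]; [:: 0; -201; 327; 0; 66; 480; -351; -186; -243; 108];
    [:: 0; 30; 6; 0; -3; -39; 0; 6; 0; 0]; [:: 0; -24; -48; 0; -3; 69; 54; 6; -54; 0]; [:: 0; 29; -23; 0; -2;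
    -62; 27; 4; 27; 0]; [:: 0; -25; 31; 0; -2; 46; -27; 4; -27; 0]; [:: 0; 594; -270; 0; 0; -1188; 486; 0;
    486; 0]; [:: 108; -270; 486; 0; -324; 756; -486; 216; -486; 0]] 108
    [:: (-6, 3, 4); (-5, -6, 1); (-5, 1, 3); (-4, -3, 6); (-3, -4, 1); (-3, -2, 1); (-3, -2, 2); (-3, 1, 1);
    (-3, 3, 1); (-3, 3, 2); (-3, 6, 1); (-2, -3, 3); (-2, -1, -2); (-2, -1, 2); (-2, -1, 4); (-2, 1, 2); (-1,
    -6, -1); (-1, -3, 3); (-1, -2, -2); (-1, -2, 1); (-1, -2, 4); (-1, 1, -1); (-1, 1, 2); (-1, 2, 1); (-1, 3,
    -1); (-1, 5, -1); (1, -14, 3); (1, -8, 1); (1, 7, -4); (3, -14, 1); (3, -10, -1); (4, -7, -1); (6, 1, -8);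
    (6, 5, -10); (6, 7, -10); (7, -4, -4); (7, 1, -4); (7, 6, -3); (8, -1, -6); (10, -3, -8); (14, -3, -10);
    (14, -1, -10)].

Definition config5 : config := Config
    [:: (1, 0, 0); (0, 0, 1); (8, 2, 3); (1, -2, 0); (3, -1, -5); (1, 1, 1); (5, 0, 1); (6, 1, 2); (5, 3, 1);
    (0, 1, 0)]
    [:: 0; 0; 156; -264; 129; 0; 0; 0; 110; -265; 112; -14; 0; 25; -142; 222; -52; 1; -10; 34; -49; 4; 1; -2;
    4; 0; 0; 0]
  [:: [:: 2; 0; -2]; [:: 0; 6; 0]; [:: -2; 0; 4]] 112
    [:: [:: 0; -56; 44; 16; 0; -20; 40; -28; 0; 4; 0; 0; 0; 0; 0]; [:: 0; -16; 40; -16; 0; 0; -12; 0; 0; 0; 4;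
    0; 0; 0; 0]; [:: 0; -12; 54; -30; 0; 0; 0; -18; 2; 0; 0; 4; 0; 0; 0]; [:: 0; -176; 32; 160; 0; -100; 256;
    -176; 0; 0; 0; 0; 4; 0; 0]; [:: 0; -62; 203; -113; 0; 0; -48; 17; -1; 0; 0; 0; 0; 4; 0]]
  [:: 9%N; 10%N; 11%N; 12%N; 13%N] 4
    [:: [:: 518; -1062; 129; -84; 106]; [:: -1062; 3104; -440; 160; -376]; [:: 129; -440; 182; -23; 28]; [::
    -84; 160; -23; 14; -14]; [:: 106; -376; 28; -14; 56]]
    [:: [:: 0; 55440; -47880; 0; 12600; -19320; 2520; -10920; 5880; 1680]; [:: 1680; -6216; 3192; 0; 504;
    1512; -168; -168; -336; 0]; [:: 0; -360; 120; 0; -200; 520; -40; 40; -80; 0]; [:: 0; 1008; -1176; 0; 280;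
    -392; 392; -56; -56; 0]; [:: 0; -34; 23; 0; 10; 6; -1; -2; -2; 0]; [:: 0; 1890; 945; 0; 1050; -2310; 105;
    -210; 210; 0]; [:: 0; -1344; 1008; 0; -504; 1008; -112; 168; -224; 0]; [:: 0; 1400; -700; 0; 700; -1680;
    140; -140; 280; 0]; [:: 0; -60; 90; 0; 0; -60; 10; 0; 20; 0]; [:: 0; 9240; -13020; 1680; 2100; -1680;
    2940; -420; -840; 0]] 1680
    [:: (-3, -3, -1); (-3, -1, -3); (-3, -1, -1); (-3, -1, 1); (-3, -1, 5); (-3, 1, 1); (-3, 5, -1); (-2, 1,
    -1); (-2, 1, 5); (-2, 1, 6); (-1, -4, 6); (-1, -1, -1); (-1, -1, 1); (-1, -1, 3); (-1, -1, 4); (-1, 1,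
    -1); (-1, 1, 1); (-1, 1, 3); (-1, 1, 6); (-1, 2, 1); (-1, 3, -3); (-1, 3, -1); (-1, 3, 1); (-1, 4, -2);
    (-1, 6, -1); (1, -15, 4); (1, -9, 1); (1, -9, 3); (1, 1, -9); (1, 7, -7); (1, 7, -6); (1, 9, -9); (1, 9,
    -1); (1, 34, -6); (3, 1, -19); (3, 1, -16); (3, 1, -10); (3, 1, -9); (4, 3, -13); (4, 13, -19); (4, 16,
    -21)].

Definition config6 : config := Config
    [:: (4, 2, 1); (1, 2, -2); (0, 1, 0); (2, 1, -2); (0, 0, 1); (4, -2, 1); (1, 0, 0); (0, 2, -1); (1, 1, 1);
    (2, 2, -3)]
    [:: 0; 0; 112; 112; 28; 0; 0; 0; -224; -184; -112; -38; 0; 148; -40; 33; 209; 118; 148; -112; -259; -47;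
    64; 34; 10; 0; 0; 0]
  [:: [:: 2; 0; 0]; [:: 0; 2; 0]; [:: 0; 0; 2]] 144
    [:: [:: 0; -16; -44; -18; 0; 36; 46; -10; -6; 12; 0; 0; 0; 0; 0]; [:: 0; 8; 40; 18; 0; -24; -44; -4; -6;
    0; 12; 0; 0; 0; 0]; [:: 0; 8; -80; -42; 0; 48; 112; -40; -18; 0; 0; 12; 0; 0; 0]; [:: 0; 36; -24; -21; 0;
    0; 48; -42; -9; 0; 0; 0; 12; 0; 0]; [:: 0; 12; 96; 45; 0; -24; -84; -18; -39; 0; 0; 0; 0; 12; 0]]
  [:: 9%N; 10%N; 11%N; 12%N; 13%N] 12
    [:: [:: 448; 166; -206; 148; 20]; [:: 166; 724; 190; -132; -96]; [:: -206; 190; 220; -163; -47]; [:: 148;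
    -132; -163; 128; 34]; [:: 20; -96; -47; 34; 20]]
    [:: [:: 0; -14; -7; 0; 8; -6; 1; 10; 8; 0]; [:: 0; 80; 40; 0; -200; 60; 200; -160; -20; 0]; [:: 0; 240;
    840; 360; -600; -900; 60; -120; 120; 0]; [:: 0; -48; -24; 0; -24; 108; 132; -120; -24; 0]; [:: 360; 0;
    -90; 0; 360; -720; -450; 360; 180; 0]; [:: 0; -10; -5; 0; 10; 0; 5; 5; -5; 0]; [:: 0; 1680; 840; 0; -1320;
    -180; -840; -480; -60; 360]; [:: 0; -120; -150; 0; 210; 90; -120; 105; -15; 0]; [:: 0; 160; 80; 0; -16;
    216; 64; -80; -64; 0]; [:: 0; 0; 0; 0; 72; -72; -108; 90; 18; 0]] 360
    [:: (-5, -1, -3); (-5, 1, -1); (-5, 1, 3); (-3, -1, -3); (-3, 1, -1); (-3, 1, 1); (-3, 1, 3); (-3, 3, 1);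
    (-3, 5, 1); (-2, -1, -3); (-2, -1, 4); (-2, 1, -1); (-2, 4, -1); (-1, -5, -5); (-1, -3, -3); (-1, -3, -1);
    (-1, -2, -3); (-1, -2, 1); (-1, -1, -1); (-1, -1, 1); (-1, -1, 3); (-1, 1, -1); (-1, 1, 1); (-1, 1, 3);
    (-1, 2, 1); (-1, 2, 2); (-1, 3, -1); (-1, 3, 1); (-1, 5, -5); (-1, 5, 1); (1, -1, -7); (1, 1, -7); (1, 6,
    7); (1, 7, 5); (4, 13, 11); (5, -7, 1); (5, 5, 7); (7, -5, -1); (7, 1, 5); (7, 5, 9)].

Definition config7 : config := Config
    [:: (0, 1, 0); (1, 0, 0); (1, 1, 1); (3, 1, -3); (3, -2, 0); (0, 3, -1); (1, 0, -1); (2, -1, -1); (0, 0,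
    1); (3, -3, 1)]
  [:: 0; 0; 27; 18; 3; 0; 0; 0; -6; -14; -22; -6; 0; 12; -14; -54; 2; 18; 24; -16; -8; 24; 12; -8; 8; 0; 0; 0]
  [:: [:: 2; 0; 0]; [:: 0; 2; 0]; [:: 0; 0; 2]] 216
    [:: [:: 0; 0; -18; -6; 0; 12; 4; -4; 0; 12; 0; 0; 0; 0; 0]; [:: 0; -18; -6; 0; 0; 0; 0; 12; 0; 0; 12; 0;
    0; 0; 0]; [:: 0; -18; -6; 0; 0; 0; -18; 12; 18; 0; 0; 12; 0; 0; 0]; [:: 0; 0; 18; 6; 0; -12; -10; -14; 0;
    0; 0; 0; 12; 0; 0]; [:: 0; 45; -12; -9; 0; 0; 27; -36; -27; 0; 0; 0; 0; 12; 0]]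
  [:: 9%N; 10%N; 11%N; 12%N; 13%N] 12
    [:: [:: 72; -18; -47; 36; -30]; [:: -18; 80; 4; 6; 20]; [:: -47; 4; 78; -32; 36]; [:: 36; 6; -32; 36;
    -12]; [:: -30; 20; 36; -12; 24]]
    [:: [:: 0; 0; 288; 96; -192; -64; 64; -192; 0; 0]; [:: 0; -216; -72; 0; 0; -48; 0; 96; 144; 96]; [:: 0;
    18; 6; 0; 12; 28; 12; 12; 8; 0]; [:: 0; 3; 1; 0; -6; -2; 6; -6; 4; 0]; [:: 0; 24; 8; 0; 0; 0; -16; 0; -16;
    0]; [:: 0; -4; -12; 0; 8; 0; 0; 8; 0; 0]; [:: 0; 0; 0; 0; 288; 0; -288; 192; -192; 0]; [:: 0; -36; -12; 0;
    -24; 16; 48; -24; 32; 0]; [:: 96; 32; 0; 0; 96; -64; -96; 0; -64; 0]; [:: 0; -9; -3; 0; 2; -2; 6; 2; 4;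
    0]] 96
    [:: (-6, 1, 4); (-5, -1, -4); (-4, -2, -5); (-4, 1, 4); (-4, 4, -3); (-3, -4, -4); (-3, -4, -1); (-3, -1,
    -4); (-3, -1, 5); (-3, 1, 1); (-3, 5, -1); (-2, -4, -3); (-2, -4, -1); (-2, -2, -1); (-2, -1, -4); (-2,
    -1, 1); (-2, 1, -1); (-2, 4, -1); (-1, -4, 1); (-1, -2, -4); (-1, -2, -2); (-1, -2, 1); (-1, -2, 4); (-1,
    -1, -2); (-1, -1, 1); (-1, -1, 3); (-1, 1, -4); (-1, 1, -2); (-1, 1, 1); (-1, 4, -2); (1, -7, -1); (1, -1,
    -7); (1, 2, 7); (5, 7, 4); (5, 8, 1); (6, 4, 7); (7, 10, 8); (8, 10, 7); (12, 4, 13)].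

Definition config8 : config := Config
    [:: (1, 2, 3); (0, 1, 0); (2, 1, 0); (1, 1, 1); (2, -1, 1); (0, 0, 1); (2, 3, 3); (1, 0, 0); (2, 3, -3);
    (4, 0, 3)]
    [:: 0; 0; 72; -92; 92; 0; 0; 0; -268; 148; -168; -72; 0; 256; 241; -23; 156; 36; -384; -42; -78; -36; 144;
    9; 9; 0; 0; 0]
  [:: [:: 2; 0; 0]; [:: 0; 2; -1]; [:: 0; -1; 2]] 324
    [:: [:: 0; 12; -6; 6; 0; -24; -3; -3; 0; 18; 0; 0; 0; 0; 0]; [:: 0; -3; 18; -3; 0; 0; -27; -3; 0; 0; 18;
    0; 0; 0; 0]; [:: 0; -9; -6; 27; 0; 0; 33; -27; -36; 0; 0; 18; 0; 0; 0]; [:: 0; 14; -6; 12; 0; -32; 9; -15;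
    0; 0; 0; 0; 18; 0; 0]; [:: 0; -27; 26; 21; 0; 0; 25; 9; -72; 0; 0; 0; 0; 18; 0]]
  [:: 9%N; 10%N; 11%N; 12%N; 13%N] 18
    [:: [:: 800; -74; 126; -384; -30]; [:: -74; 158; 36; -12; -33]; [:: 126; 36; 90; -45; -36]; [:: -384; -12;
    -45; 288; 9]; [:: -30; -33; -36; 9; 18]]
    [:: [:: 0; 768; -192; 0; -1056; -240; -144; 792; 72; 0]; [:: 0; 5040; -2520; 2520; -10080; -1260; -1260;
    7560; 0; 0]; [:: 0; 120; 600; 0; -480; -1140; -180; 360; 720; 0]; [:: 0; 8640; -7200; 0; -14400; 3600;
    2160; 10800; -1080; 0]; [:: 0; 504; -126; 0; -1008; -315; 378; 756; -189; 0]; [:: 2520; -8820; -1260; 0;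
    10710; 4410; 3780; -9450; -1890; 0]; [:: 0; -700; 420; 0; 1120; 0; 0; -840; 0; 0]; [:: 0; -2240; -3360; 0;
    5600; 10080; 0; -7560; -5040; 2520]; [:: 0; -20; -30; 0; 80; 15; 30; -60; -15; 0]; [:: 0; -100; 60; 0;
    190; -30; -60; -90; 30; 0]] 2520
    [:: (-6, 1, 1); (-4, -5, 5); (-4, -3, 6); (-4, -1, 4); (-4, -1, 6); (-4, 1, -1); (-4, 1, 1); (-4, 1, 2);
    (-4, 4, -1); (-4, 6, -3); (-3, 5, -1); (-2, -2, 1); (-2, -1, 2); (-2, 3, 1); (-1, -4, -1); (-1, -3, 2);
    (-1, -2, 1); (-1, -2, 2); (-1, -1, -2); (-1, -1, -1); (-1, -1, 3); (-1, 1, -1); (-1, 1, 1); (-1, 1, 2);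
    (-1, 1, 4); (-1, 3, -3); (-1, 3, -1); (-1, 3, 1); (-1, 3, 2); (-1, 3, 3); (-1, 3, 6); (-1, 6, -4); (4, -9,
    6); (7, 1, -9); (8, -6, 1); (8, 4, -11); (10, -8, -1); (20, -12, 1)].

Local Close Scope Z_scope.

Definition configs : seq config :=
  [:: config0; config1; config2; config3; config4; config5; config6; config7; config8].

(* The lines through the selected zeros cut the dual plane into m regions. *)
Definition selection (m : nat) : nat * seq nat := (match m with
  | 1 => (7, [:: 0])
  | 2 => (7, [:: 0; 1])
  | 3 => (7, [:: 0; 1; 4])
  | 4 => (7, [:: 0; 1; 2])
  | 6 => (7, [:: 0; 1; 2; 4])
  | 7 => (7, [:: 0; 1; 2; 3])
  | 9 => (7, [:: 0; 1; 3; 4; 6])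
  | 10 => (7, [:: 0; 1; 2; 3; 4])
  | 11 => (7, [:: 0; 1; 2; 3; 5])
  | 12 => (8, [:: 4; 5; 6; 7; 8; 9])
  | 13 => (7, [:: 0; 1; 3; 4; 6; 8])
  | 14 => (7, [:: 0; 1; 2; 3; 4; 6])
  | 15 => (7, [:: 0; 1; 2; 3; 4; 5])
  | 16 => (7, [:: 1; 2; 3; 4; 5; 6])
  | 17 => (8, [:: 2; 4; 5; 6; 7; 8; 9])
  | 18 => (7, [:: 0; 1; 3; 4; 5; 6; 8])
  | 19 => (7, [:: 0; 1; 2; 3; 4; 6; 7])
  | 20 => (7, [:: 0; 1; 2; 3; 4; 5; 6])
  | 21 => (7, [:: 0; 2; 3; 4; 5; 6; 7])
  | 22 => (7, [:: 2; 3; 4; 5; 6; 7; 8])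
  | 23 => (7, [:: 0; 1; 3; 4; 5; 6; 8; 9])
  | 24 => (8, [:: 0; 2; 3; 4; 6; 7; 8; 9])
  | 25 => (7, [:: 0; 1; 2; 3; 4; 5; 6; 8])
  | 26 => (7, [:: 0; 1; 2; 3; 4; 5; 6; 7])
  | 27 => (7, [:: 0; 2; 3; 4; 5; 6; 7; 8])
  | 28 => (7, [:: 0; 2; 4; 5; 6; 7; 8; 9])
  | 29 => (0, [:: 0; 1; 2; 3; 4; 5; 6; 7])
  | 30 => (8, [:: 0; 2; 3; 4; 5; 6; 7; 8; 9])
  | 31 => (7, [:: 0; 1; 2; 3; 4; 5; 6; 8; 9])
  | 32 => (7, [:: 0; 1; 2; 3; 4; 5; 6; 7; 8])
  | 33 => (7, [:: 1; 2; 3; 4; 5; 6; 7; 8; 9])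
  | 34 => (7, [:: 0; 2; 3; 4; 5; 6; 7; 8; 9])
  | 35 => (5, [:: 0; 1; 2; 3; 4; 5; 7; 8; 9])
  | 36 => (3, [:: 0; 1; 2; 3; 4; 5; 6; 7; 8])
  | 37 => (0, [:: 0; 1; 2; 3; 4; 5; 6; 7; 8])
  | 38 => (8, iota 0 10)
  | 39 => (7, iota 0 10)
  | 40 => (6, iota 0 10)
  | 41 => (5, iota 0 10)
  | 42 => (4, iota 0 10)
  | 43 => (3, iota 0 10)
  | 44 => (2, iota 0 10)
  | 45 => (1, iota 0 10)
  | 46 => (0, iota 0 10)
  | _ => (0, [::])
  end)%N.

Definition check_selection (m : nat) : bool :=
  let: (i, idx) := selection m in
  let c := nth config0 configs i in
  let pts := [seq nth (zunit 0) (zeros c) i | i <- idx] in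
  let L := witnesses pts (lines c) in
  [&& (0 < size idx)%N, (i < size configs)%N, all (fun i => i < size (zeros c))%N idx, size L == m, good_witnesses pts L
    & complete pts (size pts) predT (map (spattern pts) L)].

Lemma configs_good : all good_config configs.
Proof. by lazy. Qed.

Lemma selections_good :
  all (fun m => (m \in [:: 5; 8]%N) || check_selection m) (iota 1 46).
Proof. by lazy. Qed.

(** * Perturbation of a disc *)

Section StarRegion.
Variable R : realType.
Implicit Types (p u v w l h o : 'rV[R]_3) (e r t : R) (F : {mpoly R[3]}).

(** The first root after [a] would do; induction on the degree replaces its choice by dividing out a
    root with positive slope. *)
Lemma poly_crossing (g : {poly R}) a b : a <= b -> 0 < g.[a] -> g.[b] <= 0 ->
  exists t, [/\ a <= t <= b, g.[t] = 0 & g^`().[t] <= 0].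
Proof.
have [n] := ubnP (size g); elim: n => // n IH in g a b *; rewrite ltnS => sg ab ga gb.
have [] := @polyrcf.poly_ivt _ (- g) a b ab; first by rewrite !hornerN mulrNN mulr_ge0_le0 // ltW.
move=> s; rewrite in_itv /= => /andP[a_s s_b]; rewrite rootN => gs.
have /rootP gs0 := gs.
have [ds|ds] := leP g^`().[s] 0; first by exists s; rewrite a_s s_b.
have [q gE] := factor_theorem _ _ gs.
have as' : a < s by rewrite lt_neqAle a_s andbT; apply: contraTneq ga => ->; rewrite gs0 ltxx.
have dE t : g^`().[t] = q^`().[t] * (t - s) + q.[t].
  by rewrite gE derivM derivXsubC !hornerE.
have q0 : q != 0 by apply: contraTneq ga => q0; rewrite gE q0 mul0r horner0 ltxx.
(* Left of [s] the factor X - s is negative, so [- q] has the sign of [g] at [a], and at [s] it is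
   minus the slope. At a root of q in [a, s] the slope of [g] is q' times a nonpositive number. *)
have [] := IH (- q) a s.
- by rewrite size_polyN (leq_trans _ sg) // gE size_Mmonic ?monicXsubC // size_XsubC addn2.
- by [].
- by move: ga; rewrite gE hornerM hornerXsubC hornerN -mulrNN -opprB opprK pmulr_lgt0 ?subr_gt0.
- by move: ds; rewrite dE subrr mulr0 add0r hornerN oppr_le0 => /ltW.
move=> t [/andP[at' ts] /eqP]; rewrite hornerN oppr_eq0 => /eqP qt; rewrite derivN hornerN oppr_le0 => dq.
exists t; split; first by rewrite at' (le_trans ts s_b).
  by rewrite gE hornerM qt mul0r.
by rewrite dE qt addr0 mulr_ge0_le0 // subr_le0.
Qed.

Definition radial_deriv F o v : R := \sum_i F^`M(i).@[v 0] * (v - o) 0 i.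

Lemma radial_deriv_pert F e o v :
  radial_deriv (pert F e) o v = radial_deriv F o v - e * radial_deriv (fermat R) o v.
Proof.
rewrite /radial_deriv mulr_sumr -sumrB; apply: eq_bigr => i _.
by rewrite /pert mderivB mderivZ mevalB mevalZ mulrBl mulrA.
Qed.

Lemma radial_deriv_line F o u t :
  radial_deriv F o (o + t *: u) = t * (line_poly o u F)^`().[t].
Proof.
rewrite deriv_line_poly horner_sum mulr_sumr; apply: eq_bigr => i _.
by rewrite hornerZ line_polyE [o + _ - o]addrC addKr mxE; ring.
Qed.

Lemma continuous_radial_deriv (T : topologicalType) F o (a : T -> 'rV[R]_3) :
  continuous a -> continuous (fun z => radial_deriv F o (a z)).
Proof.
move=> ca; apply: continuous_sumR => i; apply: continuous_mulR; first exact: continuous_meval.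
apply: continuous_coord; apply: continuous_addV => //; exact: cst_continuous.
Qed.

(** The rescaling of [v] to the plane where [h] equals 1 is within [r] of [K]; denominators are
    cleared as in [cone_nbhd]. *)
Definition star_nbhd h (K : set 'rV[R]_3) r : set 'rV[R]_3 :=
  [set v | exists2 w, K w & `|v - dot h v *: w| < r * `|dot h v| ].

Lemma star_nbhd_open h K r : open (star_nbhd h K r).
Proof.
rewrite openE => v [w Kw]; rewrite -subr_gt0 => hv.
pose Phi v := r * `|dot h v| - `|v - dot h v *: w|.
have cPhi : continuous Phi.
  apply: continuous_addR.
    apply: continuous_mulR; first exact: continuous_cstR.
    apply: (@continuous_norm R _ R^o); exact: dot_continuous.
  apply: continuous_oppR; apply: continuous_norm; apply: continuous_addV; first by move=> x; exact: cvg_id.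
  apply: continuous_oppV; apply: continuous_scaleV; first exact: dot_continuous.
  exact: cst_continuous.
by have := near_pos cPhi hv; apply: filterS => x; rewrite /Phi subr_gt0 => hx; exists w.
Qed.

Lemma star_nbhd_scale h K r (c : R) v : c != 0 -> star_nbhd h K r v -> star_nbhd h K r (c *: v).
Proof.
move=> c0 [w Kw hw]; exists w => //.
have -> : c *: v - dot h (c *: v) *: w = c *: (v - dot h v *: w).
  by rewrite dotZr scalerBr scalerA.
by rewrite normrZ dotZr normrM mulrCA ltr_pM2l // normr_gt0.
Qed.

Lemma star_nbhd_mem h K r w : 0 < r -> dot h w = 1 -> K w -> star_nbhd h K r w.
Proof. by move=> r0 hw Kw; exists w => //; rewrite hw scale1r subrr normr0 normr1 mulr1. Qed.

(* At a zero close to K the perturbed form grows along the ray from o, so that it is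
   nonpositive on the segment from o to this zero. *)
Lemma star_region_linked F h o (K : set 'rV[R]_3) : F \is 6.-homog -> compact K ->
  (forall w, K w -> dot h w = 1) -> K o -> F.@[o 0] < 0 ->
  (forall w t, K w -> 0 <= t <= 1 -> K (o + t *: (w - o))) ->
  (forall w, K w -> F.@[w 0] < 0 \/ 0 < radial_deriv F o w) ->
  exists2 r, 0 < r & locally_linked F o (star_nbhd h K r).
Proof.
move=> F6 cK hK Ko Fo star KF.
pose f (x : 'rV[R]_3 * ('rV[R]_3 * R)) := (pert F x.2.2).@[(x.1 + x.2.1) 0].
pose D (x : 'rV[R]_3 * ('rV[R]_3 * R)) := radial_deriv (pert F x.2.2) o (x.1 + x.2.1).
have c1 : continuous (fun x : 'rV[R]_3 * ('rV[R]_3 * R) => x.1 + x.2.1).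
  apply: continuous_addV; first by move=> x; exact: cvg_fst.
  by move=> x; apply: cvg_comp; [exact: cvg_snd|exact: cvg_fst].
have c3 : continuous (fun x : 'rV[R]_3 * ('rV[R]_3 * R) => x.2.2).
  by move=> x; apply: cvg_comp; [exact: cvg_snd|exact: cvg_snd].
have cf : continuous f.
  have -> : f = (fun x => F.@[(x.1 + x.2.1) 0] - x.2.2 * (fermat R).@[(x.1 + x.2.1) 0]).
    by apply/funext => x; exact: pertE.
  apply: continuous_addR; first exact: continuous_meval.
  by apply: continuous_oppR; apply: continuous_mulR => //; exact: continuous_meval.
have cD : continuous D.
  have -> : D = (fun x => radial_deriv F o (x.1 + x.2.1) - x.2.2 * radial_deriv (fermat R) o (x.1 + x.2.1)).
    by apply/funext => x; exact: radial_deriv_pert.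
  apply: continuous_addR; first exact: continuous_radial_deriv.
  by apply: continuous_oppR; apply: continuous_mulR => //; exact: continuous_radial_deriv.
have : \forall i \near (0 : 'rV[R]_3, 0 : R), K `<=` (fun w => f (w, i) < 0 \/ 0 < D (w, i)).
  have /compact_near_coveringP/(_ _ (nbhs (0 : 'rV[R]_3, 0 : R)) (fun i w => f (w, i) < 0 \/ 0 < D (w, i)) _) := cK.
  apply=> w Kw.
  have P0 : pert F 0 = F by rewrite /pert scale0r subr0.
  have [Fw|Dw] := KF _ Kw.
    have : f (w, (0, 0)) < 0 by rewrite /f /= P0 addr0.
    by move=> /(near_neg cf); apply: filterS => -[x i] /=; left.
  have : 0 < D (w, (0, 0)) by rewrite /D /= P0 addr0.
  by move=> /(near_pos cD); apply: filterS => -[x i] /=; right.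
move=> [[U V] /= [/nbhs_ballP[r1 /= r10 h1] /nbhs_ballP[r2 /= r20 h2]] hUV].
exists r1 => //; exists r2 => // e /andP[e0 er] v [w0 Kw0 hv] fv.
set c := dot h v in hv.
have c0 : c != 0 by apply: contraTneq hv => ->; rewrite normr0 mulr0 -leNgt.
have [w wv hw] : exists2 w, w = v \/ w = - v &
    forall l, 0 < dot l (c^-1 *: v) * dot l o -> 0 < dot l w * dot l o.
  by apply: linked_scale; rewrite invr_eq0.
exists w => // l lpos; apply: hw; apply: star_linked lpos => t t01.
set f' := pert F e; pose x := c^-1 *: v; rewrite -/x.
have hx : dot h x = 1 by rewrite dotZr mulVf.
have fx : f'.@[x 0] = 0 by rewrite (meval_homogZ _ _ (pert_homog e F6)) fv mulr0.
have xw : `|x - w0| < r1.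
  have -> : x - w0 = c^-1 *: (v - c *: w0) by rewrite scalerBr scalerA mulVf // scale1r.
  by rewrite normrZ normfV mulrC ltr_pdivrMr ?normr_gt0.
have ho : dot h o = 1 by exact: hK.
split.
  apply: contraTneq (@ltr01 R) => e'.
  have : dot h (o + t *: (x - o)) = 0 by rewrite e' dot0r.
  by rewrite dotDr dotZr dotDr dotNr hx ho subrr mulr0 addr0 => ->; rewrite ltxx.
have key s : 0 <= s <= 1 -> f'.@[(o + s *: (x - o)) 0] < 0 \/ 0 < radial_deriv f' o (o + s *: (x - o)).
  move=> s01; have Ks := star _ _ Kw0 s01.
  (* The ray to the zero [x] is compared with the ray to the nearby point [w0], which stays in [K]
     because [K] is star-shaped; the error is at most the distance from [x] to [w0]. *)
  have -> : o + s *: (x - o) = o + s *: (w0 - o) + s *: (x - w0).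
    by rewrite -addrA -scalerDr; congr (o + s *: _); rewrite [RHS]addrC addrA subrK.
  apply: (hUV (s *: (x - w0), e) _ _ Ks); split=> /=.
    apply: h1; rewrite -ball_normE /ball_ /= sub0r normrN normrZ.
    move: s01 => /andP[s0 s1]; rewrite ger0_norm //.
    by apply: le_lt_trans xw; rewrite ler_piMl.
  by apply: h2; rewrite /ball /= sub0r normrN gtr0_norm.
rewrite -line_polyE leNgt; apply/negP => ft.
move: t01 => /andP[t0 t1].
have [|s [/andP[ts s1] gs ds]] := poly_crossing t1 ft.
  by rewrite line_polyE scale1r addrC subrK fx.
have s01 : 0 <= s <= 1 by rewrite s1 (le_trans t0 ts).
have [] := key s s01; first by rewrite -line_polyE gs ltxx.
rewrite radial_deriv_line ltNge; apply/negP; rewrite negbK.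
by rewrite mulr_ge0_le0 //; case/andP: s01.
Qed.

End StarRegion.

(** * A disc and the four corners of a square *)

Definition square_points : seq zvec :=
  [seq (x, y, Zpos xH) | x <- [:: Zpos xH; Zneg xH], y <- [:: Zpos xH; Zneg xH]].

Definition squares_sum : zpoly :=
  let m2 := Zneg (xO xH) in
  [:: (Zpos xH, (4, 0, 0)%N); (m2, (2, 0, 2)%N); (Zpos xH, (0, 4, 0)%N); (m2, (0, 2, 2)%N);
      (Zpos (xO xH), (0, 0, 4)%N)].

(* The circle with center (g : 0 : a) and squared radius b = g^2 - a d in the plane z = a. *)
Definition circle (a g d : Z) : zpoly :=
  [:: (a, (2, 0, 0)%N); (a, (0, 2, 0)%N); (Z.mul (Zneg (xO xH)) g, (1, 0, 1)%N); (d, (0, 0, 2)%N)].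

Definition disc_sextic (a g d : Z) : zpoly := pmul (circle a g d) squares_sum.

Definition radius2 (a g d : Z) : Z := Z.sub (Z.mul g g) (Z.mul a d).

(** In the plane z = a: the squared distance from the center to the line exceeds the squared
    radius. *)
Definition misses_disc (a g d : Z) (l : zvec) : bool :=
  let e := zdot l (g, Z0, a) in
  Z.ltb (Z.mul (radius2 a g d) (Z.add (Z.mul (zcoord l 0) (zcoord l 0)) (Z.mul (zcoord l 1) (zcoord l 1))))
    (Z.mul e e).

(** The centers are that of the disc and the four corners. The points [B] of the disc stand for the
    whole disc in the combinatorial check: a line positive on F leaves them on the side of the
    center, and finitely many suffice to exclude the unwanted patterns. *)
Definition good_disc (a g d : Z) (B L : seq zvec) : bool :=
  let pts := (g, Z0, a) :: square_points in
  [&& Z.ltb Z0 a, Z.ltb Z0 (radius2 a g d),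
      all (fun p => Z.ltb Z0 (zeval (circle a g d) p) && posdef 3 (zhess (disc_sextic a g d) p))
        square_points,
      all (fun b => Z.eqb (zcoord b 2) a && Z.leb (zeval (circle a g d) b) Z0) B
    & [&& (0 < size L)%N, good_witnesses pts L, all (misses_disc a g d) L
    & complete (pts ++ B) 5 (fun s => all id (drop 5 s)) (map (spattern pts) L)]].

Section Disc.
Variables (R : realType) (za zg zd : Z) (B L : seq zvec).
Hypothesis good : good_disc za zg zd B L.
Implicit Types (p u v w l : 'rV[R]_3).

Let a : R := zR R za.
Let g : R := zR R zg.
Let d : R := zR R zd.
Let b : R := g ^+ 2 - a * d.
Let Q := toM R (circle za zg zd).
Let A := toM R squares_sum.
Let F := toM R (disc_sextic za zg zd).
Let o : 'rV[R]_3 := vecZ R (zg, Z0, za).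
(** Normalized so that [dot h w = 1] is the plane z = a, in which [K] is the closed disc. *)
Let h : 'rV[R]_3 := a^-1 *: vecZ R (zunit 2).
Let K : set 'rV[R]_3 := [set w | dot h w = 1] `&` [set w | Q.@[w 0] <= 0].

Lemma disc_a_gt0 : 0 < a.
Proof. by move: good => /and5P[a0 _ _ _ _]; rewrite zR_gt0. Qed.

Lemma disc_b_gt0 : 0 < b.
Proof. by move: good => /and5P[_ b0 _ _ _]; rewrite /b expr2 -!zRM -zRB zR_gt0. Qed.

Lemma meval_circle v : Q.@[v 0] = a * v 0 0 ^+ 2 + a * v 0 1 ^+ 2 - 2%:R * g * v 0 0 * v 0 2%:R
  + d * v 0 2%:R ^+ 2.
Proof.
rewrite /Q /circle; set k := Z.mul _ zg; have kE : zR R k = -2%:R * g by rewrite zRM.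
rewrite !toM_cons toM_nil addr0 !mevalD !mevalZ !mevalX !prod3 !mnmE /= kE -/a -/d; ring.
Qed.

Lemma meval_squares_sum v : A.@[v 0] =
  (v 0 0 ^+ 2 - v 0 2%:R ^+ 2) ^+ 2 + (v 0 1 ^+ 2 - v 0 2%:R ^+ 2) ^+ 2.
Proof.
rewrite /A /squares_sum !toM_cons toM_nil addr0 !mevalD !mevalZ !mevalX !prod3 !mnmE /=.
by rewrite (_ : zR R (Zneg _) = -2%:R) // (_ : zR R (Zpos (xO _)) = 2%:R) // zR1; ring.
Qed.

Lemma discE v : F.@[v 0] = Q.@[v 0] * A.@[v 0].
Proof. by rewrite /F toM_pmul mevalM. Qed.

Lemma squares_sum_ge0 v : 0 <= A.@[v 0].
Proof. by rewrite meval_squares_sum addr_ge0 // sqr_ge0. Qed.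

Lemma disc_homog : F \is 6.-homog.
Proof. by rewrite /F toM_pmul; apply: (@dhomogM _ _ _ 2 _ 4); exact: toM_homog. Qed.

Lemma circle_homog : Q \is 2.-homog.
Proof. exact: toM_homog. Qed.

Lemma circle_squareP v : Q.@[v 0] = a^-1 * ((a * v 0 0 - g * v 0 2%:R) ^+ 2 + (a * v 0 1) ^+ 2
  - b * v 0 2%:R ^+ 2).
Proof. by rewrite meval_circle /b; field; rewrite gt_eqF // disc_a_gt0. Qed.

Lemma circle_le0_neq0 v : v != 0 -> Q.@[v 0] <= 0 -> v 0 2%:R != 0.
Proof.
move=> v0; rewrite circle_squareP pmulr_rle0 ?invr_gt0 ?disc_a_gt0 // => q.
apply: contra v0 => /eqP z0; move: q; rewrite z0 expr0n !mulr0 !subr0 => q.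
have a0 := disc_a_gt0.
have : (a * v 0 0) ^+ 2 + (a * v 0 1) ^+ 2 == 0 by rewrite eq_le q addr_ge0 ?sqr_ge0.
rewrite paddr_eq0 ?sqr_ge0 // !sqrf_eq0 !mulf_eq0 gt_eqF //= => /andP[/eqP x0 /eqP y0].
apply/eqP/rowP => i; rewrite mxE.
by have [-> | -> | ->] := ord3P i.
Qed.

Lemma dot_height v : dot h v = a^-1 * v 0 2%:R.
Proof. by rewrite /h dotZl /dot sum3 !mxE /= zR0 zR1; ring. Qed.

Lemma discK w : K w -> w 0 2%:R = a /\ (w 0 0 - g) ^+ 2 + w 0 1 ^+ 2 <= b.
Proof.
move=> [/= hw]; have a0 := disc_a_gt0.
have wa : w 0 2%:R = a.
  by move: hw; rewrite dot_height => /(congr1 (fun x => a * x)); rewrite mulVKf ?gt_eqF // mulr1.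
rewrite meval_circle wa /b => q; split=> //.
rewrite -(ler_pM2l a0); nra.
Qed.

Lemma disc_memK w : w 0 2%:R = a -> (w 0 0 - g) ^+ 2 + w 0 1 ^+ 2 <= b -> K w.
Proof.
move=> wa q; have a0 := disc_a_gt0; split; rewrite /= ?dot_height ?meval_circle wa.
  by rewrite mulVf ?gt_eqF.
by move: q; rewrite /b -(ler_pM2l a0) => q; nra.
Qed.

Lemma disc_center : [/\ o 0 0 = g, o 0 1 = 0 & o 0 2%:R = a].
Proof. by rewrite !mxE. Qed.

Lemma disc_star w t : K w -> 0 <= t <= 1 -> K (o + t *: (w - o)).
Proof.
move=> /discK [wa q] /andP[t0 t1]; have [o0 o1 o2] := disc_center.
have e i : (o + t *: (w - o)) 0 i = o 0 i + t * (w 0 i - o 0 i) by rewrite !mxE.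
apply: disc_memK; rewrite !e ?o0 ?o1 ?o2 ?wa ?subrr ?mulr0 ?addr0 //.
have -> : (g + t * (w 0 0 - g) - g) ^+ 2 + (0 + t * (w 0 1 - 0)) ^+ 2 =
    t ^+ 2 * ((w 0 0 - g) ^+ 2 + w 0 1 ^+ 2) by ring.
have b0 := disc_b_gt0.
by apply: le_trans q; rewrite ler_piMl ?addr_ge0 ?sqr_ge0 // expr_le1.
Qed.

Lemma disc_compact : compact K.
Proof.
apply: bounded_closed_compact; last first.
  apply: closedI.
    have -> : [set w | dot h w = 1] = [set w | dot h w - 1 = 0].
      by apply/seteqP; split=> w /= => [->|/eqP]; rewrite ?subrr // subr_eq0 => /eqP.
    apply: closed_eq0; apply: continuous_addR; first exact: dot_continuous.
    exact: continuous_cstR.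
  rewrite (_ : (fun _ => _) = [set w : 'rV[R]_3 | 0 <= - Q.@[w 0]]); last first.
    by apply/seteqP; split=> w /=; rewrite oppr_ge0.
  apply: closed_ge0; apply: continuous_oppR; apply: continuous_meval => x; exact: cvg_id.
exists (`|o| + (1 + b)); split; first by rewrite num_real.
move=> x /ltW hx w Kw; apply: le_trans hx.
rewrite -[w](subrK o) addrC (le_trans (ler_normD _ _)) // lerD2l.
have [wa q] := discK Kw; have b0 := disc_b_gt0.
change (mx_norm (w - o) <= 1 + b).
have [->|n0] := eqVneq (mx_norm (w - o)) 0; first by rewrite addr_ge0 // ltW.
have [[i j] /= e] := mx_norm_neq0 n0.
rewrite e !mxE (ord1 i).
have [-> | -> | ->] := ord3P j.
- by rewrite -[zR R _]/g ler_norml; nra.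
- rewrite (_ : zR R (zcoord _ _) = 0) // subr0 ler_norml.
  by have := sqr_ge0 (w 0 0 - g); nra.
- by rewrite wa -[zR R _]/a subrr normr0 addr_ge0 // ltW.
Qed.

Lemma square_points_zero (p : zvec) : p \in square_points -> A.@[vecZ R p 0] = 0.
Proof.
by move=> /allpairsP [[x y] [xs ys ->]]; rewrite meval_toM; move: xs ys;
  rewrite !inE => /orP[] /eqP /= -> /orP[] /eqP /= ->; rewrite zR0.
Qed.

Lemma squares_sum_eq0 v : v != 0 -> A.@[v 0] = 0 ->
  exists2 p, p \in square_points & exists2 c : R, c != 0 & v = c *: vecZ R p.
Proof.
move=> v0 /eqP; rewrite meval_squares_sum paddr_eq0 ?sqr_ge0 // !sqrf_eq0 !subr_eq0.
rewrite !eqf_sqr => /andP[xz yz].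
have z0 : v 0 2%:R != 0.
  apply: contra v0 => /eqP z0; move: xz yz; rewrite z0 oppr0 !orbb => /eqP x0 /eqP y0.
  apply/eqP/rowP => i; rewrite mxE.
  by have [-> | -> | ->] := ord3P i.
have sgn x : (x == v 0 2%:R) || (x == - v 0 2%:R) ->
    exists2 s, s \in [:: Zpos xH; Zneg xH] & x = v 0 2%:R * zR R s.
  by case/orP => /eqP ->; [exists (Zpos xH); rewrite // mulr1|exists (Zneg xH); rewrite // mulrN1].
have [s s1 xE] := sgn _ xz; have [t t1 yE] := sgn _ yz.
exists (s, t, Zpos xH); first by apply/allpairsP; exists (s, t).
exists (v 0 2%:R) => //; apply/rowP => i; rewrite !mxE.
by have [-> | -> | ->] := ord3P i; rewrite //= zR1 mulr1.
Qed.

Lemma square_points_outside (p : zvec) : p \in square_points -> 0 < Q.@[vecZ R p 0].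
Proof.
by move=> pP; move: good => /and5P[_ _ /allP/(_ _ pP)/andP[q _] _ _]; rewrite meval_toM zR_gt0.
Qed.

Lemma squares_sum_gt0 v : v != 0 -> Q.@[v 0] <= 0 -> 0 < A.@[v 0].
Proof.
move=> v0 q; rewrite lt_neqAle squares_sum_ge0 andbT eq_sym; apply/eqP => Av.
have [p pP [c c0 vE]] := squares_sum_eq0 v0 Av.
move: q; rewrite vE (meval_homogZ _ _ circle_homog) leNgt mulr_gt0 ?square_points_outside //.
by rewrite exprn_even_gt0.
Qed.

Lemma discK_neq0 w : K w -> w != 0.
Proof. by move=> [/= hw _]; apply: contraTneq (@oner_neq0 R) => w0; rewrite -hw w0 dot0r eqxx. Qed.

(** Inside the disc F is negative. On its boundary Q = 0, so the radial derivative of F is that of Q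
    times the positive A. *)
Lemma disc_radial w : K w -> F.@[w 0] < 0 \/ 0 < radial_deriv F o w.
Proof.
move=> Kw; have [_ /= q] := Kw; have A0 := squares_sum_gt0 (discK_neq0 Kw) q.
have [q0|] := ltP Q.@[w 0] 0; first by left; rewrite discE nmulr_rlt0.
move=> q'; right; have {q'}q0 : Q.@[w 0] = 0 by apply/eqP; rewrite eq_le q.
have -> : radial_deriv F o w = A.@[w 0] * radial_deriv Q o w.
  rewrite /radial_deriv mulr_sumr; apply: eq_bigr => i _.
  by rewrite /F toM_pmul mderivM mevalD !mevalM -/Q q0; ring.
apply: mulr_gt0 => //; have [wa _] := discK Kw.
have a0 := disc_a_gt0; have b0 := disc_b_gt0.
have e (c : 'I_3) : Q^`M(c) = toM R (pderiv c (circle za zg zd)) by rewrite toM_pderiv.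
rewrite /radial_deriv sum3 !e /circle; set k := Z.mul _ zg; have kE : zR R k = -2%:R * g by rewrite zRM.
have [o0 o1 o2] := disc_center; have oE i : (w - o) 0 i = w 0 i - o 0 i by rewrite !mxE.
clearbody k; rewrite !oE o0 o1 o2 wa subrr /=.
rewrite !toM_cons toM_nil addr0 !mevalD !mevalZ !mevalX !prod3 !mnmE /=.
rewrite !zRM kE (_ : zR R (Zpos (xO _)) = 2%:R) // zR0 zR1 -/a -/d wa.
move: q0; rewrite meval_circle wa /= => q0.
set E := (X in 0 < X).
(* In the plane z = a the radial derivative of Q is 2 Q + 2 a b. *)
have -> : E = 2%:R * (a * w 0 0 ^+ 2 + a * w 0 1 ^+ 2 - 2%:R * g * w 0 0 * a + d * a ^+ 2) + 2%:R * a * b.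
  by rewrite /E /b; ring.
by rewrite q0 mulr0 add0r !mulr_gt0.
Qed.

Lemma disc_center_linked : exists2 r, 0 < r & locally_linked F o (star_nbhd h K r).
Proof.
have [o0 o1 o2] := disc_center; have b0 := disc_b_gt0.
have Ko : K o by apply: disc_memK; rewrite // o0 o1 subrr !expr0n /= addr0 ltW.
apply: star_region_linked => //.
- exact: disc_homog.
- exact: disc_compact.
- by move=> w [].
- have a0 := disc_a_gt0; have q0 : Q.@[o 0] < 0.
    have -> : Q.@[o 0] = - (a * b) by rewrite meval_circle o0 o1 o2 /b; ring.
    by rewrite oppr_lt0 mulr_gt0.
  by rewrite discE nmulr_rlt0 // squares_sum_gt0 ?discK_neq0 // ltW.
- exact: disc_star.
- exact: disc_radial.
Qed.

(** Cauchy-Schwarz: in coordinates centered at the disc the line is l0 x + l1 y = - e z, and x^2 +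
    y^2 <= b z^2 would bound e^2 by b (l0^2 + l1^2). *)
Lemma disc_misses (l : zvec) v : misses_disc za zg zd l -> v != 0 -> dot (vecZ R l) v = 0 -> 0 < Q.@[v 0].
Proof.
rewrite /misses_disc; set e := zdot _ _ => lt_e v0 lv; rewrite ltNge; apply/negP => q.
have z0 := circle_le0_neq0 v0 q; have a0 := disc_a_gt0.
pose x := a * v 0 0 - g * v 0 2%:R; pose y := a * v 0 1; pose z := v 0 2%:R.
pose l0 := zR R (zcoord l 0); pose l1 := zR R (zcoord l 1).
have eE : zR R e = l0 * g + zR R (zcoord l 2) * a.
  by rewrite /e /zdot !zRD !zRM /= zR0 mulr0 addr0.
have lin : l0 * x + l1 * y = - (zR R e * z).
  move: lv; rewrite /dot sum3 !mxE /= -/l0 -/l1 => /(congr1 (fun s => a * s)); rewrite mulr0 => lv.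
  rewrite eE /x /y /z; apply/eqP; rewrite -subr_eq0 -lv; apply/eqP; ring.
have q' : x ^+ 2 + y ^+ 2 <= b * z ^+ 2.
  by move: q; rewrite circle_squareP pmulr_rle0 ?invr_gt0 // subr_le0.
have lt' : b * (l0 ^+ 2 + l1 ^+ 2) < zR R e ^+ 2.
  by rewrite /b /a /g /d /l0 /l1 !expr2 -!(zRM, zRB, zRD) -subr_gt0 -zRB zR_gt0; move: lt_e; rewrite /radius2; lia.
have cs : (l0 * x + l1 * y) ^+ 2 <= (l0 ^+ 2 + l1 ^+ 2) * (x ^+ 2 + y ^+ 2).
  by rewrite -subr_ge0 (_ : _ - _ = (l0 * y - l1 * x) ^+ 2) ?sqr_ge0 //; ring.
have : zR R e ^+ 2 * z ^+ 2 <= b * (l0 ^+ 2 + l1 ^+ 2) * z ^+ 2.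
  rewrite -exprMn -sqrrN -lin (le_trans cs) // [b * _]mulrC -mulrA ler_wpM2l //.
  by rewrite addr_ge0 // sqr_ge0.
by rewrite leNgt ltr_pM2r ?lt' // exprn_even_gt0.
Qed.

Lemma disc_le0 v : v != 0 -> F.@[v 0] <= 0 -> Q.@[v 0] <= 0 \/ A.@[v 0] = 0.
Proof.
move=> v0; rewrite discE => qA; have [q|q] := leP Q.@[v 0] 0; [by left|right].
by apply/eqP; rewrite eq_le squares_sum_ge0 andbT -(pmulr_rle0 _ q).
Qed.

Lemma disc_sextic_components : exists f : {mpoly R[3]},
    [/\ smooth_real_sextic f,
        connected_components (avoidance_locus f) #= `I_(size L) &
        forall K, connected_components (avoidance_locus f) K -> convex_as_cone K].
Proof.
have [r r0 hr] := disc_center_linked.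
have [_ _ /allP hP /allP hB /and4P[L0 /andP[uL /allP wL] /allP mL compl]] := and5P good.
pose pts := (zg, Z0, za) :: square_points.
have a0 := disc_a_gt0; have b0 := disc_b_gt0; have [o0 o1 o2] := disc_center.
have Ko : K o by apply: disc_memK; rewrite // o0 o1 subrr !expr0n /= addr0 ltW.
have Qo : Q.@[o 0] < 0.
  have -> : Q.@[o 0] = - (a * b) by rewrite meval_circle o0 o1 o2 /b; ring.
  by rewrite oppr_lt0 mulr_gt0.
have p_neq0 (p : zvec) : p \in square_points -> vecZ R p != 0.
  move=> pP; apply: contraTneq (square_points_outside pP) => ->.
  by rewrite -(scale0r (0 : 'rV[R]_3)) (meval_homogZ _ _ circle_homog) expr0n mul0r ltxx.
have op (p : zvec) : p \in square_points -> vecZ R p != o.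
  by move=> pP; apply: contraTneq (square_points_outside pP) => ->; rewrite -leNgt ltW.
have Fp (p : zvec) : p \in square_points -> F.@[vecZ R p 0] = 0.
  by move=> pP; rewrite discE square_points_zero // mulr0.
have /choice [rad hrad] : forall p, exists r, p \in map (vecZ R) square_points ->
    0 < r /\ locally_linked F p (cone_nbhd p r).
  move=> p; have [/mapP[p' pP ->]|] := boolP (p \in _); last by exists 0.
  have [] := point_linked disc_homog (p_neq0 _ pP) (Fp _ pP); last by move=> r' r'0 hr'; exists r'.
  by move=> u u0 up; apply: posdef_hess => //; have /andP[] := hP _ pP.
pose N p := if p == o then star_nbhd h K r else cone_nbhd p (rad p).
rewrite -(size_map (vecZ R) L).
apply: (@sextic_of_centers R F o (map (vecZ R) pts) _ N).
- exact: disc_homog.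
- exact: mem_head.
- move=> p; rewrite in_cons => /orP[/eqP ->|pP].
    rewrite /N eqxx; split=> //; first exact: discK_neq0.
    + by rewrite discE mulr_le0_ge0 ?squares_sum_ge0 // ltW.
    + exact: star_nbhd_open.
    + by move=> c v c0; apply: star_nbhd_scale; rewrite gt_eqF.
  have [r'0 hr'] := hrad _ pP.
  have [-> p0 Fp0] : [/\ N p = cone_nbhd p (rad p), p != 0 & F.@[p 0] = 0].
    have pP' : p \in map (vecZ R) square_points := pP.
    by have /mapP[p' p'P ->] := pP'; rewrite /N (negPf (op _ p'P)) p_neq0 // Fp.
  split; rewrite ?Fp0 //; first exact: cone_nbhd_open.
  by move=> c v c0; apply: cone_nbhd_scale; rewrite gt_eqF.
- move=> v v0 /(disc_le0 v0)[q|Av].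
    exists o; first exact: mem_head.
    have z0 := circle_le0_neq0 v0 q.
    rewrite /N eqxx -[v](scalerKV (_ : a^-1 * v 0 2%:R != 0)); last by rewrite mulf_neq0 ?invr_eq0 // gt_eqF.
    have c0 : a^-1 * v 0 2%:R != 0 by rewrite mulf_neq0 ?invr_eq0 // gt_eqF.
    have hw : dot h ((a^-1 * v 0 2%:R)^-1 *: v) = 1 by rewrite dotZr dot_height mulVf.
    apply: star_nbhd_scale => //; apply: star_nbhd_mem => //; split=> //=.
    by rewrite (meval_homogZ _ _ circle_homog) mulr_ge0_le0 // exprn_even_ge0.
  have [p pP [c c0 ->]] := squares_sum_eq0 v0 Av.
  have p_pts : p \in pts by apply/orP; right.
  exists (vecZ R p); first exact: (map_f (vecZ R) p_pts).
  have [r'0 _] := hrad _ (map_f (vecZ R) pP).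
  rewrite /N (negPf (op _ pP)); apply: cone_nbhd_scale => //; apply: cone_nbhd_mem => //.
  exact: p_neq0.
- by rewrite size_map.
- move=> _ /mapP [l lL ->]; have /andP[lp /allP hl] := wL _ lL.
  split; first by rewrite dot_vecZ zR_gt0.
  move=> x x0 lx; rewrite discE mulr_gt0 //; first exact: disc_misses (mL _ lL) x0 lx.
  rewrite lt_neqAle squares_sum_ge0 andbT eq_sym; apply/eqP => Ax.
  have [p pP [c c0 xE]] := squares_sum_eq0 x0 Ax.
  move: lx; rewrite xE dotZr dot_vecZ => /eqP; rewrite mulf_eq0 (negPf c0) zR_eq0 /=.
  by apply/negP/hl; rewrite in_cons; apply/orP; right.
- by rewrite -map_comp (eq_map (pattern_vecZ R pts)).
move=> l lp lpos; rewrite -map_comp (eq_map (pattern_vecZ R pts)).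
(* The segment from the center to a point of [B] stays in the disc, where F <= 0, so the line does
   not cross it. *)
have lB (z : zvec) : z \in B -> 0 < dot l (vecZ R z).
  move=> zB; have /andP[/Z.eqb_eq za' qz] := hB _ zB.
  have Kz : K (vecZ R z).
    split=> /=; first by rewrite dot_height mxE za' mulVf // gt_eqF.
    by rewrite meval_toM -oppr_ge0 -zRN zR_ge0; move: qz; lia.
  rewrite -(pmulr_lgt0 _ lp); apply: star_linked lpos => t t01.
  have Kt := disc_star Kz t01; split; first exact: discK_neq0.
  by have [_ /= q] := Kt; rewrite discE mulr_le0_ge0 // squares_sum_ge0.
(* Five centers: the disc and four corners; the signs on [B] only restrict the possible patterns. *)
have -> : pattern (map (vecZ R) pts) l = take 5 (pattern (map (vecZ R) (pts ++ B)) l).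
  by rewrite /pattern -!map_comp map_cat take_size_cat.
apply: completeP compl _ _ _ _ => //.
  move=> p; rewrite mem_cat => /orP[|/lB/gt_eqF -> //]; rewrite in_cons => /orP[/eqP ->|pP].
    by rewrite gt_eqF.
  by apply/eqP => /(lpos _ (p_neq0 _ pP)); rewrite Fp // ltxx.
rewrite /pattern -map_comp map_cat drop_size_cat //.
by apply/allP => _ /mapP[z zB ->]; exact: lB.
Qed.

End Disc.

Open Scope Z_scope.

(** The midpoints of the edges of the square; they prevent a line from cutting off two adjacent
    corners. *)
Definition disc5_boundary : seq zvec := [:: (2, 0, 2); (-2, 0, 2); (0, 2, 2); (0, -2, 2)].

(** The line at infinity, and one line for each corner cut off from the disc: 1 + 4 components. *)
Definition disc5_lines : seq zvec := [:: (0, 0, 1); (4, 4, 7); (-4, -4, 7); (4, -4, 7); (-4, 4, 7)].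

Definition disc8_boundary : seq zvec := [:: (16, 0, 16); (6, 6, 16); (6, -6, 16)].

(** With the disc moved to the right, one pattern cuts off nothing, four cut off one corner, and
    three cut off the left, the lower or the upper pair. The point (1, 0) of the disc blocks the
    right pair, and its points on the diagonals block the triples that leave out a right corner. *)
Definition disc8_lines : seq zvec :=
  [:: (1, 0, 0); (0, 0, 1); (1, 1, 1); (1, -1, 1); (0, 3, 2); (0, -3, 2); (-1, -3, 3); (-1, 3, 3)].

Lemma disc5_good : good_disc 2 0 (-3) disc5_boundary disc5_lines.
Proof. by lazy. Qed.

Lemma disc8_good : good_disc 16 12 3 disc8_boundary disc8_lines.
Proof. by lazy. Qed.

Close Scope Z_scope.

(** * A sextic meeting every line *)

Section EmptyLocus.
Variable R : realType.
Implicit Types (u v w l x : 'rV[R]_3).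

Definition sum_of_cubes : {mpoly R[3]} := \sum_(i < 3) 'X_i ^+ 3.

Lemma sum_of_cubesE v : sum_of_cubes.@[v 0] = \sum_i v 0 i ^+ 3.
Proof. by rewrite raddf_sum; apply: eq_bigr => i _ /=; rewrite rmorphXn /= mevalXU. Qed.

Lemma sum_of_cubes_homog : sum_of_cubes \is 3.-homog.
Proof.
by apply: rpred_sum => i _; apply: (@dhomogMn _ _ _ 1 _ 3); rewrite dhomogX /= mdeg1.
Qed.

Lemma sum_of_cubesN v : sum_of_cubes.@[(- v) 0] = - sum_of_cubes.@[v 0].
Proof. by rewrite -scaleN1r (meval_homogZ _ _ sum_of_cubes_homog) -signr_odd expr1 mulN1r. Qed.

(** An odd form on a plane: for an orthogonal basis with suitable signs its values have opposite
    signs, so it vanishes on the segment between the two vectors, which misses the origin by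
    independence. *)
Lemma sum_of_cubes_zero l : exists2 v, v != 0 & dot l v = 0 /\ sum_of_cubes.@[v 0] = 0.
Proof.
have [u u0 [lu _]] := common_zero l 0; have [w w0 [lw uw]] := common_zero l u.
wlog Cu : u u0 lu uw / 0 <= sum_of_cubes.@[u 0].
  move=> IH; have [/IH|/ltW h] := leP 0 sum_of_cubes.@[u 0]; first exact.
  by apply: (IH (- u)); rewrite ?oppr_eq0 ?dotNr ?dotNl ?lu ?uw ?oppr0 // sum_of_cubesN oppr_ge0.
wlog Cw : w w0 lw uw / sum_of_cubes.@[w 0] <= 0.
  move=> IH; have [/IH|/ltW h] := leP sum_of_cubes.@[w 0] 0; first exact.
  by apply: (IH (- w)); rewrite ?oppr_eq0 ?dotNr ?lw ?uw ?oppr0 // sum_of_cubesN oppr_le0.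
have [C0|C0] := eqVneq sum_of_cubes.@[u 0] 0; first by exists u.
have [|t [t0 t1 Ct]] := segment_root (f := sum_of_cubes) _ Cw (v := u); first by rewrite lt_neqAle eq_sym C0.
exists ((1 - t) *: u + t *: w); last by rewrite dotDr !dotZr lu lw !mulr0 addr0.
apply/eqP => e; have := congr1 (dot u) e; rewrite dotDr !dotZr uw mulr0 addr0 dot0r => /eqP.
rewrite mulf_eq0 (gt_eqF (dot_gt0 u0)) orbF subr_eq0 => /eqP te.
by move: e; rewrite -te subrr scale0r add0r scale1r => /eqP; rewrite (negPf w0).
Qed.

Definition vec3 (a b c : R) : 'rV[R]_3 := \row_i nth 0 [:: a; b; c] i.

(* Four points of the line l; the sum of cubes does not vanish on all of them. *)
Definition line_point l (k : 'I_4) : 'rV[R]_3 :=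
  let w := vec3 1 1 (- 2%:R) in
  match val k with
  | 0 => vec3 0 (l 0 2%:R) (- l 0 1)
  | 1 => vec3 (l 0 2%:R) 0 (- l 0 0)
  | 2 => vec3 (l 0 1) (- l 0 0) 0
  | _ => dot l l *: w - dot l w *: l
  end.

Lemma vec3E a b c : [/\ vec3 a b c 0 0 = a, vec3 a b c 0 1 = b & vec3 a b c 0 2%:R = c].
Proof. by rewrite !mxE. Qed.

Lemma dot_line_point l k : dot l (line_point l k) = 0.
Proof.
case: k => -[|[|[|k]]] hk; rewrite /line_point /=; last by rewrite dotDr dotNr !dotZr mulrC subrr.
all: by rewrite /dot sum3; do 3![rewrite [vec3 _ _ _ _ _]mxE /=]; ring.
Qed.

Lemma continuous_line_point k : continuous (line_point ^~ k).
Proof.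
have cid : continuous (fun l : 'rV[R]_3 => l) by move=> l; exact: cvg_id.
have ccoord i : continuous (fun l : 'rV[R]_3 => l 0 i) by exact: continuous_coord.
have cvec (a b c : 'rV[R]_3 -> R) : continuous a -> continuous b -> continuous c ->
    continuous (fun l => vec3 (a l) (b l) (c l)).
  move=> ca cb cc.
  have -> : (fun l => vec3 (a l) (b l) (c l)) =
      (fun l => a l *: vec3 1 0 0 + b l *: vec3 0 1 0 + c l *: vec3 0 0 1).
    apply/funext => l; apply/rowP => i; rewrite !mxE; case: i => [[|[|[|//]]] hi] /=; ring.
  have cs (f : 'rV[R]_3 -> R) v : continuous f -> continuous (fun l => f l *: v).
    by move=> cf; apply: (@continuous_scaleV _ _ _ f (fun _ => v)) => //; exact: cst_continuous.
  by apply: continuous_addV; [apply: continuous_addV|]; exact: cs.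
have c0 : continuous (fun _ : 'rV[R]_3 => 0 : R) by exact: continuous_cstR.
case: k => -[|[|[|k]]] hk; rewrite /line_point /=.
- by apply: cvec => //; exact: continuous_oppR.
- by apply: cvec => //; exact: continuous_oppR.
- by apply: cvec => //; exact: continuous_oppR.
apply: continuous_addV.
  by apply: continuous_scaleV; [exact: continuous_dot|exact: cst_continuous].
apply: continuous_oppV; apply: continuous_scaleV => //.
by apply: continuous_dot => //; exact: cst_continuous.
Qed.

Lemma cube_inj (x y : R) : x ^+ 3 = y ^+ 3 -> x = y.
Proof.
have key (a b : R) : a < b -> a ^+ 3 < b ^+ 3.
  rewrite -subr_gt0 => ab; rewrite -subr_gt0.
  have -> : b ^+ 3 - a ^+ 3 = 4%:R^-1 * ((b - a) ^+ 3 + 3%:R * (b - a) * (a + b) ^+ 2) by field.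
  apply: mulr_gt0; first by rewrite invr_gt0 ltr0n.
  apply: ltr_wpDr; last exact: exprn_gt0.
  by apply: mulr_ge0; [apply: mulr_ge0; [exact: ler0n|exact: ltW]|exact: sqr_ge0].
by have [/key|/key|//] := ltgtP x y => /[swap] ->; rewrite ltxx.
Qed.

(** Vanishing at the first two points forces l = (a, a, a). The last point is then 3 a^2 (1, 1, -2),
    where the sum of cubes is -162 a^6. *)
Lemma line_point_neq0 l : l != 0 -> exists k, sum_of_cubes.@[line_point l k 0] != 0.
Proof.
move=> l0; apply: contrapT => h.
have z k : sum_of_cubes.@[line_point l k 0] = 0.
  by apply/eqP; apply: contraT => nz; exfalso; apply: h; exists k.
have e1 : l 0 2%:R = l 0 1.
  apply: cube_inj; have := z 0; rewrite /line_point /= sum_of_cubesE sum3.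
  by have [-> -> ->] := vec3E 0 (l 0 2%:R) (- l 0 1) => h0; lra.
have e0 : l 0 2%:R = l 0 0.
  apply: cube_inj; have := z 1; rewrite /line_point /= sum_of_cubesE sum3.
  by have [-> -> ->] := vec3E (l 0 2%:R) 0 (- l 0 0) => h0; lra.
have := z 3%:R; rewrite /line_point /= sum_of_cubesE sum3 /dot !sum3.
have E (i : 'I_3) (w : 'rV[R]_3) (a b : R) : (a *: w - b *: l) 0 i = a * w 0 i - b * l 0 i.
  by rewrite !mxE.
rewrite !E; have [-> -> ->] := vec3E 1 1 (- 2%:R); rewrite -e1 -e0.
set a := l 0 2%:R => h0.
have : a ^+ 6 = 0 by lra.
move=> /eqP; rewrite expf_eq0 /= => /eqP a0; move: l0 => /eqP; apply.
by apply/rowP => i; rewrite mxE; have [-> | -> | ->] := ord3P i; rewrite -?e0 -?e1.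
Qed.

(** On every line the perturbed square is negative at a zero of the cubic and positive at one of the
    four points, so it has a zero between them. Compactness of the space of lines yields one [e] for
    all. *)
Lemma empty_avoidance_sextic : exists f : {mpoly R[3]},
  smooth_real_sextic f /\ avoidance_locus f = set0.
Proof.
pose F := sum_of_cubes ^+ 2.
have F6 : F \is 6.-homog by apply: (@dhomogMn _ _ _ 3 _ 2); exact: sum_of_cubes_homog.
have FE v : F.@[v 0] = sum_of_cubes.@[v 0] ^+ 2 by rewrite rmorphXn.
have [chi chi0 smooth] := generic_smooth F6.
(* Summing over the four points gives one continuous positive function; a positive sum has a
   positive term. *)
pose Phi (x : 'rV[R]_3 * R) := \sum_k (F.@[line_point x.1 k 0] - x.2 * (fermat R).@[line_point x.1 k 0]).
have cPhi : continuous Phi.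
  have c2 : continuous (fun x : 'rV[R]_3 * R => x.2) by move=> x; exact: cvg_snd.
  have cl k : continuous (fun x : 'rV[R]_3 * R => line_point x.1 k).
    move=> x; exact: (@continuous_comp _ _ _ fst (line_point ^~ k) x cvg_fst (continuous_line_point (x := _))).
  apply: continuous_sumR => k; apply: continuous_addR; first exact: continuous_meval.
  by apply: continuous_oppR; apply: continuous_mulR => //; exact: continuous_meval.
pose K : set 'rV[R]_3 := setT `&` [set l | `|l| = 1].
have [r r0 hr] : exists2 r, 0 < r & forall e, 0 < e < r -> forall l, K l -> 0 < Phi (l, e).
  apply: near0_radius; apply: compact_pos cPhi _; first by apply: compact_sphere; exact: closedT.
  move=> l [_ /= l1]; have l0 : l != 0.
    by apply/eqP => e; move: l1; rewrite e normr0 => /eqP; rewrite eq_sym oner_eq0.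
  have [k hk] := line_point_neq0 l0.
  rewrite /Phi (bigD1 k) //= ltr_pwDl //; first by rewrite mul0r subr0 FE exprn_even_gt0.
  by apply: sumr_ge0 => j _; rewrite mul0r subr0 FE sqr_ge0.
have [e e_r eroot] := small_nonroot chi0 r0.
exists (pert F e); have f6 := pert_homog e F6.
split; first by split=> //; exact: smooth.
apply/seteqP; split=> // p; have [l l0 ->] := ptP p.
move=> /(avoidP f6 l0) la.
have [k _ fk] : exists2 k, true & 0 < (pert F e).@[line_point (`|l|^-1 *: l) k 0].
  apply: contrapT => h; have := hr _ e_r (`|l|^-1 *: l).
  have Kl : K (`|l|^-1 *: l) by split; rewrite //= normalize_sphere.
  move=> /(_ Kl); rewrite ltNge /Phi /=; apply/negP; rewrite negbK; apply: sumr_le0 => k _.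
  by rewrite -pertE leNgt; apply/negP => hk; apply: h; exists k.
set v := line_point _ k in fk.
have lv : dot l v = 0.
  have := dot_line_point (`|l|^-1 *: l) k; rewrite dotZl => /eqP.
  by rewrite mulf_eq0 invr_eq0 normr_eq0 (negPf l0) => /eqP.
have [w w0 [lw Cw]] := sum_of_cubes_zero l.
have fw : (pert F e).@[w 0] < 0.
  case/andP: e_r => e0 _.
  by rewrite pertE FE Cw expr0n sub0r oppr_lt0 mulr_gt0 // fermat_gt0.
have [t [t0 t1 ft]] := segment_root fk (ltW fw).
set x := _ + _ in ft; have [x0|x0] := eqVneq x 0; last first.
  by have := la _ x0 ft; rewrite dotDr !dotZr lv lw !mulr0 addr0 eqxx.
(* If the segment met the origin, evenness would equate (1 - t)^6 times a positive value with t^6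
   times a negative one, forcing t = 1 and t = 0. *)
move: x0 => /eqP; rewrite addr_eq0 => /eqP tE.
have : (1 - t) ^+ 6 * (pert F e).@[v 0] = t ^+ 6 * (pert F e).@[w 0].
  by rewrite -!(meval_homogZ _ _ f6) tE mevalN6.
have t6 : 0 <= t ^+ 6 by rewrite exprn_ge0.
have s6 : 0 <= (1 - t) ^+ 6 by rewrite exprn_ge0 // subr_ge0.
move=> eq6; have /eqP : t ^+ 6 = 0 by nra.
have /eqP : (1 - t) ^+ 6 = 0 by nra.
by rewrite !expf_eq0 /= subr_eq0 => /eqP <-; rewrite oner_eq0.
Qed.

End EmptyLocus.

Theorem corollary5p10 (R : realType) (m : nat) (hm : (m <= 46)%N) :
  exists f : {mpoly R[3]},
    [/\ smooth_real_sextic f,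
        connected_components (avoidance_locus f) #= `I_m &
        forall K, connected_components (avoidance_locus f) K ->
          convex_as_cone K].
Proof.
have [->|m0] := posnP m.
  have [f [smooth_f f0]] := empty_avoidance_sextic R; exists f.
  rewrite f0 /connected_components image_set0 II0.
  by split; [exact: smooth_f|rewrite card_eq0|].
have [->|m5] := eqVneq m 5%N; first exact: disc_sextic_components R _ _ _ _ _ disc5_good.
have [->|m8] := eqVneq m 8%N; first exact: disc_sextic_components R _ _ _ _ _ disc8_good.
have /allP/(_ m) := selections_good.
rewrite mem_iota m0 /= add1n ltnS hm !inE (negPf m5) (negPf m8) /= => /(_ isT).
rewrite /check_selection; case: (selection m) => i S.
move=> /and5P[S0 ic S_lt /eqP size_m /andP[wit compl]].
have /(all_nthP config0)/(_ i ic) good := configs_good.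
exact: (selection_sextic R good S_lt S0 m0 size_m wit compl).
Qed.
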